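(* Up to isometries of $\mathbb{R}^2$, the ''Figure Eight'' $\mathcal{F}$ is the unique minimizer of the functional $F$ among all planar closed curves with at least one self-intersection (that is, regular curves $\varphi:\mathbb{S}^1\to\mathbb{R}^2$ of class $H^2$ for which there exist $s_1\neq s_2\in\mathbb{S}^1$ with $\varphi(s_1)=\varphi(s_2)$). Moreover, one of the two drops of $\mathcal{F}$ is (up to isometries of $\mathbb{R}^2$) the unique minimizer of $$\inf\{F(\gamma)\mid \gamma \text{ is a drop}\}.$$
   Context: For a regular planar curve $\gamma$ of class $H^2$, with scalar curvature $k$ and arclength $s$, $F(\gamma)=\int_\gamma (k^2+1)\,\mathrm{d}s$. Curves are considered up to (regular) reparametrization. A drop is a regular curve $\gamma:[0,1]\to\mathbb{R}^2$ of class $H^2$ such that $\gamma(0)=\gamma(1)$ (no condition is imposed on the tangents at the endpoints). A closed planar elastica is a critical point of $F$ among closed planar curves, i.e. a smooth regular closed curve satisfying $2\partial_s^2k+k^3-k=0$. By a theorem of Langer and Singer, up to isometries of $\mathbb{R}^2$ and multiple coverings, there is a unique closed planar elastica with self-intersections besides the circle and its multiple covers; covered once, it is called the ''Figure Eight'' and denoted by $\mathcal{F}$. It has a single self-intersection point, which divides it into two congruent loops, the ''two drops of $\mathcal{F}$''. *)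

(* Defs.v *)
From HB Require Import structures.
From mathcomp Require Import all_boot all_order all_algebra.
From mathcomp Require Import all_classical all_reals all_analysis.

Set Implicit Arguments.
Unset Strict Implicit.
Unset Printing Implicit Defensive.

Import Order.TTheory GRing.Theory Num.Theory.
Import numFieldNormedType.Exports.

Local Open Scope classical_set_scope.
Local Open Scope ring_scope.

Section PlanarCurves.
Context {R : realType}.

Local Notation mu := (@lebesgue_measure R).
(* The plane. [R * R] carries the sup norm in the library, so the Euclidean
   norm is introduced separately; only the latter is used below. *)
Local Notation plane := (R * R)%type.

Definition enorm (p : plane) : R := Num.sqrt (p.1 ^+ 2 + p.2 ^+ 2).

Definition isometry (Phi : plane -> plane) : Prop :=
  forall p q, enorm (Phi p - Phi q) = enorm (p - q).

(* Sobolev class H^2 = W^{2,2} in one variable, for continuous representatives: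
   absolute continuity on [a, b] is expressed as being the integral of an
   L^1 function. *)

Definition primitive_on (a b : R) (f g : R -> R) : Prop :=
  mu.-integrable `[a, b] (fun t => (g t)%:E) /\
  forall t, a <= t <= b -> f t = f a + \int[mu]_(u in `[a, t]) g u.

(* [f] is of class H^2 on [a, b] and [df] is its derivative there (one-sided at
   [a] and [b]); [df] is absolutely continuous, hence continuous, on [a, b], so
   its values on [a, b] are determined by those of [f]. *)
Definition H2_with_derivative (a b : R) (f df : R -> R) : Prop :=
  primitive_on a b f df /\
  exists ddf : R -> R, primitive_on a b df ddf /\
    mu.-integrable `[a, b] (fun t => (ddf t ^+ 2)%:E).

Definition regular_H2_curve (a b : R) (c : R -> plane) : Prop :=
  exists v : R -> plane,
    [/\ H2_with_derivative a b (fst \o c) (fst \o v),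
        H2_with_derivative a b (snd \o c) (snd \o v) &
        forall t, a <= t <= b -> v t <> (0, 0)].

(* The derivatives below are the library's pointwise derivatives. For a curve of
   class H^2 the first one exists everywhere and the second one almost
   everywhere, which is enough for [energy]. *)

Definition velocity (c : R -> plane) (t : R) : plane :=
  (derive1 (fst \o c) t, derive1 (snd \o c) t).

Definition speed (c : R -> plane) (t : R) : R := enorm (velocity c t).

Definition curvature (c : R -> plane) (t : R) : R :=
  let v := velocity c t in
  let w := velocity (velocity c) t in
  (v.1 * w.2 - v.2 * w.1) / speed c t ^+ 3.

Definition arclength_derivative (c : R -> plane) (f : R -> R) (t : R) : R :=
  derive1 f t / speed c t.

Definition energy (a b : R) (c : R -> plane) : \bar R :=
  (\int[mu]_(t in `]a, b[) ((curvature c t ^+ 2 + 1) * speed c t)%:E)%E.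

(* Closed curves: the circle is R/Z, so maps on it are 1-periodic maps on R. *)

Definition periodic1 (c : R -> plane) : Prop := forall t, c (t + 1) = c t.

Definition closed_curve (c : R -> plane) : Prop :=
  periodic1 c /\ forall a b, a < b -> regular_H2_curve a b c.

Definition self_intersecting (c : R -> plane) : Prop :=
  exists s1 s2 : R,
    [/\ 0 <= s1 < 1, 0 <= s2 < 1, s1 <> s2 & c s1 = c s2].

(* Lift to R of a regular reparametrization of R/Z, of degree 1 or -1. *)
Definition circle_reparametrization (sigma : R -> R) : Prop :=
  ((forall t, sigma (t + 1) = sigma t + 1) \/
   (forall t, sigma (t + 1) = sigma t - 1)) /\
  forall a b, a < b -> exists dsigma : R -> R,
    H2_with_derivative a b sigma dsigma /\
    forall t, a <= t <= b -> dsigma t <> 0.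

Definition closed_congruent (c d : R -> plane) : Prop :=
  exists (Phi : plane -> plane) (sigma : R -> R),
    [/\ isometry Phi, circle_reparametrization sigma &
        forall t, d t = Phi (c (sigma t))].

Definition is_drop (c : R -> plane) : Prop :=
  regular_H2_curve 0 1 c /\ c 0 = c 1.

Definition segment_reparametrization (sigma : R -> R) : Prop :=
  ((sigma 0 = 0 /\ sigma 1 = 1) \/ (sigma 0 = 1 /\ sigma 1 = 0)) /\
  exists dsigma : R -> R,
    H2_with_derivative 0 1 sigma dsigma /\
    forall t, 0 <= t <= 1 -> dsigma t <> 0.

(* Only the values on [0, 1] are part of a drop. *)
Definition drop_congruent (c d : R -> plane) : Prop :=
  exists (Phi : plane -> plane) (sigma : R -> R),
    [/\ isometry Phi, segment_reparametrization sigma &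
        forall t, 0 <= t <= 1 -> d t = Phi (c (sigma t))].

Definition minimizer (C : (R -> plane) -> Prop) (E : (R -> plane) -> \bar R)
    (c : R -> plane) : Prop :=
  C c /\ forall d, C d -> (E c <= E d)%E.

Definition unique_minimizer_up_to (eqv : (R -> plane) -> (R -> plane) -> Prop)
    (C : (R -> plane) -> Prop) (E : (R -> plane) -> \bar R)
    (c : R -> plane) : Prop :=
  minimizer C E c /\ forall d, minimizer C E d -> eqv c d.

Definition smooth (f : R -> R) : Prop :=
  forall n t, derivable (derive1n n f) t 1.

Definition closed_elastica (c : R -> plane) : Prop :=
  [/\ periodic1 c,
      smooth (fst \o c) /\ smooth (snd \o c),
      forall t, velocity c t <> (0, 0) &
      forall t,
        let k := curvature c in
        2 * arclength_derivative c (arclength_derivative c k) t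
          + k t ^+ 3 - k t = 0].

(* A regular closed curve valued in a circle is that circle, covered one or
   several times. *)
Definition covers_circle (c : R -> plane) : Prop :=
  exists (p : plane) (r : R), 0 < r /\ forall t, enorm (c t - p) = r.

Definition multiple_cover (c : R -> plane) : Prop :=
  exists (m : nat) (d : R -> plane) (sigma : R -> R),
    [/\ (1 < m)%N, closed_curve d, circle_reparametrization sigma &
        forall t, c t = d (m%:R * sigma t)].

(* By the Langer-Singer theorem these conditions determine the curve up to
   isometry and reparametrization. *)
Definition figure_eight (c : R -> plane) : Prop :=
  [/\ closed_elastica c, self_intersecting c,
      ~ covers_circle c & ~ multiple_cover c].

(* [d] is one of the loops cut out of the closed curve [c] by a
   self-intersection point; letting [s2] exceed 1 gives the complementary loop
   [s2, s1 + 1] as well. *)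
Definition loop_of (c d : R -> plane) : Prop :=
  exists s1 s2 : R,
    [/\ s1 < s2 < s1 + 1, c s1 = c s2 &
        forall t, d t = c (s1 + t * (s2 - s1))].

End PlanarCurves.

(* Main.v *)
(* Parametrize a curve by its speed rho and its tangent angle theta. Along a drop,
   let [al - beta, al + beta] be the range of theta and nu = - cos beta, which is
   positive because the chord vanishes. For the same reason the integral of
   rho cos (theta - al) is zero, and F is the integral of
     theta'^2 / rho + rho (1 + cos (theta - al) / nu)
       >= 2 |theta'| sqrt (1 + cos (theta - al) / nu),
   hence at least twice the integral of sqrt (1 + cos / nu) over [-beta, beta].
   With nu = 2 m - 1 this bound is the energy of half a period of the wavelike
   elastica of modulus sqrt m; as a function of m it is smallest exactly at the
   zero of [abscissa], the modulus for which half a period closes up. Equality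
   forces theta' = rho sqrt (1 + cos (theta - al) / nu), so that a minimal drop is
   this half period, up to isometry and reparametrization.

   A self-intersecting closed curve consists of two drops, so its energy is at
   least twice the minimum. In case of equality both loops are minimal, and since
   their tangents agree at the double point, the second one is the reflection of
   the first: together they form a full period of the closed wave.

   For an elastica the vector (k^2 - 1) T + 2 k_s N is constant along the curve.
   This integrates the equation: a closed elastica is a circle or a wave whose
   modulus is a zero of [abscissa], covered several times unless it consists of
   one period. Figure eights therefore have exactly twice the minimal energy, and
   each of their loops, having at least the minimal energy, is a minimal drop. *)
Require Import Defs.
From HB Require Import structures.
From mathcomp Require Import all_boot all_order all_algebra.
From mathcomp Require Import all_classical all_reals all_analysis.
From mathcomp Require Import measurable_realfun ring lra.

Set Implicit Arguments.
Unset Strict Implicit.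
Unset Printing Implicit Defensive.

Import Order.TTheory GRing.Theory Num.Theory.
Import numFieldNormedType.Exports.

Local Open Scope classical_set_scope.
Local Open Scope ring_scope.

(** The multiplier [nu^-1] belongs to the closing condition: adding [nu^-1 * x] to the energy leaves
    its total unchanged. The value [nu = - cos beta] makes [1 + cos / nu] vanish exactly at the
    extreme angles and positive between them. If [beta >= pi] no such choice exists; [nu = 1] is
    taken, the degenerate modulus 1.

    Two obstacles shape the argument. The angle is merely absolutely continuous and need not be
    monotone, so the bound is the increment of a potential [P (theta)] between a time of minimal and
    a time of maximal angle, not a change of variables. In the equality case the equation for
    [theta] is not Lipschitz at the rest angles [- beta] and [beta], so a solution may stay there;
    such a stay is a straight segment running backwards, which the closing condition excludes, and
    in between the amplitude turns the equation into a linear one.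

    Minimality in [m] needs no theory of elliptic integrals: a tangent line in [m] and the
    arithmetic-geometric inequality suffice. The comparison is strict at any zero of [abscissa], so
    each figure eight can be treated with its own modulus. *)

(** * Derivation rules for real functions and consequences of the mean value theorem *)

Section RealDerivatives.
Context {R : realType}.
Implicit Types (x y a b c : R) (f g : R -> R).

(** The rules below produce derivatives in whatever shape they come; this turns the comparison with
    the wanted value into a separate equation for [ring] or [field]. *)
Lemma der_eq f x a b : is_derive x 1 f a -> a = b -> is_derive x 1 f b.
Proof. by move=> df <-. Qed.

Lemma derD f g x a b : is_derive x 1 f a -> is_derive x 1 g b ->
  is_derive x 1 (fun y => f y + g y) (a + b).
Proof. by move=> df dg; exact: (is_deriveD df dg). Qed.

Lemma derN f x a : is_derive x 1 f a -> is_derive x 1 (fun y => - f y) (- a).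
Proof. by move=> df; exact: (is_deriveN df). Qed.

Lemma derB f g x a b : is_derive x 1 f a -> is_derive x 1 g b ->
  is_derive x 1 (fun y => f y - g y) (a - b).
Proof. by move=> df dg; exact: (is_deriveB df dg). Qed.

Lemma derM f g x a b : is_derive x 1 f a -> is_derive x 1 g b ->
  is_derive x 1 (fun y => f y * g y) (a * g x + f x * b).
Proof.
move=> df dg.
apply: (der_eq (is_deriveM df dg : is_derive x 1 (fun y => f y * g y) _)).
by rewrite /GRing.scale/= addrC mulrC.
Qed.

Lemma derC c x : is_derive x 1 (fun=> c) 0.
Proof. exact: is_derive_cst. Qed.

Lemma derI x : is_derive x 1 (fun y => y) 1.
Proof. exact: is_derive_id. Qed.

Lemma derZ c f x a : is_derive x 1 f a -> is_derive x 1 (fun y => c * f y) (c * a).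
Proof.
by move=> df; apply: (der_eq (derM (derC c x) df)); rewrite mul0r add0r.
Qed.

Lemma der_comp f g x a b : is_derive (g x) 1 f a -> is_derive x 1 g b ->
  is_derive x 1 (fun y => f (g y)) (a * b).
Proof. exact: is_derive1_comp. Qed.

Lemma derX f n x a : is_derive x 1 f a ->
  is_derive x 1 (fun y => f y ^+ n) (n%:R * f x ^+ n.-1 * a).
Proof.
move=> df; case: n => [|n].
  by rewrite mul0r mul0r; apply: derC.
elim: n => [|n ih]; first by rewrite expr0 mulr1 mul1r.
have -> : (fun y => f y ^+ n.+2) = (fun y => f y * f y ^+ n.+1).
  by apply/funext => y; rewrite exprS.
apply: (der_eq (derM df ih)).
by rewrite /= exprS [in RHS]mulrS; ring.
Qed.

Lemma derV f x a : f x != 0 -> is_derive x 1 f a ->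
  is_derive x 1 (fun y => (f y)^-1) (- a / f x ^+ 2).
Proof.
move=> f0 df.
apply: (der_eq (is_deriveV f0 df : is_derive x 1 (fun y => (f y)^-1) _)).
by rewrite /GRing.scale/= mulNr mulNr mulrC.
Qed.

Lemma der_div f g x a b : g x != 0 -> is_derive x 1 f a -> is_derive x 1 g b ->
  is_derive x 1 (fun y => f y / g y) ((a * g x - f x * b) / g x ^+ 2).
Proof.
move=> g0 df dg; apply: (der_eq (derM df (derV g0 dg))).
by field.
Qed.

Lemma der_sin f x a : is_derive x 1 f a ->
  is_derive x 1 (fun y => sin (f y)) (cos (f x) * a).
Proof. by apply: der_comp; exact: is_derive_sin. Qed.

Lemma der_cos f x a : is_derive x 1 f a ->
  is_derive x 1 (fun y => cos (f y)) (- sin (f x) * a).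
Proof. by apply: der_comp; exact: is_derive_cos. Qed.

Lemma der_sqrt f x a : 0 < f x -> is_derive x 1 f a ->
  is_derive x 1 (fun y => Num.sqrt (f y)) (a / (2 * Num.sqrt (f x))).
Proof.
move=> f0 df; apply: (der_eq (der_comp (is_derive1_sqrt f0) df)).
by rewrite mulrC.
Qed.

Lemma der_continuous f x a : is_derive x 1 f a -> {for x, continuous f}.
Proof. by move=> [df _]; apply/differentiable_continuous/derivable1_diffP. Qed.

Lemma der_inj f x a b : is_derive x 1 f a -> is_derive x 1 f b -> a = b.
Proof. by move=> [_ <-] [_ <-]. Qed.

Lemma der_derive1 f x a : is_derive x 1 f a -> derive1 f x = a.
Proof. by move=> [_ <-]; rewrite derive1E. Qed.

Lemma derivable_der f x : derivable f x 1 -> is_derive x 1 f (derive1 f x).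
Proof. by move=> df; rewrite derive1E; exact: derivableP. Qed.

Lemma der_within (a b : R) f g : (forall x, is_derive x 1 f (g x)) ->
  {within `[a, b], continuous f}.
Proof. by move=> df; apply: continuous_subspaceT => x; exact: der_continuous (df x). Qed.

(** Differentiability is asked only inside the interval because some integrands degenerate at its
    ends: [delta 1] vanishes at [pi / 2]. *)
Lemma der_ge0_le a b f g : {within `[a, b], continuous f} ->
  (forall x, a < x < b -> is_derive x 1 f (g x)) ->
  (forall x, a < x < b -> 0 <= g x) -> a <= b -> f a <= f b.
Proof.
move=> cf df g0; rewrite le_eqVlt => /predU1P[->//|ab].
have dv x : x \in `]a, b[ -> is_derive x 1 f (g x) by rewrite in_itv/=; exact: df.
have [c] := @MVT _ f g a b ab dv cf.
by rewrite in_itv/= => /g0 gc fE; rewrite -subr_ge0 fE mulr_ge0// subr_ge0 ltW.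
Qed.

Lemma der_gt0_lt a b f g : {within `[a, b], continuous f} ->
  (forall x, a < x < b -> is_derive x 1 f (g x)) ->
  (forall x, a < x < b -> 0 < g x) -> a < b -> f a < f b.
Proof.
move=> cf df g0 ab.
have dv x : x \in `]a, b[ -> is_derive x 1 f (g x) by rewrite in_itv/=; exact: df.
have [c] := @MVT _ f g a b ab dv cf.
by rewrite in_itv/= => /g0 gc fE; rewrite -subr_gt0 fE mulr_gt0// subr_gt0.
Qed.

Lemma der0_eq a b f : {within `[a, b], continuous f} ->
  (forall x, a < x < b -> is_derive x 1 f 0) -> a <= b -> f a = f b.
Proof.
move=> cf df; rewrite le_eqVlt => /predU1P[->//|ab].
have dv x : x \in `]a, b[ -> is_derive x 1 f 0 by rewrite in_itv/=; exact: df.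
have [c _] := @MVT _ f (fun=> 0) a b ab dv cf.
by rewrite mul0r => /eqP; rewrite subr_eq0 => /eqP ->.
Qed.

End RealDerivatives.

(** * Absolutely continuous functions as primitives of integrable ones *)

Section Primitives.
Context {R : realType}.
Local Notation mu := (@lebesgue_measure R).
Implicit Types (a b s t : R) (f g F : R -> R).

Lemma subset_segment a b s t : a <= s -> t <= b -> `[s, t] `<=` `[a, b].
Proof.
move=> as_ tb x /=; rewrite !in_itv/= => /andP[sx xt].
by rewrite (le_trans as_ sx) (le_trans xt tb).
Qed.

Lemma primitive_onW a b s t f g : primitive_on a b f g ->
  a <= s -> t <= b -> primitive_on s t f g.
Proof.
move=> [ig fE] as_ tb; split.
  by apply: integrableS ig => //; exact: subset_segment.
move=> u /andP[su ut]; have au : a <= u by exact: le_trans su.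
have ub : u <= b by exact: le_trans tb.
have sb : s <= b by exact: le_trans su ub.
rewrite fE ?au// [X in _ = X + _]fE ?as_// -addrA; congr (_ + _).
have iu : mu.-integrable `[a, u] (EFin \o g).
  by apply: integrableS ig => //; exact: subset_segment.
apply/eqP; rewrite addrC -subr_eq; apply/eqP.
rewrite Rintegral_itvB//= ?bnd_simp//.
rewrite Rintegral_itv_obnd_cbnd//; apply: integrableS iu => //.
by move=> x /=; rewrite !in_itv/= => /andP[sx ->]; rewrite (le_trans as_ (ltW sx)).
Qed.

Lemma primitive_on_incr a b f g s t : primitive_on a b f g ->
  a <= s -> s <= t -> t <= b -> f t - f s = \int[mu]_(u in `[s, t]) g u.
Proof.
move=> pfg as_ st tb; have [_ ->] := primitive_onW pfg as_ tb.
  by rewrite addrC addKr.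
by rewrite st lexx.
Qed.

Lemma primitive_on_eq a b f g h k : primitive_on a b f g ->
  (forall t, a <= t <= b -> f t = h t) -> (forall t, a <= t <= b -> g t = k t) ->
  primitive_on a b h k.
Proof.
move=> [ig fE] fh gk; split.
  apply: eq_integrable ig => // x /[1!inE]/=; rewrite in_itv/= => xab.
  by rewrite gk.
move=> t /[dup] tab /andP[at_ tb]; rewrite -!fh ?lexx ?(le_trans at_)// fE//.
congr (_ + _); apply: eq_Rintegral => x /[1!inE]/=; rewrite in_itv/= => /andP[ax xt].
by rewrite gk// ax (le_trans xt).
Qed.

Lemma primitive_onD a b f g h k : primitive_on a b f g -> primitive_on a b h k ->
  primitive_on a b (fun t => f t + h t) (fun t => g t + k t).
Proof.
move=> [ig fE] [ik hE]; split; first exact: (integrableD _ ig ik).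
move=> t /[dup] tab /andP[at_ tb]; rewrite fE// hE// RintegralD//; first lra.
  by apply: integrableS ig => //; exact: subset_segment.
by apply: integrableS ik => //; exact: subset_segment.
Qed.

Lemma primitive_onZ a b (c : R) f g : primitive_on a b f g ->
  primitive_on a b (fun t => c * f t) (fun t => c * g t).
Proof.
move=> [ig fE]; split; first exact: (integrableZl _ _ ig).
move=> t /[dup] tab /andP[at_ tb]; rewrite fE// RintegralZl//; first lra.
by apply: integrableS ig => //; exact: subset_segment.
Qed.

Lemma primitive_onN a b f g : primitive_on a b f g ->
  primitive_on a b (fun t => - f t) (fun t => - g t).
Proof.
by move=> /(primitive_onZ (-1)) p; apply: primitive_on_eq p _ _ => t _; rewrite mulN1r.
Qed.

Lemma primitive_onB a b f g h k : primitive_on a b f g -> primitive_on a b h k ->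
  primitive_on a b (fun t => f t - h t) (fun t => g t - k t).
Proof. by move=> p /primitive_onN q; exact: primitive_onD. Qed.

Lemma primitive_on_cst a b (c : R) : primitive_on a b (cst c) (cst 0).
Proof.
split; first by apply: (eq_integrable _ (cst 0%E)) => //; exact: integrable0.
by move=> t _; rewrite /= Rintegral_cst// mul0r addr0.
Qed.

Lemma primitive_on_continuous a b f g : a <= b -> primitive_on a b f g ->
  {within `[a, b], continuous f}.
Proof.
move=> ab [ig fE].
have := parameterized_integral_continuous ab ig; rewrite /parameterized_integral => ci.
have cf : {within `[a, b], continuous (fun x : R => f a + \int[mu]_(t in `[a, x]) g t)}.
  by move=> x; apply: cvgD; [exact: cvg_cst|exact: ci].
apply: (subspace_eq_continuous _ cf) => x /[1!inE]/=.
by rewrite in_itv/= => /fE.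
Qed.

Lemma primitive_on_le a b f g s t : primitive_on a b f g ->
  (forall u, a <= u <= b -> 0 <= g u) -> a <= s -> s <= t -> t <= b -> f s <= f t.
Proof.
move=> p g0 as_ st tb; rewrite -subr_ge0 (primitive_on_incr p)//.
apply: Rintegral_ge0 => x; rewrite /= in_itv/= => /andP[sx xt].
by apply: g0; rewrite (le_trans as_ sx) (le_trans xt tb).
Qed.

End Primitives.

(** * Continuity and integrability on a segment *)

Section WithinContinuity.
Context {R : realType}.
Local Notation mu := (@lebesgue_measure R).
Implicit Types (a b s t : R) (f g F : R -> R).

Lemma within_distP a b f : {within `[a, b], continuous f} <->
  forall x, a <= x <= b -> forall e, 0 < e -> exists2 d, 0 < d &
    forall y, a <= y <= b -> `|y - x| < d -> `|f y - f x| < e.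
Proof.
rewrite subspace_continuousP; split=> [cf x xab e e0|cf x /=].
  have := cf x; rewrite /= in_itv/= => /(_ xab) /cvgrPdist_lt /(_ e e0).
  rewrite near_withinE => /nbhs_ballP[d /= d0 dP]; exists d => // y yab yx.
  rewrite distrC; apply: dP; last by rewrite /= in_itv.
  by rewrite /ball/= distrC.
rewrite in_itv/= => xab; apply/cvgrPdist_lt => e e0.
have [d d0 dP] := cf x xab e e0.
rewrite near_withinE; apply/nbhs_ballP; exists d => // y yx.
rewrite /= in_itv/= => yab; rewrite distrC; apply: dP => //.
by rewrite distrC.
Qed.

Lemma withinW a b s t f : a <= s -> t <= b ->
  {within `[a, b], continuous f} -> {within `[s, t], continuous f}.
Proof. by move=> as_ tb; apply: continuous_subspaceW; exact: subset_segment. Qed.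

Lemma withinT a b f : continuous f -> {within `[a, b], continuous f}.
Proof. exact: continuous_subspaceT. Qed.

Lemma within_comp a b f (G : R -> R) : {within `[a, b], continuous f} ->
  (forall x, a <= x <= b -> {for f x, continuous G}) ->
  {within `[a, b], continuous (G \o f)}.
Proof.
move=> cf cG; apply/subspace_continuousP => x /=; rewrite in_itv/= => xab.
move/subspace_continuousP : cf => /(_ x); rewrite /= in_itv/= => /(_ xab) cf.
by apply: cvg_comp; [exact: cf|exact: cG].
Qed.

Lemma withinD a b f g : {within `[a, b], continuous f} ->
  {within `[a, b], continuous g} -> {within `[a, b], continuous (fun x => f x + g x)}.
Proof. by move=> cf cg x; apply: cvgD; [exact: cf|exact: cg]. Qed.

Lemma withinB a b f g : {within `[a, b], continuous f} ->
  {within `[a, b], continuous g} -> {within `[a, b], continuous (fun x => f x - g x)}.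
Proof. by move=> cf cg x; apply: cvgB; [exact: cf|exact: cg]. Qed.

Lemma withinN a b f : {within `[a, b], continuous f} ->
  {within `[a, b], continuous (fun x => - f x)}.
Proof. by move=> cf x; apply: cvgN; exact: cf. Qed.

Lemma withinM a b f g : {within `[a, b], continuous f} ->
  {within `[a, b], continuous g} -> {within `[a, b], continuous (fun x => f x * g x)}.
Proof. by move=> cf cg x; apply: cvgM; [exact: cf|exact: cg]. Qed.

Lemma withinV a b f : {within `[a, b], continuous f} ->
  (forall x, a <= x <= b -> f x != 0) ->
  {within `[a, b], continuous (fun x => (f x)^-1)}.
Proof.
move=> cf f0; apply: (@within_comp a b f (fun y => y^-1)) => // x xab.
by apply: inv_continuous; exact: f0.
Qed.

Lemma withinX a b f n : {within `[a, b], continuous f} ->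
  {within `[a, b], continuous (fun x => f x ^+ n)}.
Proof.
move=> cf; apply: (@within_comp a b f (fun y => y ^+ n)) => // x _.
exact: exprn_continuous.
Qed.

Lemma within_cst a b (c : R) : {within `[a, b], continuous (fun _ => c)}.
Proof. by apply: withinT; exact: cst_continuous. Qed.

Lemma within_bounded a b f : {within `[a, b], continuous f} ->
  exists2 M, 0 < M & forall x, a <= x <= b -> `|f x| <= M.
Proof.
move=> cf; have [ab|ba] := leP a b; last first.
  by exists 1 => // x /andP[ax xb]; have := le_trans ax xb; rewrite leNgt ba.
have cn : {within `[a, b], continuous (fun x => `|f x|)}.
  by apply: (@within_comp a b f (fun y => `|y|)) => // x _; exact: norm_continuous.
have [c _ cP] := EVT_max ab cn; exists (`|f c| + 1); first by rewrite ltr_wpDl.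
by move=> x xab; rewrite (le_trans (cP x _))// ?in_itv//= lerDl.
Qed.

Lemma integrable_within a b f : {within `[a, b], continuous f} ->
  mu.-integrable `[a, b] (EFin \o f).
Proof. by move=> cf; apply: continuous_compact_integrable => //; exact: segment_compact. Qed.

Lemma integrable_withinM a b f g : {within `[a, b], continuous f} ->
  mu.-integrable `[a, b] (EFin \o g) -> mu.-integrable `[a, b] (fun x => (f x * g x)%:E).
Proof.
move=> cf ig.
have [M M0 fM] := within_bounded cf.
apply: (@le_integrable _ _ _ mu _ _ _ (fun x => (M * g x)%:E)) => //.
- apply/measurable_EFinP; apply: measurable_funM.
    exact: subspace_continuous_measurable_fun.
  by apply/measurable_EFinP; exact: measurable_int ig.
- move=> x /=; rewrite in_itv/= => xab; rewrite lee_fin !normrM.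
  by rewrite ler_wpM2r// (le_trans (fM x xab))// ler_norm.
- exact: (integrableZl _ _ ig).
Qed.

Lemma integrable_normr a b g : mu.-integrable `[a, b] (EFin \o g) ->
  mu.-integrable `[a, b] (EFin \o (fun x => `|g x|)).
Proof. by move=> ig; apply: integrable_norm => //. Qed.

(** Increment bounds add up over adjacent segments, so the set of times up to which the bound holds
    cannot have a supremum before [b]: the neighbourhood of that supremum would carry the bound
    beyond it. *)
Lemma local_increment_bound a b (D N : R -> R) : a <= b ->
  (forall x, a <= x <= b -> exists2 d, 0 < d & forall s t, a <= s -> s <= t ->
     t <= b -> `|s - x| < d -> `|t - x| < d -> `|D t - D s| <= N t - N s) ->
  `|D b - D a| <= N b - N a.
Proof.
move=> ab loc; pose S := [set t | a <= t <= b /\ `|D t - D a| <= N t - N a].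
have Sa : S a by split; rewrite ?lexx// !subrr normr0.
have Sb : ubound S b by move=> t [/andP[]].
have hS : has_sup S by split; [exists a|exists b].
have aS : a <= sup S by apply: ub_le_sup => //; exists b.
have Sb' : sup S <= b by apply: ge_sup => //; exists a.
have [d d0 dP] := loc (sup S) ltac:(by rewrite aS Sb').
have [s [/andP[as_ sb] sS] sd] := sup_adherent d0 hS.
have ss : s <= sup S by apply: ub_le_sup; [exists b|split; rewrite ?as_].
have key t : s <= t -> t <= b -> t < sup S + d -> S t.
  move=> st tb td; split; first by rewrite tb (le_trans as_ st).
  have := dP s t as_ st tb.
  have -> : `|s - sup S| < d by rewrite ltr_norml; apply/andP; split; lra.
  have -> : `|t - sup S| < d by rewrite ltr_norml; apply/andP; split; lra.
  move=> /(_ isT isT) ts.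
  have -> : D t - D a = (D t - D s) + (D s - D a) by ring.
  by rewrite (le_trans (ler_normD _ _))// (le_trans (lerD ts sS))//; lra.
have [bs|sb'] := ltP b (sup S + d).
  by have [] := key b sb (lexx _) bs.
have : S (sup S + d / 2) by apply: key; lra.
move=> /(ub_le_sup _) => /(_ (ex_intro _ b Sb)); lra.
Qed.

End WithinContinuity.

(** * Chain and product rules for absolutely continuous functions *)

Section ChainRule.
Context {R : realType}.
Local Notation mu := (@lebesgue_measure R).
Implicit Types (a b s t : R) (f g F : R -> R).

(* [F] need only be differentiable at the values of [f]: between two of them,
   the mean value theorem is applied on a segment of values of [f]. *)
Lemma increment_comp a b f g F dF : a <= b -> primitive_on a b f g ->
  (forall t, a <= t <= b -> is_derive (f t) 1 F (dF (f t))) ->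
  {within `[a, b], continuous (dF \o f)} ->
  F (f b) = F (f a) + \int[mu]_(u in `[a, b]) (dF (f u) * g u).
Proof.
move=> ab pfg dFf cdF; have ig := integrable_withinM cdF pfg.1.
pose I t := \int[mu]_(u in `[a, t]) (dF (f u) * g u).
have pI : primitive_on a b I (fun t => dF (f t) * g t).
  by split=> // t _; rewrite /I set_itv1 Rintegral_set1 add0r.
pose A t := \int[mu]_(u in `[a, t]) `|g u|.
have pA : primitive_on a b A (fun t => `|g t|).
  split; first exact: integrable_normr pfg.1.
  by move=> t _; rewrite /A set_itv1 Rintegral_set1 add0r.
(* Absolute continuity of [F \o f] is not shown directly: it is enough that its increments differ
   from those of [I] by at most [e] times those of [A], for every [e], and such bounds can be
   checked locally. *)
suff small e : 0 < e -> `|F (f b) - I b - (F (f a) - I a)| <= e * (A b - A a).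
  have A0 : 0 <= A b - A a.
    by rewrite subr_ge0; apply: (primitive_on_le pA).
  have : F (f b) - I b - (F (f a) - I a) = 0.
    apply/eqP; rewrite -normr_le0; apply/ler_addgt0Pl => e e0; rewrite addr0.
    have e1 : 0 < e / (A b - A a + 1) by rewrite divr_gt0// ltr_wpDl.
    apply: (le_trans (small _ e1)); rewrite mulrAC ler_pdivrMr ?ltr_wpDl//.
    by rewrite ler_wpM2l ?(ltW e0)// lerDl.
  rewrite -/(I b) [I a](_ : _ = 0); first by lra.
  by rewrite /I set_itv1 Rintegral_set1.
move=> e0; rewrite mulrBr.
apply: (@local_increment_bound _ a b (fun t => F (f t) - I t) (fun t => e * A t)) => //.
move=> x xab; have e2 : 0 < e / 2 by rewrite divr_gt0.
have [d d0 dP] := (within_distP _ _ _).1 cdF x xab _ e2.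
exists d => // s t as_ st tb sx tx.
have cf : {within `[s, t], continuous f}.
  by apply: primitive_on_continuous => //; apply: primitive_onW pfg _ _.
have [u /andP[su ut] uE] : exists2 u, s <= u <= t &
    F (f t) - F (f s) = dF (f u) * (f t - f s).
  have wlg y z : s <= y <= t -> s <= z <= t -> f y <= f z ->
      exists2 u, s <= u <= t & F (f z) - F (f y) = dF (f u) * (f z - f y).
    move=> yst zst yz.
    have val v : v \in `[f y, f z] -> exists2 u, s <= u <= t & f u = v.
      rewrite in_itv/= => /andP[yv vz].
      have [yz'|zy] := leP y z.
        have cyz : {within `[y, z], continuous f}.
          by apply: withinW cf; [case/andP: yst|case/andP: zst].
        have [|c] := IVT (v := v) yz' cyz.
          by rewrite ge_min yv le_max vz orbT.
        rewrite in_itv/= => /andP[yc cz] cv; exists c => //.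
        by case/andP: yst => sy _; case/andP: zst => _ zt; lra.
      have cyz : {within `[z, y], continuous f}.
        by apply: withinW cf; [case/andP: zst|case/andP: yst].
      have [|c] := IVT (v := v) (ltW zy) cyz.
        by rewrite ge_min yv orbT le_max vz.
      rewrite in_itv/= => /andP[yc cz] cv; exists c => //.
      by case/andP: yst => ? ?; case/andP: zst => ? ?; lra.
    have dv v : v \in `[f y, f z] -> is_derive v 1 F (dF v).
      move=> /val[u /andP[su ut] <-]; apply: dFf.
      by rewrite (le_trans as_ su) (le_trans ut tb).
    have cF : {within `[f y, f z], continuous F}.
      by apply: derivable_within_continuous => v /dv [].
    have dv' v : v \in `]f y, f z[ -> is_derive v 1 F (dF v).
      by move=> vyz; apply: dv; exact: subset_itv_oo_cc vyz.
    have [c cyz cE] := @MVT_segment _ F dF _ _ yz dv' cF.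
    by have [u sut uc] := val c cyz; exists u => //; rewrite uc.
  have [fst_|fts] := leP (f s) (f t).
    by apply: wlg => //; rewrite ?lexx ?st.
  have [||u sut uE] := wlg t s _ _ (ltW fts); rewrite ?lexx ?st//.
  by exists u => //; rewrite -opprB uE -mulrN opprB.
have igst : mu.-integrable `[s, t] (EFin \o g).
  by apply: integrableS pfg.1 => //; exact: subset_segment.
have igst' : mu.-integrable `[s, t] (EFin \o (fun t => dF (f t) * g t)).
  by apply: integrableS ig => //; exact: subset_segment.
have igc : mu.-integrable `[s, t] (EFin \o (fun t => dF (f u) * g t)).
  exact: (integrableZl _ _ igst).
have -> : F (f t) - I t - (F (f s) - I s) = F (f t) - F (f s) - (I t - I s) by ring.
rewrite uE (primitive_on_incr pfg as_ st tb) (primitive_on_incr pI as_ st tb).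
rewrite -mulrBr (primitive_on_incr pA as_ st tb).
rewrite -RintegralZl// -RintegralB// -RintegralZl//; last exact: integrable_normr igst.
apply: le_trans (le_normr_Rintegral _ _) _ => //; first exact: (integrableB _ igc igst').
apply: le_Rintegral => //.
- by apply: integrable_normr; exact: (integrableB _ igc igst').
- exact: (integrableZl _ _ (integrable_normr igst)).
move=> w /=; rewrite in_itv/= => /andP[sw wt].
rewrite -mulrBl normrM ler_wpM2r//.
have near_x v : s <= v -> v <= t -> `|dF (f v) - dF (f x)| < e / 2.
  move=> sv vt; apply: dP; first by rewrite (le_trans as_ sv) (le_trans vt tb).
  by move: sx tx; rewrite !ltr_norml => /andP[? ?] /andP[? ?]; apply/andP; split; lra.
have := near_x u su ut; have := near_x w sw wt.
rewrite !ltr_norml => /andP[? ?] /andP[? ?].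
by rewrite ler_norml; apply/andP; split; lra.
Qed.

Lemma primitive_on_comp a b f g F dF : primitive_on a b f g ->
  (forall t, a <= t <= b -> is_derive (f t) 1 F (dF (f t))) ->
  {within `[a, b], continuous (dF \o f)} ->
  primitive_on a b (F \o f) (fun t => dF (f t) * g t).
Proof.
move=> pfg dFf cdF; split; first exact: integrable_withinM cdF pfg.1.
move=> t /andP[at_ tb]; apply: (@increment_comp a t f g F dF) => //.
- exact: primitive_onW pfg (lexx a) tb.
- by move=> u /andP[au ut]; apply: dFf; rewrite au (le_trans ut).
- exact: withinW (lexx a) tb cdF.
Qed.

Lemma primitive_onX2 a b f g : a <= b -> primitive_on a b f g ->
  primitive_on a b (fun t => f t ^+ 2) (fun t => 2 * f t * g t).
Proof.
move=> ab p; apply: (@primitive_on_comp a b f g (fun y => y ^+ 2) (fun y => 2 * y)) => //.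
  move=> t _; apply: (der_eq (derX 2 (derI (f t)))).
  by rewrite /= expr1 mulr1.
by apply: withinM; [exact: within_cst|exact: primitive_on_continuous p].
Qed.

(** Polarization reduces products to the chain rule for squares. *)
Lemma primitive_onM a b f g h k : a <= b -> primitive_on a b f g ->
  primitive_on a b h k ->
  primitive_on a b (fun t => f t * h t) (fun t => f t * k t + g t * h t).
Proof.
move=> ab p q.
have := primitive_onB (primitive_onX2 ab (primitive_onD p q)) (primitive_onX2 ab (primitive_onB p q)).
move=> /(primitive_onZ (4^-1)) r.
by apply: primitive_on_eq r _ _ => t _; field.
Qed.

Lemma within_itvoo a b f x : {within `[a, b], continuous f} -> a < x < b ->
  {for x, continuous f}.
Proof.
move=> cf /andP[ax xb]; have [c _ _] := (continuous_within_itvP _ (lt_trans ax xb)).1 cf.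
by apply: c; rewrite in_itv/= ax.
Qed.

Lemma primitive_on_derive a b f g x : primitive_on a b f g ->
  {within `[a, b], continuous g} -> a < x < b -> is_derive x 1 f (g x).
Proof.
move=> [ig fE] cg /andP[ax xb].
have cgx : {for x, continuous g} by apply: within_itvoo cg _; rewrite ax.
have [dI IE] := continuous_FTC1_closed xb ig ax cgx.
have dJ : is_derive x 1 (fun y => f a + \int[mu]_(t in `[a, y]) g t) (g x).
  have -> : (fun y => f a + \int[mu]_(t in `[a, y]) g t) =
    cst (f a) + (fun y => \int[mu]_(t in `[a, y]) g t) by [].
  rewrite -[g x]add0r; apply: is_deriveD; rewrite -IE derive1E; exact: derivableP.
apply: near_eq_is_derive dJ.
have /near_in_itvoo : x \in `]a, b[ by rewrite in_itv/= ax.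
by apply: filterS => y; rewrite in_itv/= => /andP[/ltW ay /ltW yb]; apply/esym/fE; rewrite ay.
Qed.

Lemma primitive_on_C1 a b f g : {within `[a, b], continuous g} ->
  {within `[a, b], continuous f} ->
  (forall x, a < x < b -> is_derive x 1 f (g x)) -> primitive_on a b f g.
Proof.
move=> cg cf df; split; first exact: integrable_within.
move=> t /andP[]; rewrite le_eqVlt => /predU1P[<-|at_ tb].
  by rewrite set_itv1 Rintegral_set1 addr0.
have dft x : x \in `]a, t[ -> is_derive x 1 f (g x).
  by rewrite in_itv/= => /andP[ax xt]; apply: df; rewrite ax (lt_le_trans xt tb).
have [_ ca ct] := (continuous_within_itvP _ at_).1 (withinW (lexx a) tb cf).
rewrite /Rintegral (@continuous_FTC2 _ g f a t)//=; first by lra.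
- exact: withinW cg.
- by split=> // x /dft [].
- by move=> x /dft; exact: der_derive1.
Qed.

End ChainRule.

(** * Antiderivatives, inverse functions, periodicity and angles on the whole line *)

Section GlobalCalculus.
Context {R : realType}.
Local Notation mu := (@lebesgue_measure R).
Implicit Types (a b s t x y : R) (f g F G : R -> R).

Lemma exists_antiderivative f : continuous f ->
  exists F, forall x, is_derive x 1 F (f x).
Proof.
move=> cf.
exists (fun x => if 0 <= x then \int[mu]_(t in `[0, x]) f t
                 else - \int[mu]_(t in `[x, 0]) f t) => x.
pose M := `|x| + 1.
have xM : - M < x < M.
  by rewrite -ltr_norml /M ltrDl.
pose G y := \int[mu]_(t in `[- M, y]) f t.
have cfM : {within `[- M, M], continuous f} by exact: withinT.
have pG : primitive_on (- M) M G f.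
  split; first exact: integrable_within.
  by move=> t _; rewrite /G set_itv1 Rintegral_set1 add0r.
have dG := primitive_on_derive pG cfM xM.
have dF : is_derive x 1 (fun y => G y - G 0) (f x).
  by apply: (der_eq (derB dG (derC (G 0) x))); rewrite subr0.
apply: near_eq_is_derive dF.
have /near_in_itvoo : x \in `]- M, M[ by rewrite in_itv/=.
apply: filterS => y; rewrite in_itv/= => /andP[/ltW My /ltW yM].
case: ifPn => [y0|]; first by rewrite (primitive_on_incr pG)//; lra.
rewrite -ltNge => y0; rewrite -opprB; congr (- _).
by rewrite (primitive_on_incr pG)//; lra.
Qed.

Lemma der_eq_increment f F G a b : (forall x, is_derive x 1 F (f x)) ->
  (forall x, is_derive x 1 G (f x)) -> F b - F a = G b - G a.
Proof.
move=> dF dG; have d0 x : is_derive x 1 (fun y => F y - G y) 0.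
  by apply: (der_eq (derB (dF x) (dG x))); rewrite subrr.
by have := is_derive_0_is_cst a b d0; lra.
Qed.

Lemma der_pos_mono f F : (forall x, is_derive x 1 F (f x)) -> (forall x, 0 < f x) ->
  {mono F : x y / x <= y}.
Proof.
move=> dF f0; apply: le_mono => x y xy.
by apply: (der_gt0_lt (g := f)) xy => //; exact: der_within dF.
Qed.

Lemma der_pos_inj f F : (forall x, is_derive x 1 F (f x)) -> (forall x, 0 < f x) ->
  injective F.
Proof. by move=> dF f0; exact: inc_inj (der_pos_mono dF f0). Qed.

Lemma der_lbound_surj f F e : (forall x, is_derive x 1 F (f x)) -> 0 < e ->
  (forall x, e <= f x) -> forall y, exists x, F x = y.
Proof.
move=> dF e0 fe y.
have grow a b : a <= b -> F a + e * (b - a) <= F b.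
  move=> ab; suff : F a - e * a <= F b - e * b by lra.
  have dh x : is_derive x 1 (fun x => F x - e * x) (f x - e).
    by apply: (der_eq (derB (dF x) (derZ e (derI x)))); rewrite mulr1.
  apply: (@der_ge0_le _ a b (fun x => F x - e * x) (fun x => f x - e)) => //.
  - exact: der_within dh.
  - by move=> x _; rewrite subr_ge0.
pose M := `|y - F 0| / e.
have M0 : 0 <= M by rewrite divr_ge0// ltW.
have hi := grow 0 M M0; have lo := grow (- M) 0.
have eM : e * M = `|y - F 0| by rewrite /M mulrC divfK// gt_eqF.
have := ler_norm (y - F 0); have := ler_norm (- (y - F 0)); rewrite normrN => h1 h2.
have MM : - M <= M by lra.
have mid : Num.min (F (- M)) (F M) <= y <= Num.max (F (- M)) (F M).
  by rewrite ge_min le_max; apply/andP; split; apply/orP; [left|right]; lra.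
by have [c _ cy] := IVT MM (der_within dF) mid; exists c.
Qed.

Lemma exists_inverse f F : (forall x, is_derive x 1 F (f x)) -> (forall x, 0 < f x) ->
  (forall y, exists x, F x = y) ->
  exists G, [/\ cancel F G, cancel G F & forall y, is_derive y 1 G (f (G y))^-1].
Proof.
move=> dF f0 sF; have [G GP] := choice sF.
have FG : cancel F G by move=> x; apply: (der_pos_inj dF f0); rewrite GP.
exists G; split=> // y; rewrite -{1}(GP y).
apply: is_derive_inverse => //.
- by exists 1 => //= z _; exact: FG.
- by exists 1 => //= z _; exact: der_continuous (dF z).
- by rewrite gt_eqF.
Qed.

Lemma periodic_ind (P : R -> Prop) s : (forall t, P t <-> P (t + 1)) ->
  (forall t, s <= t < s + 1 -> P t) -> forall t, P t.
Proof.
move=> Pp Ps t.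
have Pn (n : nat) u : P u <-> P (u + n%:R).
  elim: n => [|n ih]; first by rewrite addr0.
  by rewrite ih Pp -addrA natr1.
have Pz (n : int) u : P (u - n%:~R) -> P u.
  case: n => n; first by move=> /(Pn n); rewrite subrK.
  rewrite NegzE mulrNz opprK => Pu; apply/(Pn n.+1); exact: Pu.
apply: (Pz (Num.floor (t - s))); apply: Ps.
by have := floor_itv (t - s); rewrite intrD => /andP[]; lra.
Qed.

Lemma periodic_bounded_below f : continuous f -> (forall t, f (t + 1) = f t) ->
  (forall t, 0 < f t) -> exists2 e, 0 < e & forall t, e <= f t.
Proof.
move=> cf pf f0.
have [c _ cP] := EVT_min (@ler01 R) (@withinT _ 0 1 f cf).
exists (f c) => //; apply: (@periodic_ind (fun t => f c <= f t) 0).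
  by move=> t; rewrite pf.
by move=> t /andP[t0 t1]; apply: cP; rewrite in_itv/= t0 ltW// -[X in _ < X]add0r.
Qed.

Lemma exists_angle (u v : R) : u ^+ 2 + v ^+ 2 = 1 -> exists t, cos t = u /\ sin t = v.
Proof.
move=> uv1.
have u1 : -1 <= u <= 1.
  by rewrite -ler_norml -(expr_le1 (n := 2))// -normrX ger0_norm ?sqr_ge0//; nra.
have sE : Num.sqrt (1 - u ^+ 2) = `|v| by rewrite -uv1 addrC addKr sqrtr_sqr.
have [v0|v0] := leP 0 v.
  by exists (acos u); rewrite acosK ?in_itv//= sin_acos// sE ger0_norm.
exists (- acos u); rewrite cosN sinN acosK ?in_itv//= sin_acos// sE ltr0_norm//.
by rewrite opprK.
Qed.

Lemma eq_angle (x y : R) : cos x = cos y -> sin x = sin y ->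
  exists n : int, x = y + n%:~R * (2 * pi).
Proof.
move=> cxy sxy; have pi0 := pi_gt0 R.
have c1 : cos (x - y) = 1 by rewrite cosB cxy sxy -!expr2 cos2Dsin2.
pose n := Num.floor ((x - y) / (2 * pi)); exists n.
pose r := (x - y) / (2 * pi) - n%:~R.
have /andP[r0 r1] : 0 <= r < 1.
  by have := floor_itv ((x - y) / (2 * pi)); rewrite -/n intrD /r => /andP[]; lra.
have xyE : x - y = 2 * pi * r + n%:~R * (2 * pi).
  by rewrite /r mulrBr mulrC divfK ?[2 * pi * _]mulrC ?subrK// mulf_neq0// gt_eqF.
have per (z : R) (k : nat) : cos (z + k%:R * (2 * pi)) = cos z.
  elim: k => [|k ih]; first by rewrite mul0r addr0.
  have -> : z + k.+1%:R * (2 * pi) = z + k%:R * (2 * pi) + pi *+ 2.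
    by rewrite -(natr1 k); ring.
  by rewrite cosD2pi.
have cr : cos (2 * pi * r) = 1.
  rewrite -[RHS]c1 xyE; case: (n) => m; first exact/esym/per.
  rewrite -[RHS](per _ m.+1); congr cos.
  by rewrite NegzE mulrNz; ring.
(* Half-angle formula: [pi * r] lies in [[0, pi[], where the sine vanishes only at 0. *)
have s0 : sin (pi * r) = 0.
  have : cos (2 * pi * r) = 1 - 2 * sin (pi * r) ^+ 2.
    have -> : 2 * pi * r = pi * r + pi * r by ring.
    by rewrite cosD -!expr2 cos2sin2; ring.
  by rewrite cr => h; apply/eqP; rewrite -sqrf_eq0; apply/eqP; lra.
have r00 : r = 0.
  apply/eqP; rewrite eq_le r0 andbT leNgt; apply/negP => rp.
  have := @sin_gt0_pi _ (pi * r); rewrite s0 ltxx => /(_ _)/negP; apply => //.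
  by rewrite mulr_gt0//= gtr_pMr.
by move: xyE; rewrite r00; lra.
Qed.

End GlobalCalculus.

(** * Comparison of integrals off a null set, without measurability *)

Section NonMeasurableIntegrands.
Context {R : realType}.
Context d (T : measurableType d) (mu : {measure set T -> \bar R}).
Import HBNNSimple.

(* Neither function is assumed to be measurable: the integral of a nonnegative
   function is a supremum over the simple functions below it, and those can be
   cut off on a null set. *)
Lemma le_integral_off_null (D N : set T) (f g : T -> \bar R) :
  d.-measurable N -> mu N = 0%E ->
  (forall x, D x -> (0 <= f x)%E) -> (forall x, D x -> (0 <= g x)%E) ->
  (forall x, D x -> ~ N x -> (f x <= g x)%E) ->
  (\int[mu]_(x in D) f x <= \int[mu]_(x in D) g x)%E.
Proof.
move=> mN N0 f0 g0 fg; rewrite !ge0_integralE//.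
apply: ge_ereal_sup => _ [h hf <-].
have mC : measurable (~` N) by exact: measurableC.
have hE x : proj_nnsfun h mC x = if x \in ~` N then h x else 0.
  by rewrite /= mindicE; case: ifP => _; rewrite (mulr0, mulr1).
have -> : sintegral mu h = sintegral mu (proj_nnsfun h mC).
  rewrite -!integralT_nnsfun.
  have mh (k : {nnsfun T >-> R}) : measurable_fun setT (EFin \o k).
    exact/measurable_EFinP.
  have h0 (k : {nnsfun T >-> R}) x : setT x -> (0 <= (k x)%:E)%E.
    by move=> _; rewrite lee_fin fun_ge0.
  rewrite (ge0_negligible_integral mN measurableT (mh h) (h0 h) N0).
  rewrite (ge0_negligible_integral mN measurableT (mh _) (h0 (proj_nnsfun h mC)) N0).
  apply: eq_integral => x; rewrite inE/= => -[_ Nx].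
  by transitivity (proj_nnsfun h mC x)%:E => //; rewrite hE mem_set.
apply: ereal_sup_ubound; exists (proj_nnsfun h mC) => // x.
rewrite hE; case: ifPn => [|_]; last first.
  by rewrite /patch; case: ifPn => // /[1!inE] Dx; exact: g0.
rewrite inE/= => Nx; apply: (le_trans (hf x)).
by rewrite /patch; case: ifPn => // /[1!inE] Dx; exact: fg.
Qed.

Lemma eq_integral_off_null (D N : set T) (f g : T -> \bar R) :
  d.-measurable N -> mu N = 0%E ->
  (forall x, D x -> (0 <= f x)%E) -> (forall x, D x -> (0 <= g x)%E) ->
  (forall x, D x -> ~ N x -> f x = g x) ->
  (\int[mu]_(x in D) f x = \int[mu]_(x in D) g x)%E.
Proof.
move=> mN N0 f0 g0 fg; apply/eqP; rewrite eq_le; apply/andP; split;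
  by apply: (le_integral_off_null mN N0) => // x Dx Nx; rewrite fg.
Qed.

End NonMeasurableIntegrands.

(** * Almost everywhere differentiability of primitives *)

Section LebesgueDifferentiation.
Context {R : realType}.
Local Notation mu := (@lebesgue_measure R).

Lemma primitive_on_ae_derive (a b : R) (f g : R -> R) : primitive_on a b f g ->
  exists N : set R, [/\ measurable N, mu N = 0%E &
    forall x, a < x < b -> ~ N x -> is_derive x 1 f (g x)].
Proof.
(* Extended by zero, [g] has integrals from [a] that are integrals from [-oo], the form in which the
   differentiation theorem applies. *)
move=> [ig fE]; pose h := g \_ `[a, b].
have ih : mu.-integrable setT (EFin \o h).
  rewrite /h -restrict_EFin; apply/integrable_restrict => //=; rewrite setTI.
  exact: ig.
have ihy y : mu.-integrable `]-oo, y] (EFin \o h).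
  by apply: integrableS ih => //.
have lh : locally_integrable setT h by exact: integrable_locally.
have [N [mN N0 NP]] := FTC1Ny ihy lh.
exists N; split=> // x /andP[ax xb] Nx.
have [dF FE] : derivable (fun x : R => \int[mu]_(t in `]-oo, x]) h t) x 1 /\
    derive1 (fun x : R => \int[mu]_(t in `]-oo, x]) h t) x = h x.
  by apply: contrapT => hx; apply: Nx; apply: NP.
have hx : h x = g x by rewrite /h patchE mem_set//= in_itv/= !ltW.
have dG : is_derive x 1 (fun y => f a + \int[mu]_(t in `]-oo, y]) h t) (g x).
  apply: (der_eq (derD (derC (f a) x) (derivable_der dF))).
  by rewrite FE hx add0r.
apply: near_eq_is_derive dG.
have /near_in_itvoo : x \in `]a, b[ by rewrite in_itv/= ax.
apply: filterS => y; rewrite in_itv/= => /andP[/ltW ay /ltW yb].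
rewrite [RHS]fE ?ay//; congr (_ + _).
rewrite [LHS]Rintegral_mkcond [RHS]Rintegral_mkcond; congr Rintegral.
apply/funext => t; rewrite /h /patch.
have E (I : interval R) : (t \in [set` I]) = (t \in I) by apply/idP/idP => [/set_mem//|tI]; exact/mem_set.
rewrite !E !in_itv/=; have [ty|_] := leP t y; last by rewrite andbF.
by rewrite (le_trans ty yb) andbT.
Qed.

End LebesgueDifferentiation.

(** * Speed and tangent angle of an H^2 curve *)

Section PolarForm.
Context {R : realType}.
Local Notation mu := (@lebesgue_measure R).
Implicit Types (a b s t : R) (f g : R -> R) (c : R -> R * R).

Lemma eq_integrable_segment a b f g : (forall t, a <= t <= b -> f t = g t) ->
  mu.-integrable `[a, b] (fun t => (f t)%:E) ->
  mu.-integrable `[a, b] (fun t => (g t)%:E).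
Proof.
move=> fg; apply: eq_integrable => // t /[1!inE]/=; rewrite in_itv/= => tab.
by rewrite fg.
Qed.

Lemma integrable_sqrM a b f g : {within `[a, b], continuous f} ->
  mu.-integrable `[a, b] (fun t => (g t ^+ 2)%:E) ->
  mu.-integrable `[a, b] (fun t => ((f t * g t) ^+ 2)%:E).
Proof.
move=> cf ig; have := integrable_withinM (@withinX _ a b f 2 cf) ig.
by apply: eq_integrable_segment => t _; rewrite exprMn.
Qed.

Lemma integrable_sqrD a b f g :
  mu.-integrable `[a, b] (EFin \o f) -> mu.-integrable `[a, b] (EFin \o g) ->
  mu.-integrable `[a, b] (fun t => (f t ^+ 2)%:E) ->
  mu.-integrable `[a, b] (fun t => (g t ^+ 2)%:E) ->
  mu.-integrable `[a, b] (fun t => ((f t + g t) ^+ 2)%:E).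
Proof.
move=> if1 ig1 if2 ig2.
have mf : measurable_fun `[a, b] f by apply/measurable_EFinP; exact: measurable_int if1.
have mg : measurable_fun `[a, b] g by apply/measurable_EFinP; exact: measurable_int ig1.
apply: (@le_integrable _ _ _ mu _ _ _ (fun t => (2 * f t ^+ 2 + 2 * g t ^+ 2)%:E)) => //.
- by apply/measurable_EFinP; apply: measurable_funX; exact: measurable_funD.
- move=> t _; rewrite lee_fin !ger0_norm ?sqr_ge0//.
    by have := sqr_ge0 (f t - g t); nra.
  by rewrite addr_ge0// mulr_ge0// sqr_ge0.
- by apply: (integrableD _ (integrableZl _ 2 if2) (integrableZl _ 2 ig2)).
Qed.

Lemma enorm_polar (r t : R) : 0 <= r -> enorm (r * cos t, r * sin t) = r.
Proof.
move=> r0; rewrite /enorm/= !exprMn -mulrDr cos2Dsin2 mulr1 sqrtr_sqr.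
exact: ger0_norm.
Qed.

(** Here [omega / rho] is the curvature, so [omega ^+ 2 / rho + rho] is the density of the energy.
    The energy is recorded on all subsegments because a closed curve is later cut at its double
    point inside a single polar form. Square integrability of [drho] makes changes of parameter by
    arclength of class H^2. *)
Record polar_form a b c (rho drho theta omega : R -> R) : Prop := {
  polar_x : primitive_on a b (fst \o c) (fun t => rho t * cos (theta t));
  polar_y : primitive_on a b (snd \o c) (fun t => rho t * sin (theta t));
  polar_rho : primitive_on a b rho drho;
  polar_drho2 : mu.-integrable `[a, b] (fun t => (drho t ^+ 2)%:E);
  polar_theta : primitive_on a b theta omega;
  polar_int : mu.-integrable `[a, b] (fun t => (omega t ^+ 2 / rho t + rho t)%:E);
  polar_gt0 : forall t, a <= t <= b -> 0 < rho t;
  polar_velocity : forall t, a < t < b ->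
    velocity c t = (rho t * cos (theta t), rho t * sin (theta t));
  polar_energy : forall s t, a <= s -> s < t -> t <= b -> energy s t c =
    (\int[mu]_(u in `[s, t]) (omega u ^+ 2 / rho u + rho u))%:E
}.

(** No continuous choice of argument is made: [theta] is defined as the integral of the angular
    velocity of [(v1, v2)]. The unit tangent and [(cos theta, sin theta)] then rotate at the same
    rate from the same position, so their scalar product stays 1 and their cross product stays 0. *)
Lemma exists_polar_form a b c : a < b -> regular_H2_curve a b c ->
  exists rho drho theta omega, polar_form a b c rho drho theta omega.
Proof.
move=> ab [v [[px [w1 [pv1 iw1]]] [py [w2 [pv2 iw2]]] vn0]].
have {}vn0 t : a <= t <= b -> 0 < (v t).1 ^+ 2 + (v t).2 ^+ 2.
  move=> /vn0 vt; rewrite lt_neqAle addr_ge0 ?sqr_ge0// andbT eq_sym.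
  apply/eqP => /eqP; rewrite paddr_eq0 ?sqr_ge0// !sqrf_eq0 => /andP[/eqP v1 /eqP v2].
  by apply: vt; rewrite [v t]surjective_pairing v1 v2.
pose v1 t := (v t).1; pose v2 t := (v t).2.
have {}px : primitive_on a b (fst \o c) v1 by [].
have {}py : primitive_on a b (snd \o c) v2 by [].
have {}pv1 : primitive_on a b v1 w1 by [].
have {}pv2 : primitive_on a b v2 w2 by [].
have {vn0}N0 t : a <= t <= b -> 0 < v1 t ^+ 2 + v2 t ^+ 2 := @vn0 t.
clearbody v1 v2; clear v.
have abW := ltW ab.
have cv1 := primitive_on_continuous abW pv1.
have cv2 := primitive_on_continuous abW pv2.
pose N t := v1 t ^+ 2 + v2 t ^+ 2.
have cN : {within `[a, b], continuous N} by apply: withinD; exact: withinX.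
pose rho t := Num.sqrt (N t).
have rho2 t : a <= t <= b -> rho t ^+ 2 = v1 t ^+ 2 + v2 t ^+ 2.
  by move=> /N0 N0t; rewrite sqr_sqrtr// ltW.
have rho0 t : a <= t <= b -> 0 < rho t by move=> /N0; rewrite sqrtr_gt0.
have rn0 t : a <= t <= b -> rho t != 0 by move=> /rho0 ?; rewrite gt_eqF.
have crho : {within `[a, b], continuous rho}.
  by apply: (within_comp cN) => x _; exact: sqrt_continuous.
pose drho t := (v1 t / rho t) * w1 t + (v2 t / rho t) * w2 t.
have prho : primitive_on a b rho drho.
  have pN := primitive_onD (primitive_onX2 abW pv1) (primitive_onX2 abW pv2).
  have := @primitive_on_comp _ a b N _ Num.sqrt (fun y => (2 * Num.sqrt y)^-1) pN.
  move=> /(_ _ _)/wrap[t tab||h].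
  - exact: is_derive1_sqrt (N0 t tab).
  - apply: (@withinV _ a b (fun t => 2 * rho t)); first by apply: withinM => //; exact: within_cst.
    by move=> t tab; rewrite mulf_neq0// rn0.
  - apply: primitive_on_eq h _ _ => // t tab.
    by rewrite /drho -/(rho t); field; exact: rn0.
have crV : {within `[a, b], continuous (fun t => (rho t)^-1)} by exact: withinV.
have prV : primitive_on a b (fun t => (rho t)^-1) (fun t => - drho t / rho t ^+ 2).
  have := @primitive_on_comp _ a b rho _ (fun y => y^-1) (fun y => - 1 / y ^+ 2) prho.
  move=> /(_ _ _)/wrap[t tab||h].
  - by apply: (derV _ (derI (rho t))); exact: rn0.
  - have -> : (fun y : R => - 1 / y ^+ 2) \o rho = (fun t => - 1 * (rho t ^+ 2)^-1) by [].
    apply: withinM; first exact: within_cst.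
    by apply: withinV; [exact: withinX|move=> t tab; rewrite expf_neq0// rn0].
  - by apply: primitive_on_eq h _ _ => // t tab; field; exact: rn0.
pose omega t := (v1 t / rho t ^+ 2) * w2 t - (v2 t / rho t ^+ 2) * w1 t.
have cr2 : {within `[a, b], continuous (fun t => (rho t ^+ 2)^-1)}.
  by apply: withinV; [exact: withinX|move=> t tab; rewrite expf_neq0// rn0].
have c12 := withinM cv1 cr2; have c22 := withinM cv2 cr2.
have io1 := integrable_withinM c12 pv2.1; have io2 := integrable_withinM c22 pv1.1.
have iomega : mu.-integrable `[a, b] (EFin \o omega) by exact: (integrableB _ io1 io2).
have iomega2 : mu.-integrable `[a, b] (fun t => (omega t ^+ 2)%:E).
  apply: (@integrable_sqrD a b (fun t => v1 t / rho t ^+ 2 * w2 t)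
    (fun t => - (v2 t / rho t ^+ 2 * w1 t))).
  - exact: io1.
  - apply: (@eq_integrable_segment a b (fun t => -1 * (v2 t / rho t ^+ 2 * w1 t))).
      by move=> t _; rewrite mulN1r.
    exact: (integrableZl _ (-1) io2).
  - exact: integrable_sqrM.
  - have := integrable_sqrM c22 iw1; apply: eq_integrable_segment => t _.
    by rewrite sqrrN.
have idrho2 : mu.-integrable `[a, b] (fun t => (drho t ^+ 2)%:E).
  have d1 := withinM cv1 crV; have d2 := withinM cv2 crV.
  by apply: integrable_sqrD; [exact: integrable_withinM d1 pv1.1
    |exact: integrable_withinM d2 pv2.1|exact: integrable_sqrM|exact: integrable_sqrM].
have abA : a <= a <= b by rewrite lexx.
have [th0 [cth0 sth0]] : exists t, cos t = v1 a / rho a /\ sin t = v2 a / rho a.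
  apply: exists_angle; rewrite !expr_div_n -mulrDl rho2// divff// gt_eqF//.
  exact: N0.
pose theta t := th0 + \int[mu]_(u in `[a, t]) omega u.
have thA : theta a = th0 by rewrite /theta set_itv1 Rintegral_set1 addr0.
have ptheta : primitive_on a b theta omega.
  by split=> // t tab; rewrite thA.
have ctheta := primitive_on_continuous abW ptheta.
have pcos : primitive_on a b (fun t => cos (theta t)) (fun t => - sin (theta t) * omega t).
  apply: (@primitive_on_comp _ a b theta omega cos (fun y => - sin y)) => //.
  by apply: withinN; apply: (within_comp ctheta) => x _; exact: continuous_sin.
have psin : primitive_on a b (fun t => sin (theta t)) (fun t => cos (theta t) * omega t).
  apply: (@primitive_on_comp _ a b theta omega sin cos) => //.
  by apply: (within_comp ctheta) => x _; exact: continuous_cos.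
have pu1 := primitive_onM abW pv1 prV; have pu2 := primitive_onM abW pv2 prV.
have du1 t : a <= t <= b ->
    v1 t * (- drho t / rho t ^+ 2) + w1 t / rho t = - (v2 t / rho t) * omega t.
  move=> tab; have r0 := rn0 _ tab.
  have -> : omega t = (v1 t * w2 t - v2 t * w1 t) / rho t ^+ 2 by rewrite /omega; field.
  have -> : drho t = (v1 t * w1 t + v2 t * w2 t) / rho t by rewrite /drho; field.
  have -> : w1 t / rho t = w1 t * (v1 t ^+ 2 + v2 t ^+ 2) / rho t ^+ 3.
    by rewrite -rho2//; field.
  by field.
have du2 t : a <= t <= b ->
    v2 t * (- drho t / rho t ^+ 2) + w2 t / rho t = (v1 t / rho t) * omega t.
  move=> tab; have r0 := rn0 _ tab.
  have -> : omega t = (v1 t * w2 t - v2 t * w1 t) / rho t ^+ 2 by rewrite /omega; field.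
  have -> : drho t = (v1 t * w1 t + v2 t * w2 t) / rho t by rewrite /drho; field.
  have -> : w2 t / rho t = w2 t * (v1 t ^+ 2 + v2 t ^+ 2) / rho t ^+ 3.
    by rewrite -rho2//; field.
  by field.
have const f : primitive_on a b f (fun=> 0) -> forall t, a <= t <= b -> f t = f a.
  by move=> [_ fE] t /fE ->; rewrite Rintegral_cst// mul0r addr0.
have pf := primitive_onD (primitive_onM abW pu1 pcos) (primitive_onM abW pu2 psin).
have pg := primitive_onB (primitive_onM abW pu2 pcos) (primitive_onM abW pu1 psin).
have fE t : a <= t <= b ->
    v1 t / rho t * cos (theta t) + v2 t / rho t * sin (theta t) = 1.
  move=> tab; rewrite (const (fun t => v1 t / rho t * cos (theta t) + v2 t / rho t * sin (theta t)))//.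
    by rewrite thA -cth0 -sth0 -!expr2 cos2Dsin2.
  apply: primitive_on_eq pf _ _ => // {tab}t tab.
  by rewrite /= du1// du2//; ring.
have gE t : a <= t <= b ->
    v2 t / rho t * cos (theta t) - v1 t / rho t * sin (theta t) = 0.
  move=> tab; rewrite (const (fun t => v2 t / rho t * cos (theta t) - v1 t / rho t * sin (theta t)))//.
    by rewrite thA -cth0 -sth0 mulrC subrr.
  apply: primitive_on_eq pg _ _ => // {tab}t tab.
  by rewrite /= du1// du2//; ring.
have v1E t : a <= t <= b -> v1 t = rho t * cos (theta t).
  move=> tab; have r0 := rn0 _ tab.
  have -> : v1 t = rho t * (v1 t / rho t) by field.
  congr (_ * _).
  have := fE _ tab; have := gE _ tab; have := cos2Dsin2 (theta t).
  set u := v1 t / rho t; set w := v2 t / rho t.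
  set C := cos (theta t); set S := sin (theta t) => h1 h2 h3.
  have -> : u = u * (C ^+ 2 + S ^+ 2) by rewrite h1 mulr1.
  have -> : u * (C ^+ 2 + S ^+ 2) = C * (u * C + w * S) - S * (w * C - u * S) by ring.
  by rewrite h2 h3; ring.
have v2E t : a <= t <= b -> v2 t = rho t * sin (theta t).
  move=> tab; have r0 := rn0 _ tab.
  have -> : v2 t = rho t * (v2 t / rho t) by field.
  congr (_ * _).
  have := fE _ tab; have := gE _ tab; have := cos2Dsin2 (theta t).
  set u := v1 t / rho t; set w := v2 t / rho t.
  set C := cos (theta t); set S := sin (theta t) => h1 h2 h3.
  have -> : w = w * (C ^+ 2 + S ^+ 2) by rewrite h1 mulr1.
  have -> : w * (C ^+ 2 + S ^+ 2) = S * (u * C + w * S) + C * (w * C - u * S) by ring.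
  by rewrite h2 h3; ring.
have ienergy : mu.-integrable `[a, b] (fun t => (omega t ^+ 2 / rho t + rho t)%:E).
  have i1 : mu.-integrable `[a, b] (fun t => (omega t ^+ 2 / rho t)%:E).
    have := integrable_withinM crV iomega2; apply: eq_integrable_segment => t _.
    by rewrite mulrC.
  exact: (integrableD _ i1 (integrable_within crho)).
have vel t : a < t < b -> velocity c t = (v1 t, v2 t).
  move=> tab; rewrite /velocity.
  by rewrite (der_derive1 (primitive_on_derive px cv1 tab)) (der_derive1 (primitive_on_derive py cv2 tab)).
exists rho, drho, theta, omega; split=> //.
- by apply: primitive_on_eq px _ _ => // t /v1E.
- by apply: primitive_on_eq py _ _ => // t /v2E.
- move=> t /[dup] /andP[/ltW at_ /ltW tb] tab.
  by rewrite vel// v1E ?v2E ?at_.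
move=> s t as_ st tb.
have [N1 [mN1 N10 N1P]] := primitive_on_ae_derive pv1.
have [N2 [mN2 N20 N2P]] := primitive_on_ae_derive pv2.
have ie : mu.-integrable `[s, t] (fun t => (omega t ^+ 2 / rho t + rho t)%:E).
  by apply: integrableS ienergy => //; exact: subset_segment.
rewrite /Rintegral fineK; last exact: integrable_fin_num.
rewrite integral_itv_bndoo; last first.
  by apply: (measurable_int mu); apply: integrableS ie => //; exact: subset_itv_oo_cc.
have mN : measurable (N1 `|` N2) by exact: measurableU.
have N12 : mu (N1 `|` N2) = 0%E by rewrite null_set_setU.
rewrite /energy.
(* [curvature] is built from pointwise derivatives, which take default values where the second
   derivative fails to exist. Comparing off a null set avoids asking whether it is measurable. *)
apply: (@eq_integral_off_null R _ _ mu _ _ _ _ mN N12).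
- move=> x _; rewrite lee_fin mulr_ge0 ?addr_ge0 ?sqr_ge0//.
  by rewrite /speed /enorm sqrtr_ge0.
- move=> x /=; rewrite in_itv/= => /andP[/ltW sx /ltW xt].
  have x0 : 0 < rho x by apply: rho0; rewrite (le_trans as_ sx) (le_trans xt tb).
  by rewrite lee_fin addr_ge0 ?(ltW x0)// divr_ge0 ?sqr_ge0 ?(ltW x0).
move=> x /=; rewrite in_itv/= => /andP[sx xt] /not_orP[x1 x2]; congr EFin.
have xab : a < x < b by rewrite (le_lt_trans as_ sx) (lt_le_trans xt tb).
have xab' : a <= x <= b by case/andP: xab => /ltW -> /ltW ->.
have r0 := rn0 _ xab'.
have near_vel : \forall y \near x, velocity c y = (v1 y, v2 y).
  have /near_in_itvoo : x \in `]a, b[ by rewrite in_itv/=.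
  by apply: filterS => y; rewrite in_itv/=; exact: vel.
have acc : velocity (velocity c) x = (w1 x, w2 x).
  rewrite [LHS]/velocity; congr pair; apply: der_derive1.
    by apply: near_eq_is_derive (N1P x xab x1); apply: filterS near_vel => y yE; rewrite /comp yE.
  by apply: near_eq_is_derive (N2P x xab x2); apply: filterS near_vel => y yE; rewrite /comp yE.
have spE : speed c x = rho x.
  by rewrite /speed vel.
rewrite /curvature acc spE vel//= /omega.
by field.
Qed.

End PolarForm.

(** * The wavelike elastica, its elliptic integrals, and the tangent inequality in the modulus *)

Section ReferenceElastica.
Context {R : realType}.
Implicit Types (m x y : R) (f F : R -> R).

(* Junk value [fun=> 0] when [f] has no antiderivative. *)
Definition primitive_from (x0 : R) f : R -> R :=
  xget (fun=> 0) [set F : R -> R | F x0 = 0 /\ forall x, is_derive x 1 F (f x)].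

Lemma primitive_fromP (x0 : R) f : continuous f ->
  primitive_from x0 f x0 = 0 /\ forall x, is_derive x 1 (primitive_from x0 f) (f x).
Proof.
move=> /exists_antiderivative[F dF]; rewrite /primitive_from.
case: xgetP => [G _ //|/(_ (fun x => F x - F x0))]; case; split; first by rewrite subrr.
by move=> x; apply: (der_eq (derB (dF x) (derC _ x))); rewrite subr0.
Qed.

(** Jacobi's delta amplitude for the squared modulus [m]. In terms of the incomplete elliptic
    integrals F and E based at [- (pi / 2)], the next three functions are [2 E - F], [F] and
    [E - (1 - m) F]; the last is [scale m / 4] times the integral of the squared curvature along the
    wave. *)
Definition delta m x : R := Num.sqrt (1 - m * sin x ^+ 2).
Definition abscissa m := primitive_from (- (pi / 2))
  (fun x => (1 - 2 * m * sin x ^+ 2) / delta m x).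
Definition reduced_length m := primitive_from (- (pi / 2)) (fun x => (delta m x)^-1).
Definition bending m := primitive_from (- (pi / 2))
  (fun x => m * cos x ^+ 2 / delta m x).
(** The size is dictated by the coefficient of the length in the energy: the wave satisfies
    [2 k_ss + k^3 - k = 0] for this dilation factor. *)
Definition scale m : R := Num.sqrt (2 * (2 * m - 1)).

(* The wavelike elastica of modulus [Num.sqrt m], parametrized by the amplitude
   [x]: its curvature is [2 * Num.sqrt m * cos x / scale m] and its tangent angle
   [t] satisfies [sin (t / 2) = Num.sqrt m * sin x]. *)
Definition wave m x : R * R :=
  (scale m * abscissa m x, - (2 * scale m * Num.sqrt m * cos x)).

(** Twice the bending energy of half a period. At a zero of [abscissa] the length equals the bending
    energy, so this is the whole energy of the half period; at other moduli it is the value of the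
    lower bound obtained from the tangent angle. *)
Definition drop_energy m : R := 8 * bending m (pi / 2) / scale m.

Lemma sin_sqr_le1 x : sin x ^+ 2 <= 1.
Proof. by rewrite -(cos2Dsin2 x) lerDr sqr_ge0. Qed.

Lemma delta_arg_gt0 m x : m < 1 -> 0 < 1 - m * sin x ^+ 2.
Proof.
move=> m1; have S1 := sin_sqr_le1 x; have := sqr_ge0 (sin x).
rewrite le_eqVlt => /predU1P[<-|S0]; first by rewrite mulr0 subr0.
by have := mulr_gt0 S0 (_ : 0 < 1 - m); rewrite subr_gt0 => /(_ m1); nra.
Qed.

Lemma delta_gt0 m x : m < 1 -> 0 < delta m x.
Proof. by move=> m1; rewrite sqrtr_gt0; exact: delta_arg_gt0. Qed.

Lemma delta_neq0 m x : m < 1 -> delta m x != 0.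
Proof. by move=> m1; rewrite gt_eqF// delta_gt0. Qed.

Lemma delta_sqr m x : m <= 1 -> delta m x ^+ 2 = 1 - m * sin x ^+ 2.
Proof.
move=> m1; rewrite sqr_sqrtr//.
by have := sin_sqr_le1 x; have := sqr_ge0 (sin x); nra.
Qed.

Lemma derive_delta m x : m < 1 ->
  is_derive x 1 (delta m) (- (m * sin x * cos x) / delta m x).
Proof.
move=> m1; have d0 := delta_neq0 x m1.
have dS := derX 2 (der_sin (derI x)).
apply: (der_eq (der_sqrt (f := fun x => 1 - m * sin x ^+ 2) _ (derB (derC 1 x) (derZ m dS)))).
  exact: delta_arg_gt0.
by rewrite -/(delta m x) /=; field.
Qed.

Lemma continuous_deltaV m : m < 1 -> continuous (fun x => (delta m x)^-1).
Proof.
move=> m1 x; exact: der_continuous (derV (delta_neq0 x m1) (derive_delta x m1)).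
Qed.

Lemma continuous_div_delta m f : m < 1 -> (forall x, derivable f x 1) ->
  continuous (fun x => f x / delta m x).
Proof.
move=> m1 df x; apply: der_continuous.
exact: (der_div (delta_neq0 x m1) (derivable_der (df x)) (derive_delta x m1)).
Qed.

Lemma reduced_lengthP m : m < 1 -> reduced_length m (- (pi / 2)) = 0 /\
  forall x, is_derive x 1 (reduced_length m) (delta m x)^-1.
Proof. by move=> m1; apply: primitive_fromP; exact: continuous_deltaV. Qed.

Lemma abscissaP m : m < 1 -> abscissa m (- (pi / 2)) = 0 /\
  forall x, is_derive x 1 (abscissa m) ((1 - 2 * m * sin x ^+ 2) / delta m x).
Proof.
move=> m1; by apply: primitive_fromP; exact: continuous_div_delta.
Qed.

Lemma bendingP m : m < 1 -> bending m (- (pi / 2)) = 0 /\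
  forall x, is_derive x 1 (bending m) (m * cos x ^+ 2 / delta m x).
Proof.
move=> m1; by apply: primitive_fromP; exact: continuous_div_delta.
Qed.

Lemma pi_periodic_primitive f F : F (- (pi / 2)) = 0 ->
  (forall x, is_derive x 1 F (f x)) -> (forall x, f (x + pi) = f x) ->
  forall x, F (x + pi) = F x + F (pi / 2).
Proof.
move=> F0 dF fp x.
have dG y : is_derive y 1 (fun y => F (y + pi)) (f y).
  apply: (der_eq (der_comp (dF _) (derD (derI y) (derC pi y)))).
  by rewrite fp addr0 mulr1.
have := der_eq_increment (- (pi / 2)) x dF dG.
have -> : - (pi / 2) + pi = pi / 2 :> R by field.
by rewrite F0; lra.
Qed.

Lemma deltaDpi m x : delta m (x + pi) = delta m x.
Proof. by rewrite /delta sinDpi sqrrN. Qed.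

Lemma abscissaDpi m x : m < 1 ->
  abscissa m (x + pi) = abscissa m x + abscissa m (pi / 2).
Proof.
move=> m1; have [a0 da] := abscissaP m1; apply: (pi_periodic_primitive a0 da) => y.
by rewrite deltaDpi sinDpi sqrrN.
Qed.

Lemma reduced_lengthDpi m x : m < 1 ->
  reduced_length m (x + pi) = reduced_length m x + reduced_length m (pi / 2).
Proof.
move=> m1; have [a0 da] := reduced_lengthP m1; apply: (pi_periodic_primitive a0 da) => y.
by rewrite deltaDpi.
Qed.

Lemma reduced_lengthD2pi m x : m < 1 ->
  reduced_length m (x + 2 * pi) = reduced_length m x + 2 * reduced_length m (pi / 2).
Proof.
by move=> m1; rewrite (_ : x + 2 * pi = x + pi + pi) ?reduced_lengthDpi//; ring.
Qed.

Lemma bendingDpi m x : m < 1 ->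
  bending m (x + pi) = bending m x + bending m (pi / 2).
Proof.
move=> m1; have [a0 da] := bendingP m1; apply: (pi_periodic_primitive a0 da) => y.
by rewrite deltaDpi cosDpi sqrrN.
Qed.

Lemma scale_gt0 m : 1 / 2 < m -> 0 < scale m.
Proof. by move=> m2; rewrite sqrtr_gt0; lra. Qed.

Lemma scale_sqr m : 1 / 2 < m -> scale m ^+ 2 = 2 * (2 * m - 1).
Proof. by move=> m2; rewrite sqr_sqrtr//; lra. Qed.

(** The integrands obey [4 m cos^2 - 2 (2 m - 1) = 2 (1 - 2 m sin^2)]. Where the abscissa vanishes
    this says that bending energy and length are equal. *)
Lemma bending_length_abscissa m x : 1 / 2 < m -> m < 1 ->
  4 * bending m x - scale m ^+ 2 * reduced_length m x = 2 * abscissa m x.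
Proof.
move=> m2 m1; have [a0 da] := abscissaP m1; have [l0 dl] := reduced_lengthP m1.
have [b0 db] := bendingP m1.
have d1 y : is_derive y 1 (fun y => 4 * bending m y - scale m ^+ 2 * reduced_length m y)
    (2 * ((1 - 2 * m * sin y ^+ 2) / delta m y)).
  apply: (der_eq (derB (derZ 4 (db y)) (derZ (scale m ^+ 2) (dl y)))).
  by rewrite scale_sqr// cos2sin2; field; exact: delta_neq0.
have := der_eq_increment (- (pi / 2)) x d1 (fun y => derZ 2 (da y)).
by rewrite a0 l0 b0; lra.
Qed.

Lemma bending_gt0 m : 0 < m -> m < 1 -> 0 < bending m (pi / 2).
Proof.
move=> m0 m1; have [b0 db] := bendingP m1.
have pi0 := pi_gt0 R; rewrite -b0; apply: (der_gt0_lt (der_within db)) => //.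
- by move=> x /cos_gt0_pihalf c0; rewrite divr_gt0 ?delta_gt0// mulr_gt0// exprn_gt0.
- lra.
Qed.

(* As a function of [m], the integrand [m * cos x ^+ 2 / delta m x] lies above its
   tangent at [m0]; with [p = delta m x], [q = delta m0 x] the difference is
   [cos x ^+ 2 * (p - q) ^+ 2 * ((1 + q ^+ 2) * p + 2 * q) / (2 * p * q ^+ 3)] over
   [sin x ^+ 2]. The slope of the tangent is, up to an exact derivative, a
   combination of the integrands of [bending m0] and [abscissa m0]. *)
Lemma bending_integrand_tangent m m0 x : m <= 1 -> m0 < 1 -> 0 < cos x ->
  m0 * cos x ^+ 2 / delta m0 x +
    (m - m0) * (cos x ^+ 2 * (1 + delta m0 x ^+ 2) / (2 * delta m0 x ^+ 3))
  <= m * cos x ^+ 2 / delta m x.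
Proof.
move=> m1 m01 c0.
have S1 : sin x ^+ 2 < 1 by rewrite -(cos2Dsin2 x) ltrDr exprn_gt0.
have S0 := sqr_ge0 (sin x).
have q0 := delta_gt0 x m01.
have p0 : 0 < delta m x by rewrite sqrtr_gt0; nra.
have pE := delta_sqr x m1; have qE := delta_sqr x (ltW m01).
set S := sin x ^+ 2 in S1 S0 pE qE *; set C := cos x ^+ 2.
set p := delta m x in p0 pE *; set q := delta m0 x in q0 qE *.
have C0 : 0 <= C by exact: sqr_ge0.
suff : 0 <= m / p - m0 / q - (m - m0) * ((1 + q ^+ 2) / (2 * q ^+ 3)).
  move=> h; have := mulr_ge0 C0 h; rewrite [X in 0 <= X](_ : _ = m * C / p -
    (m0 * C / q + (m - m0) * (C * (1 + q ^+ 2) / (2 * q ^+ 3)))) ?subr_ge0//.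
  by field; rewrite !gt_eqF.
have [S00|Sn0] := eqVneq S 0.
  have -> : p = q.
    by apply/eqP; rewrite -(eqrXn2 (n := 2)) ?ltW//; rewrite pE qE S00 !mulr0.
  have -> : q = 1.
    by apply/eqP; rewrite -(eqrXn2 (n := 2)) ?ltW//; rewrite qE S00 mulr0 subr0 expr1n.
  by rewrite expr1n expr1n; lra.
have Sp : 0 < S by rewrite lt_neqAle eq_sym Sn0.
have mE : m = (1 - p ^+ 2) / S by rewrite pE; field.
have m0E : m0 = (1 - q ^+ 2) / S by rewrite qE; field.
have -> : m / p - m0 / q - (m - m0) * ((1 + q ^+ 2) / (2 * q ^+ 3)) =
    (p - q) ^+ 2 * ((1 + q ^+ 2) * p + 2 * q) / (2 * p * q ^+ 3 * S).
  by rewrite mE m0E; field; rewrite Sn0 !gt_eqF.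
rewrite divr_ge0//.
  rewrite mulr_ge0 ?sqr_ge0// addr_ge0 ?mulr_ge0 ?(ltW p0) ?(ltW q0)//.
  by rewrite addr_ge0// sqr_ge0.
have q3 : 0 < q ^+ 3 by exact: exprn_gt0.
by do ! apply: mulr_ge0 => //; exact: ltW.
Qed.

Lemma bending_support m m0 F : 1 / 2 < m0 -> m0 < 1 -> m <= 1 ->
  abscissa m0 (pi / 2) = 0 ->
  {within `[- (pi / 2), pi / 2], continuous F} ->
  (forall x, - (pi / 2) < x < pi / 2 ->
     is_derive x 1 F (m * cos x ^+ 2 / delta m x)) ->
  bending m0 (pi / 2) * (m + m0 - 1) / (2 * m0 - 1) <= F (pi / 2) - F (- (pi / 2)).
Proof.
move=> m02 m01 m1 root cF dF; have pi0 := pi_gt0 R.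
have [a0 da] := abscissaP m01; have [b0 db] := bendingP m01.
(* An antiderivative of the slope. Its term [sin * cos / delta] vanishes at both ends and its
   abscissa term vanishes by [root], which leaves [bending m0 (pi / 2) / (2 * m0 - 1)]. *)
pose G x := (bending m0 x - 1 / 2 * abscissa m0 x +
  (m0 - 1 / 2) * (sin x * cos x / delta m0 x)) / (2 * m0 - 1).
have n0 : 2 * m0 - 1 != 0 by rewrite gt_eqF//; lra.
have dG x : is_derive x 1 G
    (cos x ^+ 2 * (1 + delta m0 x ^+ 2) / (2 * delta m0 x ^+ 3)).
  have d0 := delta_neq0 x m01.
  have dsc := der_div d0 (derM (der_sin (derI x)) (der_cos (derI x))) (derive_delta x m01).
  have := derM (derD (derB (db x) (derZ (1 / 2) (da x))) (derZ (m0 - 1 / 2) dsc))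
    (derC (2 * m0 - 1)^-1 x).
  move=> /der_eq; apply; rewrite mulr0 addr0.
  have mE : m0 * sin x ^+ 2 = 1 - delta m0 x ^+ 2 by rewrite delta_sqr ?ltW//; ring.
  have SC : cos x ^+ 2 = 1 - sin x ^+ 2 by exact: cos2sin2.
  have -> : (cos x * 1 * cos x + sin x * (- sin x * 1)) = 1 - 2 * sin x ^+ 2.
    by rewrite mulr1 mulr1 -expr2 SC; ring.
  have -> : sin x * cos x * (- (m0 * sin x * cos x) / delta m0 x) =
    - (m0 * sin x ^+ 2 * (1 - sin x ^+ 2)) / delta m0 x by rewrite -SC; field.
  rewrite SC; set S := sin x ^+ 2 in mE *; set q := delta m0 x in d0 mE *.
  have q2 : q ^+ 2 = 1 - m0 * S by rewrite mE; ring.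
  have q4 : q ^+ 4 = (1 - m0 * S) ^+ 2 by rewrite -q2; ring.
  rewrite [LHS](_ : _ = (m0 * (1 - S) * q ^+ 2 - 1 / 2 * (1 - 2 * m0 * S) * q ^+ 2 +
     (m0 - 1 / 2) * ((1 - 2 * S) * q ^+ 2 + m0 * S * (1 - S))) / ((2 * m0 - 1) * q ^+ 3)).
    rewrite q2; field; by rewrite n0 d0.
  by field; rewrite n0 d0.
pose H x := bending m0 x + (m - m0) * G x.
have dH x : is_derive x 1 H (m0 * cos x ^+ 2 / delta m0 x +
    (m - m0) * (cos x ^+ 2 * (1 + delta m0 x ^+ 2) / (2 * delta m0 x ^+ 3))).
  exact: derD (db x) (derZ _ (dG x)).
have le : F (- (pi / 2)) - H (- (pi / 2)) <= F (pi / 2) - H (pi / 2).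
  apply: (der_ge0_le (f := fun x => F x - H x)); last by lra.
  - by apply: withinB => //; exact: der_within dH.
  - by move=> x xp; exact: derB (dF x xp) (dH x).
  - move=> x /cos_gt0_pihalf c0; rewrite subr_ge0; exact: bending_integrand_tangent.
have HE : H (pi / 2) = bending m0 (pi / 2) * (m + m0 - 1) / (2 * m0 - 1).
  by rewrite /H /G root cos_pihalf !mulr0 mul0r; field.
have H0 : H (- (pi / 2)) = 0.
  by rewrite /H /G b0 a0 cosN cos_pihalf !mulr0 mul0r; field.
by move: le; rewrite H0 HE; lra.
Qed.

End ReferenceElastica.

(** * Existence and strict minimality of the closing modulus *)

Section ModulusOfTheFigureEight.
Context {R : realType}.
Implicit Types (m x y : R) (f F : R -> R).

(** Write [s] and [s0] for the scales of [m] and [m0]. The supporting line at [m0] is [bending m0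
    (pi / 2) * (s^2 + s0^2) / (2 s0^2)], and the arithmetic-geometric inequality bounds it below by
    [bending m0 (pi / 2) * s / s0], strictly unless [s = s0]. *)
Lemma drop_energy_lt m m0 F : 1 / 2 < m0 -> m0 < 1 -> 1 / 2 < m -> m <= 1 ->
  abscissa m0 (pi / 2) = 0 ->
  {within `[- (pi / 2), pi / 2], continuous F} ->
  (forall x, - (pi / 2) < x < pi / 2 ->
     is_derive x 1 F (m * cos x ^+ 2 / delta m x)) ->
  m != m0 -> drop_energy m0 < 8 * (F (pi / 2) - F (- (pi / 2))) / scale m.
Proof.
move=> m02 m01 m2 m1 root cF dF mm0.
have le := bending_support m02 m01 m1 root cF dF.
have B0 : 0 < bending m0 (pi / 2) by apply: bending_gt0 => //; lra.
rewrite /drop_energy -!mulrA ltr_pM2l//.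
have s0 := scale_gt0 m02; have s1 := scale_gt0 m2.
rewrite ltr_pdivlMr// ; apply: lt_le_trans le.
rewrite -mulrA -mulrA ltr_pM2l// mulrC.
have sE0 := scale_sqr m02; have sE := scale_sqr m2.
have d0 : 0 < 2 * m0 - 1 by lra.
have -> : m + m0 - 1 = (scale m ^+ 2 + scale m0 ^+ 2) / 4 by rewrite sE sE0; field.
have -> : 2 * m0 - 1 = scale m0 ^+ 2 / 2 by rewrite sE0; field.
have ne : scale m != scale m0.
  by apply/eqP => e; move/eqP: mm0; apply; move: sE; rewrite e sE0; lra.
rewrite -subr_gt0.
have -> : (scale m ^+ 2 + scale m0 ^+ 2) / 4 / (scale m0 ^+ 2 / 2) - scale m / scale m0 =
  (scale m - scale m0) ^+ 2 / (2 * scale m0 ^+ 2) by field; rewrite gt_eqF.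
apply: divr_gt0; first by rewrite exprn_even_gt0//= subr_eq0.
by apply: mulr_gt0 => //; exact: exprn_gt0.
Qed.

Lemma sin_le x : 0 <= x -> sin x <= x.
Proof.
move=> x0.
have d y : is_derive y 1 (fun y => y - sin y) (1 - cos y).
  by apply: (der_eq (derB (derI y) (der_sin (derI y)))); rewrite mulr1.
have := @der_ge0_le _ 0 x _ _ (der_within d) (fun y _ => d y) _ x0.
rewrite sin0 subrr subr_ge0; apply => y _; rewrite subr_ge0; exact: cos_le1.
Qed.

(** The integrand is even, so the two quarter periods contribute equally. *)
Lemma abscissa_pihalf m : m < 1 -> abscissa m (pi / 2) = 2 * abscissa m 0.
Proof.
move=> m1; have [a0 da] := abscissaP m1.
have d y : is_derive y 1 (fun y => abscissa m y + abscissa m (- y)) 0.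
  apply: (der_eq (derD (da y) (der_comp (da (- y)) (derN (derI y))))).
  by rewrite /delta sinN sqrrN; ring.
by have := is_derive_0_is_cst (pi / 2) 0 d; rewrite a0 oppr0; lra.
Qed.

Lemma abscissa_half_gt0 : 0 < abscissa (1 / 2) (pi / 2) :> R.
Proof.
have m1 : 1 / 2 < 1 :> R by lra.
have pi0 := pi_gt0 R.
have [a0 da] := abscissaP m1; rewrite -a0.
apply: (der_gt0_lt (der_within da)) => //; last by lra.
move=> x /cos_gt0_pihalf c0; rewrite divr_gt0 ?delta_gt0//.
rewrite (_ : 1 - _ = cos x ^+ 2) ?exprn_gt0// cos2sin2.
by field.
Qed.

(* For [d = expR (- 4)] and [y = pi / 2 - x] one has [delta m x <= d + sin y]
   and [delta m x <= d + y], and [(d + y)^-1] has a large logarithmic integral. *)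
Lemma exists_abscissa_lt0 : exists m : R, [/\ 1 / 2 < m, m < 1 & abscissa m (pi / 2) < 0].
Proof.
pose d : R := expR (- 4).
have d0 : 0 < d by exact: expR_gt0.
have d5 : d <= 1 / 5.
  have e5 := expR_ge1Dx (4 : R).
  have de : d * expR 4 = 1 by rewrite /d expRN mulVf// gt_eqF// expR_gt0.
  have : 0 <= d * (expR 4 - 5) by rewrite mulr_ge0 ?(ltW d0)//; lra.
  by rewrite mulrBr de; lra.
pose m := 1 - d ^+ 2.
have m1 : m < 1 by rewrite /m ltrBlDr ltrDl exprn_gt0.
have m2 : 1 / 2 < m by rewrite /m; nra.
exists m; split=> //.
have [a0 da] := abscissaP m1.
have piE := abscissa_pihalf m1.
have pi0 := pi_gt0 R; have pi2 := pihalf_ge1 R; have pi4 := pihalf_lt2 R.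
suff : abscissa m (pi / 2) - abscissa m 0 < 0 by lra.
(* The integrand is [2 * delta - delta^-1], and the two bounds on [delta] make the derivative of [G]
   a majorant. At [pi / 2] the logarithm is [ln d = - 4] while the rest of [G] stays below 3; at 0
   the function [G] is nonnegative. *)
pose G x := 2 * (sin x + d * x) + ln (d + pi / 2 - x).
have dG x : x < d + pi / 2 -> is_derive x 1 G (2 * (cos x + d) - (d + pi / 2 - x)^-1).
  move=> xd; have x0 : 0 < d + pi / 2 - x by lra.
  have dl := @der_comp _ (@ln R) (fun y => d + pi / 2 - y) x _ _ (is_derive1_ln x0)
    (derB (derC (d + pi / 2) x) (derI x)).
  apply: (der_eq (derD (derZ 2 (derD (der_sin (derI x)) (derZ d (derI x)))) dl)).
  by rewrite sub0r mulrN1 !mulr1.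
have cG : {within `[0, pi / 2], continuous G}.
  apply: continuous_in_subspaceT => x; rewrite inE/= in_itv/= => /andP[_ xp].
  by apply: der_continuous (dG x _); lra.
have le : G 0 - abscissa m 0 <= G (pi / 2) - abscissa m (pi / 2).
  apply: (@der_ge0_le _ 0 (pi / 2) (fun x => G x - abscissa m x)
    (fun x => (2 * (cos x + d) - (d + pi / 2 - x)^-1) - (1 - 2 * m * sin x ^+ 2) / delta m x)).
  - by apply: withinB => //; exact: der_within da.
  - move=> x /andP[_ xp]; have xd : x < d + pi / 2 by lra.
    exact: (derB (dG x xd) (da x)).
  - move=> x /andP[x0 xp].
    have c0 : 0 <= cos x by apply/cos_ge0_pihalf/andP; split; lra.
    have D0 := delta_gt0 x m1.
    have DE : delta m x ^+ 2 = cos x ^+ 2 + d ^+ 2 * sin x ^+ 2.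
      by rewrite delta_sqr ?ltW// cos2sin2 /m; ring.
    have D1 : delta m x <= cos x + d.
      rewrite -(ler_pXn2r (n := 2)) ?nnegrE ?(ltW D0)// ?DE ?addr_ge0// ?(ltW d0)//.
      by have := sin_sqr_le1 x; have := mulr_ge0 c0 (ltW d0); nra.
    have cy : cos x <= pi / 2 - x.
      have -> : cos x = sin (pi / 2 - x) by rewrite -opprB sinN sinBpihalf opprK.
      by apply: sin_le; lra.
    have D2 : delta m x <= d + pi / 2 - x by lra.
    have -> : (1 - 2 * m * sin x ^+ 2) / delta m x = 2 * delta m x - (delta m x)^-1.
      have -> : 1 - 2 * m * sin x ^+ 2 = 2 * delta m x ^+ 2 - 1.
        by rewrite delta_sqr ?ltW//; ring.
      by field; rewrite gt_eqF.
    have : (d + pi / 2 - x)^-1 <= (delta m x)^-1 by rewrite lef_pV2 ?posrE//; lra.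
    by lra.
  - by lra.
have G0 : 0 <= G 0.
  rewrite /G sin0 mulr0 addr0 mulr0 add0r subr0; apply: ln_ge0; lra.
have Gp : G (pi / 2) < 0.
  rewrite /G sin_pihalf addrK /d expRK -/d; nra.
lra.
Qed.

(** Intermediate value theorem in [m], between [1 / 2] and a modulus with negative value; continuity
    in [m] comes from an explicit Lipschitz estimate of the integrand. *)
Lemma exists_modulus : exists m : R, [/\ 1 / 2 < m, m < 1 & abscissa m (pi / 2) = 0].
Proof.
have [M [M2 M1 MJ]] := exists_abscissa_lt0.
have pi0 := pi_gt0 R.
(* For moduli at most [M], [delta] is at least [e]. With [p] and [q] two values of [delta], the
   integrands differ by [(p^2 - q^2) (2 + 1 / (p q)) / (p + q)], whence the constant [L]. *)
pose e := Num.sqrt (1 - M).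
have e0 : 0 < e by rewrite sqrtr_gt0 subr_gt0.
have e2 : e ^+ 2 = 1 - M by rewrite sqr_sqrtr// subr_ge0 ltW.
pose L := (2 + e ^- 2) / (2 * e).
have L0 : 0 < L by rewrite divr_gt0 ?mulr_gt0// addr_gt0// invr_gt0 exprn_gt0.
have lip m n : m <= M -> n <= M ->
    abscissa m (pi / 2) - abscissa n (pi / 2) <= L * `|m - n| * pi.
  move=> mM nM; have m1 : m < 1 by lra.
  have n1 : n < 1 by lra.
  have [a0 da] := abscissaP m1; have [b0 db] := abscissaP n1.
  have dh x := derB (derZ (L * `|m - n|) (derI x)) (derB (da x) (db x)).
  suff : L * `|m - n| * (- (pi / 2)) - (abscissa m (- (pi / 2)) - abscissa n (- (pi / 2)))
      <= L * `|m - n| * (pi / 2) - (abscissa m (pi / 2) - abscissa n (pi / 2)).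
    by rewrite a0 b0; lra.
  apply: (der_ge0_le (der_within dh) (fun x _ => dh x)); last by lra.
  move=> x _; rewrite mulr1.
  have p0 := delta_gt0 x m1; have q0 := delta_gt0 x n1.
  have pE := delta_sqr x (ltW m1); have qE := delta_sqr x (ltW n1).
  have S1 := sin_sqr_le1 x; have S0 := sqr_ge0 (sin x).
  have M0 : 0 <= M * (1 - sin x ^+ 2) by rewrite mulr_ge0//; lra.
  have mS : 0 <= (M - m) * sin x ^+ 2 by rewrite mulr_ge0//; lra.
  have nS : 0 <= (M - n) * sin x ^+ 2 by rewrite mulr_ge0//; lra.
  have ep : e <= delta m x by rewrite -(ler_pXn2r (n := 2)) ?nnegrE ?(ltW e0) ?(ltW p0)// pE e2; lra.
  have eq : e <= delta n x by rewrite -(ler_pXn2r (n := 2)) ?nnegrE ?(ltW e0) ?(ltW q0)// qE e2; lra.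
  set p := delta m x in p0 pE ep *; set q := delta n x in q0 qE eq *.
  have -> : 1 - 2 * m * sin x ^+ 2 = 2 * p ^+ 2 - 1 by rewrite pE; ring.
  have -> : 1 - 2 * n * sin x ^+ 2 = 2 * q ^+ 2 - 1 by rewrite qE; ring.
  have -> : (2 * p ^+ 2 - 1) / p - (2 * q ^+ 2 - 1) / q = (p ^+ 2 - q ^+ 2) *
      ((2 + (p * q)^-1) / (p + q)).
    by field; rewrite !gt_eqF// addr_gt0.
  rewrite subr_ge0; apply: (le_trans (ler_norm _)); rewrite normrM.
  have -> : p ^+ 2 - q ^+ 2 = - ((m - n) * sin x ^+ 2) by rewrite pE qE; ring.
  rewrite normrN normrM mulrC; apply: ler_pM => //.
  - rewrite ger0_norm ?divr_ge0 ?addr_ge0 ?invr_ge0 ?mulr_ge0 ?(ltW p0) ?(ltW q0)//.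
    have pq : e ^+ 2 <= p * q by rewrite expr2; apply: ler_pM => //; exact: ltW.
    have e20 : 0 < e ^+ 2 by rewrite exprn_gt0.
    have pq0 : 0 < p * q by rewrite mulr_gt0.
    apply: ler_pM.
    + by rewrite addr_ge0// invr_ge0 ltW.
    + by rewrite invr_ge0 addr_ge0// ltW.
    + by rewrite lerD2l lef_pV2 ?posrE.
    + rewrite lef_pV2 ?posrE ?addr_gt0 ?mulr_gt0//; lra.
  - rewrite -[leRHS]mulr1 ler_wpM2l// ger0_norm//.
have cJ : {within `[1 / 2, M], continuous (fun m => abscissa m (pi / 2))}.
  apply/within_distP => m /andP[_ mM] eps eps0.
  exists (eps / (L * pi)); first by rewrite divr_gt0// mulr_gt0.
  move=> n /andP[_ nM] nm.
  have h1 := lip m n mM nM; have h2 := lip n m nM mM.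
  rewrite distrC in h1.
  have h3 : L * `|n - m| * pi < eps.
    have -> : L * `|n - m| * pi = `|n - m| * (L * pi) by rewrite mulrAC mulrC.
    by rewrite -ltr_pdivlMr// mulr_gt0.
  by rewrite ltr_norml; apply/andP; split; lra.
have half := abscissa_half_gt0.
have M2' := ltW M2.
have mid : Num.min (abscissa (1 / 2) (pi / 2)) (abscissa M (pi / 2)) <= 0 <=
    Num.max (abscissa (1 / 2) (pi / 2)) (abscissa M (pi / 2)).
  by rewrite ge_min le_max (ltW half) (ltW MJ) orbT.
have [m] := IVT M2' cJ mid.
rewrite in_itv/= => /andP[m2 mM] m0; exists m; split => //; last by lra.
rewrite lt_neqAle m2 andbT; apply/eqP => e12; move: half; rewrite e12 m0 ltxx.
by [].
Qed.

End ModulusOfTheFigureEight.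

(** * Last and first passage of a continuous function at a level *)

Section LastTime.
Context {R : realType}.
Implicit Types (s t v : R) (f : R -> R).

Lemma last_time s t v f : s <= t -> {within `[s, t], continuous f} ->
  f s = v -> v < f t -> exists2 u, s <= u < t &
    f u = v /\ forall w, u < w <= t -> v < f w.
Proof.
move=> st cf fs ft; pose S := [set w | s <= w <= t /\ f w <= v].
have Ss : S s by split; rewrite ?lexx ?st// fs.
have Sb : ubound S t by move=> w [/andP[]].
have hS : has_sup S by split; [exists s|exists t].
have su : s <= sup S by apply: ub_le_sup => //; exists t.
have ut : sup S <= t by apply: ge_sup => //; exists s.
have ust : s <= sup S <= t by rewrite su.
have fu : f (sup S) <= v.
  rewrite leNgt; apply/negP => vf.
  have e0 : 0 < f (sup S) - v by rewrite subr_gt0.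
  have [d d0 dP] := (within_distP _ _ _).1 cf _ ust _ e0.
  have [w [/andP[sw wt] fw] ud] := sup_adherent d0 hS.
  have wu : w <= sup S by apply: ub_le_sup; [exists t|split; rewrite ?sw].
  have wd : `|w - sup S| < d by rewrite ltr_norml; apply/andP; split; lra.
  have := dP w _ wd; rewrite sw wt ltr_norml => /(_ isT)/andP[]; lra.
have above w : sup S < w <= t -> v < f w.
  move=> /andP[uw wt]; rewrite ltNge; apply/negP => fw.
  have : w <= sup S.
    by apply: ub_le_sup; [exists t|split; rewrite // (le_trans su (ltW uw))].
  by rewrite leNgt uw.
have ut' : sup S < t.
  by rewrite lt_neqAle ut andbT; apply/eqP => e; move: ft; rewrite -e ltNge fu.
exists (sup S); rewrite ?su//; split=> //.
apply/eqP; rewrite eq_le fu leNgt; apply/negP => fv.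
have mid : Num.min (f (sup S)) (f t) <= v <= Num.max (f (sup S)) (f t).
  by rewrite ge_min le_max fu (ltW ft) orbT.
have [w] := IVT (ltW ut') (withinW su (lexx t) cf) mid.
rewrite in_itv/= => /andP[]; rewrite le_eqVlt => /predU1P[<-|uw] wt fw.
  by move: fv; rewrite fw ltxx.
by have := above w; rewrite uw wt fw ltxx => /(_ isT).
Qed.

(** [last_time] after reversing both time and sign. *)
Lemma first_time s t v f : s <= t -> {within `[s, t], continuous f} ->
  f t = v -> f s < v -> exists2 u, s < u <= t &
    f u = v /\ forall w, s <= w < u -> f w < v.
Proof.
move=> st cf ft fs.
have cg : {within `[- t, - s], continuous (fun w => - f (- w))}.
  apply/within_distP => w /andP[tw ws] e e0.
  have wst : s <= - w <= t by apply/andP; split; lra.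
  have [d d0 dP] := (within_distP _ _ _).1 cf _ wst e e0.
  exists d => // z /andP[tz zs] zw.
  have zst : s <= - z <= t by apply/andP; split; lra.
  have := dP (- z) zst; rewrite -!opprD !normrN; apply.
  exact: zw.
have ts : - t <= - s by rewrite lerN2.
have [||u /andP[tu us] [fu above]] := @last_time _ _ (- v) _ ts cg.
- by rewrite opprK ft.
- by rewrite opprK ltrN2.
exists (- u); first by apply/andP; split; lra.
split; first by rewrite -[LHS]opprK fu opprK.
move=> w /andP[sw wu]; have := above (- w); rewrite opprK ltrN2; apply.
by apply/andP; split; lra.
Qed.

End LastTime.

(** * The lower bound for a drop and its equality case, with the angle centred and oriented *)

Section DropBound.
Context {R : realType}.
Local Notation mu := (@lebesgue_measure R).
Context (a b : R) (x rho theta omega : R -> R) (nu beta ta tb : R).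
Context (px : primitive_on a b x (fun t => rho t * cos (theta t)))
  (crho : {within `[a, b], continuous rho})
  (rho_gt0 : forall t, a <= t <= b -> 0 < rho t)
  (ptheta : primitive_on a b theta omega)
  (ienergy : mu.-integrable `[a, b] (fun t => (omega t ^+ 2 / rho t + rho t)%:E))
  (xab : x a = x b)
  (theta_bound : forall t, a <= t <= b -> - beta <= theta t <= beta)
  (ata : a <= ta) (tatb : ta < tb) (tbb : tb <= b)
  (theta_ta : theta ta = - beta) (theta_tb : theta tb = beta)
  (nu_gt0 : 0 < nu)
  (nu_bound : forall y, - beta <= y <= beta -> 0 <= 1 + cos y / nu).

Let ab : a <= b. Proof. by rewrite (le_trans ata)// (le_trans (ltW tatb)). Qed.

Let p y := 1 + cos y / nu.
Let sp y := Num.sqrt (p y).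

Let csp : continuous sp.
Proof.
move=> y; apply: (@continuous_comp _ _ _ p Num.sqrt); last exact: sqrt_continuous.
apply: der_continuous (derD (derC 1 y) (derM (der_cos (derI y)) (derC nu^-1 y))).
Qed.

Context (P : R -> R) (dP : forall y : R, is_derive y 1 P (sp y)).

Let ctheta : {within `[a, b], continuous theta}.
Proof. exact: primitive_on_continuous ptheta. Qed.

Let E t := \int[mu]_(u in `[a, t]) (omega u ^+ 2 / rho u + rho u).

Let pE : primitive_on a b E (fun t => omega t ^+ 2 / rho t + rho t).
Proof. by split=> // t _; rewrite /E set_itv1 Rintegral_set1 add0r. Qed.

(** Since [x a = x b], [U] and [E] have the same total increment, but the density of [U] carries the
    factor [p (theta)] that vanishes at the extreme angles when [nu = - cos beta]. *)
Let U t := E t + nu^-1 * x t.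

Let pU : primitive_on a b U (fun t => omega t ^+ 2 / rho t + rho t * p (theta t)).
Proof.
apply: primitive_on_eq (primitive_onD pE (primitive_onZ nu^-1 px)) _ _ => // t _.
by rewrite /p; ring.
Qed.

(** [V] accumulates the loss in the arithmetic-geometric inequality: its density is a complete
    square divided by [rho]. *)
Let V t := U t - 2 * P (theta t).

Let pV : primitive_on a b V
  (fun t => (omega t - rho t * sp (theta t)) ^+ 2 / rho t).
Proof.
have pP : primitive_on a b (P \o theta) (fun t => sp (theta t) * omega t).
  apply: (primitive_on_comp ptheta) => //.
  by apply: (within_comp ctheta) => t _; exact: csp.
apply: primitive_on_eq (primitive_onB pU (primitive_onZ 2 pP)) _ _ => // t tab.
have r0 := rho_gt0 tab.
have -> : p (theta t) = sp (theta t) ^+ 2.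
  by rewrite sqr_sqrtr//; apply: nu_bound; exact: theta_bound.
by field; rewrite gt_eqF.
Qed.

Let U_incr s t : a <= s -> s <= t -> t <= b -> U s <= U t.
Proof.
move=> as_ st tb'; apply: (primitive_on_le pU) => // u uab.
have u0 := rho_gt0 uab; rewrite addr_ge0 ?divr_ge0 ?sqr_ge0 ?(ltW u0)//.
by rewrite mulr_ge0 ?(ltW u0)//; apply: nu_bound; exact: theta_bound.
Qed.

Let V_incr s t : a <= s -> s <= t -> t <= b -> V s <= V t.
Proof.
move=> as_ st tb'; apply: (primitive_on_le pV) => // u uab.
by rewrite divr_ge0 ?sqr_ge0// ltW// rho_gt0.
Qed.

Let EU : E b = U b - U a.
Proof.
have Ea : E a = 0 by rewrite /E set_itv1 Rintegral_set1.
by rewrite /U xab Ea; lra.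
Qed.

Let U_outside : U a <= U ta /\ U tb <= U b.
Proof.
split; apply: U_incr => //; first by rewrite (le_trans (ltW tatb)).
by rewrite (le_trans ata)// ltW.
Qed.

(** Between [ta] and [tb] the monotonicity of [V] is used, outside them only that of [U]. Since [P]
    is evaluated along [theta], only the two end angles matter and [theta] may go back and forth. *)
Lemma energy_ge_potential : 2 * (P beta - P (- beta)) <= E b.
Proof.
have [h1 h2] := U_outside; have := V_incr ata (ltW tatb) tbb; rewrite /V theta_ta theta_tb EU; lra.
Qed.

Context (minimal : E b <= 2 * (P beta - P (- beta))).

Let minimal_eq : [/\ U ta = U a, U b = U tb & V tb = V ta].
Proof.
have [h1 h2] := U_outside; have := V_incr ata (ltW tatb) tbb.
by move: minimal; rewrite /V theta_ta theta_tb EU; split; lra.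
Qed.

Let U_l : U ta = U a. Proof. by have [] := minimal_eq. Qed.
Let U_r : U b = U tb. Proof. by have [] := minimal_eq. Qed.
Let V_ab : V tb = V ta. Proof. by have [] := minimal_eq. Qed.

(** The density of [U] is merely integrable, so constancy of [U] is passed on to its part
    [rho * p (theta)]; this one is continuous, and its primitive can be differentiated at every
    point. *)
Let potential_eq0 s t : a <= s -> t <= b -> U s = U t ->
  forall u, s < u < t -> p (theta u) = 0.
Proof.
move=> as_ tb' Ust u /andP[su ut].
have cg : {within `[a, b], continuous (fun t => rho t * p (theta t))}.
  apply: withinM => //; apply: (within_comp ctheta) => y _.
  apply: der_continuous (derD (derC 1 _) (derM (der_cos (derI _)) (derC nu^-1 _))).
pose W t := \int[mu]_(u in `[a, t]) (rho u * p (theta u)).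
have pW : primitive_on a b W (fun t => rho t * p (theta t)).
  split; first exact: integrable_within.
  by move=> w _; rewrite /W set_itv1 Rintegral_set1 add0r.
have Wle v w : s <= v -> v <= w -> w <= t -> W v = W w.
  move=> sv vw wt.
  have av : a <= v by rewrite (le_trans as_).
  have wb : w <= b by rewrite (le_trans wt).
  apply/eqP; rewrite eq_le; apply/andP; split.
    apply: (primitive_on_le pW) => // z zab; rewrite mulr_ge0 ?(ltW (rho_gt0 zab))//.
    by apply: nu_bound; exact: theta_bound.
  have : U v - W v <= U w - W w.
    apply: (primitive_on_le (primitive_onB pU pW)) => // z zab.
    by rewrite addrK divr_ge0 ?sqr_ge0// ltW// rho_gt0.
  have := U_incr as_ sv (le_trans vw wb); have := U_incr (le_trans av vw) wt tb'.
  have := U_incr av vw wb; lra.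
have uab : a < u < b by rewrite (le_lt_trans as_ su) (lt_le_trans ut tb').
have dW := primitive_on_derive pW cg uab.
have dW0 : is_derive u 1 W 0.
  apply: near_eq_is_derive (derC (W u) u).
  have /near_in_itvoo : u \in `]s, t[ by rewrite in_itv/= su.
  apply: filterS => y; rewrite in_itv/= => /andP[/ltW sy /ltW yt].
  have [uy|yu] := leP u y; first exact: Wle (ltW su) uy yt.
  by apply/esym; apply: Wle => //; exact: ltW.
have /eqP := der_inj dW dW0; rewrite mulf_eq0 => /orP[/eqP r0|/eqP//].
by have := @rho_gt0 u; rewrite r0 ltxx; case/andP: uab => /ltW -> /ltW -> /(_ isT).
Qed.

Lemma minimal_cos_outside t : a < t < ta \/ tb < t < b -> cos (theta t) = - nu.
Proof.
move=> tout; have : p (theta t) = 0.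
  case: tout => tin.
    by apply: (potential_eq0 (lexx a) _ (esym U_l)) => //; rewrite (le_trans (ltW tatb)).
  by apply: (potential_eq0 _ (lexx b) (esym U_r)) => //; rewrite (le_trans ata)// ltW.
rewrite /p => /eqP; rewrite addr_eq0 => /eqP h.
have -> : cos (theta t) = cos (theta t) / nu * nu by rewrite divfK// gt_eqF.
by rewrite -[_ / nu]opprK -h mulN1r.
Qed.

(* AM-GM: a function [z] is at most [e + z ^+ 2 / e], and the integral of
   [(omega - rho * sp theta) ^+ 2 / rho] vanishes. *)
Lemma minimal_ode : primitive_on ta tb theta
  (fun t => rho t * Num.sqrt (1 + cos (theta t) / nu)).
Proof.
have csth : {within `[a, b], continuous (sp \o theta)}.
  by apply: (within_comp ctheta) => t _; exact: csp.
have cg := withinM crho csth.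
pose I t := \int[mu]_(u in `[a, t]) (rho u * sp (theta u)).
have pI : primitive_on a b I (fun t => rho t * sp (theta t)).
  split; first exact: integrable_within.
  by move=> w _; rewrite /I set_itv1 Rintegral_set1 add0r.
have pZ := primitive_onB ptheta pI.
have [M M0 rM] := within_bounded crho.
have Vst s t : ta <= s -> s <= t -> t <= tb -> V t = V s.
  move=> tas st ttb.
  have h1 := V_incr ata tas (le_trans st (le_trans ttb tbb)).
  have h2 := V_incr (le_trans ata tas) st (le_trans ttb tbb).
  have h3 := V_incr (le_trans ata (le_trans tas st)) ttb tbb.
  by move: V_ab; lra.
have pid : primitive_on a b (fun t => t) (fun=> 1).
  by apply: primitive_on_C1; [exact: within_cst|by apply: withinT => t; exact: cvg_id].
(* [eps] stands for the two signs, which bound [theta - I] from both sides. The bound [M] on [rho]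
   turns the square into a multiple of the density of [V]. *)
have bound t e (eps : R) : a <= t <= b -> 0 < e -> eps ^+ 2 = 1 ->
    eps * (omega t - rho t * sp (theta t)) <=
    e * 1 + M / e * ((omega t - rho t * sp (theta t)) ^+ 2 / rho t).
  move=> tab e0 eps1; set z := omega t - _.
  have r0 := rho_gt0 tab.
  have rMt : rho t <= M by rewrite (le_trans (ler_norm _))// rM.
  have h1 : z ^+ 2 / e <= M / e * (z ^+ 2 / rho t).
    have -> : M / e * (z ^+ 2 / rho t) = (z ^+ 2 / e) * (M / rho t).
      by field; rewrite !gt_eqF.
    by rewrite ler_peMr ?divr_ge0 ?sqr_ge0 ?(ltW e0)// ler_pdivlMr// mul1r.
  rewrite mulr1; apply: le_trans (lerD (lexx _) h1).
  have -> : z ^+ 2 / e = (eps * z) ^+ 2 / e by rewrite exprMn eps1 mul1r.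
  rewrite -subr_ge0.
  have -> : e + (eps * z) ^+ 2 / e - eps * z =
    ((e - eps * z / 2) ^+ 2 + 3 / 4 * (eps * z) ^+ 2) / e by field; rewrite gt_eqF.
  by rewrite divr_ge0 ?(ltW e0)// addr_ge0 ?sqr_ge0// mulr_ge0// sqr_ge0.
have Zst (eps : R) s t : eps ^+ 2 = 1 -> ta <= s -> s <= t -> t <= tb ->
    eps * (theta t - I t) <= eps * (theta s - I s).
  move=> eps1 tas st ttb; apply/ler_addgt0Pr => e0' e0'0.
  pose e := e0' / (t - s + 1).
  have e0 : 0 < e by rewrite divr_gt0//; lra.
  have pB := primitive_onB (primitive_onD (primitive_onZ e pid) (primitive_onZ (M / e) pV))
    (primitive_onZ eps pZ).
  have := primitive_on_le pB _ (le_trans ata tas) st (le_trans ttb tbb).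
  have h : e * (t - s) <= e0'.
    by rewrite /e mulrAC ler_pdivrMr ?ler_wpM2l ?(ltW e0'0)//; lra.
  move=> /(_ _)/wrap[u uab|]; first by rewrite subr_ge0; exact: bound.
  by rewrite (Vst s t)//; move: h; lra.
apply: primitive_on_eq (primitive_onD (primitive_onW pI ata tbb)
  (primitive_on_cst ta tb (theta ta - I ta))) _ _ => t /andP[tat ttb].
  have h1 := Zst 1 _ _ (expr1n _ _) (lexx ta) tat ttb.
  have N1 : (-1) ^+ 2 = 1 :> R by rewrite sqrrN expr1n.
  have h2 := Zst (-1) _ _ N1 (lexx ta) tat ttb.
  by move: h1 h2; rewrite !mul1r !mulN1r; rewrite /cst; lra.
by rewrite /cst addr0.
Qed.

End DropBound.

(** * From the equality case to the half period of the wave *)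

Section MinimalDrop.
Context {R : realType}.
Local Notation mu := (@lebesgue_measure R).
Implicit Types (a b s t y z : R).

Lemma cos_double y : cos (2 * y) = 1 - 2 * sin y ^+ 2 :> R.
Proof.
by rewrite (_ : 2 * y = y + y) ?cosD -?expr2 ?cos2sin2; ring.
Qed.

Lemma sin_double y : sin (2 * y) = 2 * sin y * cos y :> R.
Proof. by rewrite (_ : 2 * y = y + y) ?sinD; ring. Qed.

Lemma cos_half_sqr y : cos y = 1 - 2 * sin (y / 2) ^+ 2 :> R.
Proof. by rewrite -cos_double; congr cos; field. Qed.

Lemma sin_half y : sin y = 2 * sin (y / 2) * cos (y / 2) :> R.
Proof. by rewrite -sin_double; congr sin; field. Qed.

Lemma cos_lt_bound y z : z <= pi -> - z < y < z -> cos z < cos y :> R.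
Proof.
move=> zpi; rewrite -ltr_norml => yz; rewrite -[cos y]cos_norm.
have z0 : 0 < z by rewrite (le_lt_trans _ yz).
by rewrite ltr_cos// in_itv/= ?normr_ge0/= ?(le_trans (ltW yz))// (ltW z0).
Qed.

Context (m beta : R) (m2 : 1 / 2 < m) (m1 : m < 1)
  (beta_gt0 : 0 < beta) (beta_lt : beta < pi) (cos_beta : cos beta = - (2 * m - 1)).

Let k := Num.sqrt m.
Let k0 : 0 < k.
Proof. by move: m2; rewrite sqrtr_gt0; lra. Qed.
Let k2 : k ^+ 2 = m.
Proof. by rewrite sqr_sqrtr//; move: m2; lra. Qed.
Let a0 : 0 < scale m. Proof. exact: scale_gt0. Qed.
Let a2 : scale m ^+ 2 = 2 * (2 * m - 1). Proof. exact: scale_sqr. Qed.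
Let nu0 : 0 < 2 * m - 1.
Proof. by move: m2; lra. Qed.

Lemma sin_half_beta : sin (beta / 2) = k.
Proof.
have [b0 bpi] := (beta_gt0, beta_lt).
have s0 : 0 < sin (beta / 2) by apply: sin_gt0_pi; apply/andP; split; lra.
apply/eqP; rewrite -(eqrXn2 (n := 2)) ?ltW// k2; apply/eqP.
by have := cos_half_sqr beta; rewrite cos_beta; lra.
Qed.

(** Substitution of the angle by the amplitude, [y = 2 * asin (k * sin x)]: the square root becomes
    [2 * k / scale m * cos x], and the integrand becomes that of [bending] up to a constant
    factor. *)
Lemma potential_increment (P : R -> R) :
  (forall y, is_derive y 1 P (Num.sqrt (1 + cos y / (2 * m - 1)))) ->
  P beta - P (- beta) = 4 / scale m * bending m (pi / 2).
Proof.
move=> dP; have pi0 := pi_gt0 R; have [be0 bpi] := (beta_gt0, beta_lt).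
have [b0 db] := bendingP m1.
have ks y : - 1 < k * sin y < 1.
  rewrite -ltr_norml -(@ltr_pXn2r _ 2)// ?nnegrE// -normrX ger0_norm ?sqr_ge0//.
  by rewrite exprMn k2 expr1n; have := delta_arg_gt0 y m1; lra.
pose T y := 2 * asin (k * sin y).
have dT y : is_derive y 1 T (2 * k * cos y / delta m y).
  apply: (der_eq (derZ 2 (@der_comp _ (@asin R) (fun y => k * sin y) y _ _
    (is_derive1_asin (ks y)) (derZ k (der_sin (derI y)))))).
  by rewrite exprMn k2 -/(delta m y); field; exact: delta_neq0.
have sT y : sin (T y / 2) = k * sin y.
  rewrite /T (_ : 2 * _ / 2 = asin (k * sin y)); last by field.
  by rewrite asinK// in_itv/=; have /andP[/ltW -> /ltW ->] := ks y.
have spE y : - (pi / 2) < y < pi / 2 ->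
    Num.sqrt (1 + cos (T y) / (2 * m - 1)) = 2 * k / scale m * cos y.
  move=> /cos_gt0_pihalf c0.
  have -> : 1 + cos (T y) / (2 * m - 1) = (2 * k / scale m * cos y) ^+ 2.
    rewrite (cos_half_sqr (T y)) sT !exprMn k2 exprVn a2 cos2sin2.
    by field; rewrite gt_eqF.
  rewrite sqrtr_sqr ger0_norm// mulr_ge0 ?(ltW c0)// divr_ge0 ?(ltW a0)//.
  by rewrite mulr_ge0// ltW.
have dF y : is_derive y 1 (fun y => P (T y) - 4 / scale m * bending m y)
   (Num.sqrt (1 + cos (T y) / (2 * m - 1)) * (2 * k * cos y / delta m y) -
    4 / scale m * (m * cos y ^+ 2 / delta m y)).
  exact: (derB (der_comp (dP (T y)) (dT y)) (derZ _ (db y))).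
have := @der0_eq _ (- (pi / 2)) (pi / 2) _ (der_within dF).
move=> /(_ _ _)/wrap[y yp||].
- apply: (der_eq (dF y)); rewrite spE//.
  have d0 := delta_neq0 y m1; have s0 : scale m != 0 by rewrite gt_eqF.
  move: (scale m) (delta m y) s0 d0 => A D A0 D0; rewrite -k2.
  by field; rewrite A0 D0.
- lra.
rewrite b0 mulr0 subr0 /T sinN sin_pihalf mulrN mulr1.
have -> : asin k = beta / 2.
  by rewrite -sin_half_beta sinK// in_itv/=; apply/andP; split; lra.
have -> : asin (- k) = - (beta / 2).
  by rewrite -sin_half_beta -sinN sinK// in_itv/=; apply/andP; split; lra.
have -> : 2 * - (beta / 2) = - beta by field.
have -> : 2 * (beta / 2) = beta by field.
lra.
Qed.

Context (root : abscissa m (pi / 2) = 0).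
Context (a b : R) (x y rho theta : R -> R) (ta tb : R).
Context (px : primitive_on a b x (fun t => rho t * cos (theta t)))
  (py : primitive_on a b y (fun t => rho t * sin (theta t)))
  (crho : {within `[a, b], continuous rho})
  (rho_gt0 : forall t, a <= t <= b -> 0 < rho t)
  (ctheta : {within `[a, b], continuous theta})
  (xab : x a = x b)
  (theta_bound : forall t, a <= t <= b -> - beta <= theta t <= beta)
  (ata : a <= ta) (tatb : ta < tb) (tbb : tb <= b)
  (theta_ta : theta ta = - beta) (theta_tb : theta tb = beta)
  (outside : forall t, a < t < ta \/ tb < t < b -> cos (theta t) = - (2 * m - 1))
  (ode : primitive_on ta tb theta
    (fun t => rho t * Num.sqrt (1 + cos (theta t) / (2 * m - 1)))).

(** Where the angle rests at [- beta] or [beta] the curve is a straight segment whose [x]-component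
    points backwards, because [cos beta] is negative. *)
Let x_decr s t : a <= s -> s < t -> t <= b ->
  (forall u, s < u < t -> cos (theta u) = - (2 * m - 1)) -> x t < x s.
Proof.
move=> as_ st tb' cE; rewrite -ltrN2.
have cg : {within `[s, t], continuous (fun t => rho t * cos (theta t))}.
  apply: (withinW as_ tb'); apply: withinM => //; apply: (within_comp ctheta) => u _.
  exact: continuous_cos.
have p := primitive_onW px as_ tb'.
apply: (@der_gt0_lt _ s t (fun t => - x t) (fun t => - (rho t * cos (theta t)))) => //.
- by apply: withinN; apply: primitive_on_continuous p; exact: ltW.
- by move=> u sut; apply: derN; exact: primitive_on_derive p cg sut.
- move=> u /[dup] sut /andP[su ut]; rewrite (cE _ sut) mulrN opprK.
  apply: mulr_gt0 => //; apply: rho_gt0.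
  by rewrite (le_trans as_ (ltW su)) (le_trans (ltW ut) tb').
Qed.

(** The equation for [theta] does not determine when the solution leaves [- beta] nor how long it
    stays at [beta]. Between these rests the amplitude describes the arc completely; the rests
    themselves are removed at the end by the closing condition. *)
Lemma minimal_structure : exists psi : R -> R,
  [/\ psi a = - (pi / 2), psi b = pi / 2, theta a = - beta, theta b = beta &
    forall t, a <= t <= b ->
    [/\ - (pi / 2) <= psi t <= pi / 2,
       scale m * reduced_length m (psi t) = \int[mu]_(u in `[a, t]) rho u,
       x t = x a + scale m * abscissa m (psi t) &
       y t = y a - 2 * scale m * k * cos (psi t)]].
Proof.
have pi0 := pi_gt0 R; have [m2' m1'] := (m2, m1); have nu0' := nu0.
have [be0 bpi] := (beta_gt0, beta_lt); have [thta thtb] := (theta_ta, theta_tb).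
have ctab : {within `[ta, tb], continuous theta} by exact: withinW ctheta.
have bb : - beta < theta tb by rewrite theta_tb; lra.
(* The angle may stay at [- beta] after [ta] and reach [beta] before [tb]; [u] and [v] delimit the
   part where it lies strictly between. *)
have [u /andP[tau utb] [thu above]] := last_time (ltW tatb) ctab theta_ta bb.
have cutb : {within `[u, tb], continuous theta} by exact: withinW ctab.
have bb' : theta u < beta by rewrite thu; lra.
have [v /andP[uv vtb] [thv below]] := first_time (ltW utb) cutb theta_tb bb'.
have th_incr s t : ta <= s -> s <= t -> t <= tb -> theta s <= theta t.
  apply: (primitive_on_le ode) => w /andP[taw wtb].
  rewrite mulr_ge0 ?sqrtr_ge0// ltW// rho_gt0//.
  by rewrite (le_trans ata taw) (le_trans wtb tbb).
have au : a <= u by rewrite (le_trans ata).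
have vb : v <= b by rewrite (le_trans vtb).
have left_cos w : a < w < u -> cos (theta w) = - (2 * m - 1).
  move=> /andP[aw wu]; have [wta|taw] := ltP w ta; first by apply: outside; left; rewrite aw.
  have h1 := th_incr _ _ (lexx ta) taw (le_trans (ltW wu) (ltW utb)).
  have h2 := th_incr _ _ taw (ltW wu) (ltW utb).
  have -> : theta w = - beta by lra.
  by rewrite cosN.
have right_cos w : v < w < b -> cos (theta w) = - (2 * m - 1).
  move=> /andP[vw wb]; have [wtb|tbw] := leP w tb; last first.
    by apply: outside; right; rewrite tbw.
  have tav : ta <= v by rewrite (le_trans tau)// ltW.
  have h1 := th_incr _ _ tav (ltW vw) wtb.
  have h2 := th_incr _ _ (le_trans tav (ltW vw)) wtb (lexx tb).
  have -> : theta w = beta by lra.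
  exact: cos_beta.
have cth : {within `[u, v], continuous theta} by exact: withinW ctheta.
have crh : {within `[u, v], continuous rho} by exact: withinW crho.
have cch : {within `[u, v], continuous (fun t => cos (theta t / 2))}.
  apply: (within_comp (G := fun z => cos (z / 2)) cth) => z _.
  exact: der_continuous (der_cos (derM (derI _) (derC 2^-1 _))).
have csh : {within `[u, v], continuous (fun t => sin (theta t / 2))}.
  apply: (within_comp (G := fun z => sin (z / 2)) cth) => z _.
  exact: der_continuous (der_sin (derM (derI _) (derC 2^-1 _))).
(* The amplitude is defined by integrating its expected speed [rho * delta / scale], with
   [cos (theta / 2)] in the role of [delta]. Solving [sin (theta / 2) = k * sin psi] for [psi] would
   not be differentiable at the ends. *)
pose w t := rho t * cos (theta t / 2) / scale m.
have cw : {within `[u, v], continuous w}.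
  by apply: withinM; [exact: withinM|exact: within_cst].
pose psi t := - (pi / 2) + \int[mu]_(z in `[u, t]) w z.
have ppsi : primitive_on u v psi w.
  split; first exact: integrable_within.
  by move=> t _; rewrite /psi set_itv1 Rintegral_set1 addr0.
have psiu : psi u = - (pi / 2) by rewrite /psi set_itv1 Rintegral_set1 addr0.
have uvW := ltW uv.
have cpsi := primitive_on_continuous uvW ppsi.
pose sp t := Num.sqrt (1 + cos (theta t) / (2 * m - 1)).
have csp : {within `[u, v], continuous sp}.
  apply: (within_comp (G := Num.sqrt) (f := fun t => 1 + cos (theta t) / (2 * m - 1))).
    apply: (within_comp (G := fun z => 1 + cos z / (2 * m - 1)) cth) => z _.
    exact: der_continuous (derD (derC 1 _) (derM (der_cos (derI _)) (derC _ _))).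
  by move=> z _; exact: sqrt_continuous.
have inab t : u <= t <= v -> a <= t <= b.
  by move=> /andP[ut tv]; rewrite (le_trans au ut) (le_trans tv vb).
have dth t : u < t < v -> is_derive t 1 theta (rho t * sp t).
  by move=> tuv; apply: (primitive_on_derive (primitive_onW ode tau vtb)) => //; exact: withinM.
have dpsi t : u < t < v -> is_derive t 1 psi (w t) by exact: primitive_on_derive ppsi cw.
have p_gt0 t : u < t < v -> 0 < 1 + cos (theta t) / (2 * m - 1).
  move=> /andP[ut tv]; have : cos beta < cos (theta t).
    apply: cos_lt_bound; first exact: ltW.
    by rewrite above ?below ?(ltW ut) ?ut ?tv// (le_trans (ltW tv)).
  rewrite cos_beta => h.
  have : -1 < cos (theta t) / (2 * m - 1) by rewrite ltr_pdivlMr// mulN1r.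
  lra.
(* The expected cosine and sine of [psi]. By the equation for [theta] the vector [(u1, u2)] turns at
   speed [w], as [(cos psi, sin psi)] does, and both start at [(0, -1)]; scalar and cross product
   then show that they agree. *)
pose u1 t := scale m / (2 * k) * sp t.
pose u2 t := k^-1 * sin (theta t / 2).
have cu1 : {within `[u, v], continuous u1} by apply: withinM => //; exact: within_cst.
have cu2 : {within `[u, v], continuous u2} by apply: withinM => //; exact: within_cst.
have du1 t : u < t < v -> is_derive t 1 u1 (- u2 t * w t).
  move=> tuv; have sp0 : 0 < sp t by rewrite sqrtr_gt0; exact: p_gt0.
  have dc := derM (der_cos (dth t tuv)) (derC (2 * m - 1)^-1 t).
  have ds := der_sqrt (f := fun t => 1 + cos (theta t) / (2 * m - 1))
    (p_gt0 t tuv) (derD (derC 1 t) dc).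
  apply: (der_eq (derZ (scale m / (2 * k)) ds)).
  rewrite -/(sp t) /u2 /w (sin_half (theta t)).
  have -> : 2 * m - 1 = scale m ^+ 2 / 2 by rewrite a2; field.
  by field; rewrite !gt_eqF.
have du2 t : u < t < v -> is_derive t 1 u2 (u1 t * w t).
  move=> tuv.
  apply: (der_eq (derZ k^-1 (der_sin (derM (dth t tuv) (derC 2^-1 t))))).
  by rewrite /u1 /w; field; rewrite !gt_eqF.
have ccp : {within `[u, v], continuous (fun t => cos (psi t))}.
  by apply: (within_comp cpsi) => z _; exact: continuous_cos.
have csps : {within `[u, v], continuous (fun t => sin (psi t))}.
  by apply: (within_comp cpsi) => z _; exact: continuous_sin.
have spu : sp u = 0.
  rewrite /sp thu cosN cos_beta mulNr divff ?gt_eqF// subrr; exact: sqrtr0.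
have u2u : u2 u = -1.
  by rewrite /u2 thu mulNr sinN sin_half_beta mulrN mulVf// gt_eqF.
have fE t : u <= t <= v -> u1 t * cos (psi t) + u2 t * sin (psi t) = 1.
  move=> /andP[ut tv].
  have <- : u1 u * cos (psi u) + u2 u * sin (psi u) = 1.
    by rewrite psiu sinN sin_pihalf u2u cosN cos_pihalf; ring.
  apply/esym; apply: (@der0_eq _ u t (fun t => u1 t * cos (psi t) + u2 t * sin (psi t))) => //.
    by apply: (withinW (lexx u) tv); apply: withinD; exact: withinM.
  move=> z /andP[uz zt]; have zuv : u < z < v by rewrite uz (lt_le_trans zt).
  apply: (der_eq (derD (derM (du1 z zuv) (der_cos (dpsi z zuv)))
     (derM (du2 z zuv) (der_sin (dpsi z zuv))))); ring.
have gE t : u <= t <= v -> u2 t * cos (psi t) - u1 t * sin (psi t) = 0.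
  move=> /andP[ut tv].
  have <- : u2 u * cos (psi u) - u1 u * sin (psi u) = 0.
    by rewrite psiu sinN sin_pihalf u2u cosN cos_pihalf /u1 spu; ring.
  apply/esym; apply: (@der0_eq _ u t (fun t => u2 t * cos (psi t) - u1 t * sin (psi t))) => //.
    by apply: (withinW (lexx u) tv); apply: withinB; exact: withinM.
  move=> z /andP[uz zt]; have zuv : u < z < v by rewrite uz (lt_le_trans zt).
  apply: (der_eq (derB (derM (du2 z zuv) (der_cos (dpsi z zuv)))
     (derM (du1 z zuv) (der_sin (dpsi z zuv))))); ring.
have u1E t : u <= t <= v -> cos (psi t) = u1 t.
  move=> tuv; have := fE t tuv; have := gE t tuv; have := cos2Dsin2 (psi t).
  set C := cos (psi t); set S := sin (psi t) => h1 h2 h3.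
  have -> : u1 t = u1 t * (C ^+ 2 + S ^+ 2) by rewrite h1 mulr1.
  have -> : u1 t * (C ^+ 2 + S ^+ 2) =
    C * (u1 t * C + u2 t * S) - S * (u2 t * C - u1 t * S) by ring.
  by rewrite h2 h3; ring.
have u2E t : u <= t <= v -> sin (psi t) = u2 t.
  move=> tuv; have := fE t tuv; have := gE t tuv; have := cos2Dsin2 (psi t).
  set C := cos (psi t); set S := sin (psi t) => h1 h2 h3.
  have -> : u2 t = u2 t * (C ^+ 2 + S ^+ 2) by rewrite h1 mulr1.
  have -> : u2 t * (C ^+ 2 + S ^+ 2) =
    S * (u1 t * C + u2 t * S) + C * (u2 t * C - u1 t * S) by ring.
  by rewrite h2 h3; ring.
have ch_gt0 t : u <= t <= v -> 0 < cos (theta t / 2).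
  move=> /inab /theta_bound /andP[? ?]; apply: cos_gt0_pihalf.
  by apply/andP; split; lra.
have w_ge0 t : u <= t <= v -> 0 < w t.
  by move=> tuv; rewrite divr_gt0// mulr_gt0 ?ch_gt0// rho_gt0// inab.
have psi_ge t : u <= t <= v -> - (pi / 2) <= psi t.
  move=> /andP[ut tv]; rewrite -psiu; apply: (primitive_on_le ppsi) => // z zuv.
  exact: ltW (w_ge0 z zuv).
have psi_le t : u <= t <= v -> psi t <= pi / 2.
  move=> /andP[ut tv]; rewrite leNgt; apply/negP => h.
  (* Truncation at [pi] gives a value attained by [psi] at which the cosine is negative, against
     [cos psi = u1 >= 0]. *)
  pose z := Num.min (psi t) pi.
  have z1 : pi / 2 < z by rewrite /z lt_min h; lra.
  have z2 : z <= psi t by rewrite /z ge_min lexx.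
  have z3 : z <= pi by rewrite /z ge_min lexx orbT.
  have mid : Num.min (psi u) (psi t) <= z <= Num.max (psi u) (psi t).
    by rewrite ge_min le_max z2 orbT andbT psiu; apply/orP; left; lra.
  have [q] := IVT ut (withinW (lexx u) tv cpsi) mid.
  rewrite in_itv/= => /andP[uq qt] qz.
  have quv : u <= q <= v by rewrite uq (le_trans qt).
  have : 0 <= cos (psi q).
    by rewrite u1E// /u1 mulr_ge0 ?sqrtr_ge0// divr_ge0 ?(ltW a0)// mulr_ge0 ?(ltW k0).
  rewrite qz leNgt => /negP; apply.
  rewrite -[z](subrK (pi / 2)) cosDpihalf oppr_lt0; apply: sin_gt0_pi.
  by apply/andP; split; lra.
have psiv : psi v = pi / 2.
  have vuv : u <= v <= v by rewrite uvW lexx.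
  apply: sin_inj; rewrite ?in_itv/= ?psi_ge ?psi_le//.
    by apply/andP; split; lra.
  by rewrite u2E// /u2 thv sin_half_beta sin_pihalf mulVf// gt_eqF.
have chE t : u <= t <= v -> cos (theta t / 2) = delta m (psi t).
  move=> tuv; apply/eqP; rewrite -(eqrXn2 (n := 2)) ?(ltW (ch_gt0 t tuv)) ?ltW ?delta_gt0//.
  rewrite delta_sqr ?ltW// u2E// cos2sin2; apply/eqP; congr (1 - _).
  have mn0 : m != 0 by rewrite gt_eqF//; lra.
  by rewrite /u2 exprMn exprVn k2; field.
have shE t : u <= t <= v -> sin (theta t / 2) = k * sin (psi t).
  by move=> tuv; rewrite u2E// /u2 mulVKf// gt_eqF.
have wE t : u <= t <= v -> w t = rho t * delta m (psi t) / scale m.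
  by move=> tuv; rewrite /w chE.
have [A0 dA] := abscissaP m1; have [L0 dL] := reduced_lengthP m1.
have within_p (G : R -> R) (dG : forall z, {for z, continuous G}) :
    {within `[u, v], continuous (fun t => G (psi t))}.
  by apply: (within_comp cpsi) => z _; exact: dG.
have cosE t : u <= t <= v -> cos (theta t) = 1 - 2 * m * sin (psi t) ^+ 2.
  by move=> tuv; rewrite cos_half_sqr shE// exprMn k2 mulrA.
have sinE t : u <= t <= v -> sin (theta t) = 2 * k * sin (psi t) * delta m (psi t).
  by move=> tuv; rewrite sin_half shE// chE// mulrA.
have ccos : {within `[u, v], continuous (fun t => rho t * cos (theta t))}.
  by apply: withinM => //; apply: (within_comp cth) => z _; exact: continuous_cos.
have csin : {within `[u, v], continuous (fun t => rho t * sin (theta t))}.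
  by apply: withinM => //; apply: (within_comp cth) => z _; exact: continuous_sin.
have px' := primitive_onW px au vb; have py' := primitive_onW py au vb.
have xE t : u <= t <= v -> x t = x u + scale m * abscissa m (psi t).
  move=> /andP[ut tv].
  suff : x u - scale m * abscissa m (psi u) = x t - scale m * abscissa m (psi t).
    by rewrite psiu A0; lra.
  apply: (@der0_eq _ u t (fun t => x t - scale m * abscissa m (psi t))) => //.
    apply: (withinW (lexx u) tv); apply: withinB; first exact: primitive_on_continuous px'.
    apply: withinM; first exact: within_cst.
    by apply: within_p => z; exact: der_continuous (dA z).
  move=> z /andP[uz zt]; have zuv : u < z < v by rewrite uz (lt_le_trans zt).
  have zuv' : u <= z <= v by case/andP: zuv => /ltW -> /ltW ->.
  apply: (der_eq (derB (primitive_on_derive px' ccos zuv)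
     (derZ (scale m) (der_comp (dA (psi z)) (dpsi z zuv))))).
  by rewrite wE// cosE//; field; rewrite delta_neq0// gt_eqF.
have yE t : u <= t <= v -> y t = y u - 2 * scale m * k * cos (psi t).
  move=> /andP[ut tv].
  suff : y u + 2 * scale m * k * cos (psi u) = y t + 2 * scale m * k * cos (psi t).
    by rewrite psiu cosN cos_pihalf; lra.
  apply: (@der0_eq _ u t (fun t => y t + 2 * scale m * k * cos (psi t))) => //.
    apply: (withinW (lexx u) tv); apply: withinD; first exact: primitive_on_continuous py'.
    by apply: withinM => //; exact: within_cst.
  move=> z /andP[uz zt]; have zuv : u < z < v by rewrite uz (lt_le_trans zt).
  have zuv' : u <= z <= v by case/andP: zuv => /ltW -> /ltW ->.
  apply: (der_eq (derD (primitive_on_derive py' csin zuv)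
     (derZ (2 * scale m * k) (der_cos (dpsi z zuv))))).
  by rewrite wE// sinE//; field; rewrite gt_eqF.
have xv : x v = x u by rewrite xE ?uvW ?lexx// psiv root mulr0 addr0.
(* By [root] the arc over [[u, v]] returns to its initial abscissa, so a segment running backwards
   before or after it would contradict [x a = x b]. *)
have au' : a = u.
  apply/eqP; rewrite eq_le au/= leNgt; apply/negP => lt.
  have h1 := x_decr (lexx a) lt (le_trans uvW vb) left_cos.
  have h2 : x b <= x v.
    move: vb; rewrite le_eqVlt => /predU1P[->//|vb'].
    by apply/ltW; apply: (x_decr (le_trans au uvW) vb' (lexx b) right_cos).
  by move: xab; lra.
have bv : b = v.
  apply/eqP; rewrite eq_le vb andbT leNgt; apply/negP => lt.
  have h := x_decr (le_trans au uvW) lt (lexx b) right_cos.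
  by move: xab; rewrite au'; lra.
exists psi; rewrite au' bv; split=> // t tuv; split.
- by rewrite psi_ge// psi_le.
- have /andP[ut tv] := tuv.
  pose S z := \int[mu]_(q in `[u, z]) rho q.
  have pS : primitive_on u v S rho.
    split; first exact: integrable_within.
    by move=> z _; rewrite /S set_itv1 Rintegral_set1 add0r.
  rewrite -/(S t); have Su : S u = 0 by rewrite /S set_itv1 Rintegral_set1.
  pose h z := scale m * reduced_length m (psi z) - S z.
  have ch : {within `[u, t], continuous h}.
    apply: (withinW (lexx u) tv); apply: withinB; last exact: primitive_on_continuous pS.
    apply: withinM; first exact: within_cst.
    by apply: within_p => z; exact: der_continuous (dL z).
  have dh z : u < z < t -> is_derive z 1 h 0.
    move=> /andP[uz zt]; have zuv : u < z < v by rewrite uz (lt_le_trans zt).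
    have zuv' : u <= z <= v by case/andP: zuv => /ltW -> /ltW ->.
    have dh := derB (derZ (scale m) (der_comp (dL (psi z)) (dpsi z zuv)))
      (primitive_on_derive pS crh zuv).
    apply: (der_eq dh).
    by rewrite wE//; field; rewrite delta_neq0// gt_eqF.
  have := der0_eq ch dh ut; rewrite /h psiu L0 Su; lra.
- exact: xE.
- exact: yE.
Qed.

End MinimalDrop.

(** * Sharp lower bound for drops and structure of the minimal ones *)

Section DropTheorem.
Context {R : realType}.
Local Notation mu := (@lebesgue_measure R).
Implicit Types (a b s t y z : R) (c : R -> R * R).

(** For [e] equal to 1 or -1, an isometry taking the origin, where the wave starts, to [p]; the sign
    -1 inserts a reflection in the axis of the wave. *)
Definition rigid (e al : R) (p q : R * R) : R * R :=
  (p.1 + (cos al * q.1 - e * sin al * q.2), p.2 + (sin al * q.1 + e * cos al * q.2)).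

(** On [[- pi, pi]] the integrand is [Num.sqrt 2 * cos (y / 2)], and the remaining angles contribute
    nonnegatively. This is the limit [m = 1] of the wave. *)
Lemma potential_increment_ge_pi (beta : R) (P : R -> R) : pi <= beta ->
  (forall y, is_derive y 1 P (Num.sqrt (1 + cos y / 1))) ->
  4 * Num.sqrt 2 <= P beta - P (- beta).
Proof.
move=> bpi dP; have pi0 := pi_gt0 R.
have Pmono s t : s <= t -> P s <= P t.
  by move=> st; apply: (der_ge0_le (der_within dP) (fun y _ => dP y)).
have h1 := Pmono _ _ bpi.
have h2 : P (- beta) <= P (- pi) by apply: Pmono; rewrite lerN2.
pose G y := 2 * Num.sqrt 2 * sin (y / 2).
have dG y : is_derive y 1 G (Num.sqrt 2 * cos (y / 2)).
  apply: (der_eq (derZ (2 * Num.sqrt 2) (der_sin (derM (derI y) (derC 2^-1 y))))).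
  by field.
have dF y : - pi < y < pi -> is_derive y 1 (fun y => P y - G y) 0.
  move=> /andP[piy ypi]; apply: (der_eq (derB (dP y) (dG y))).
  have c0 : 0 <= cos (y / 2) by apply/cos_ge0_pihalf/andP; split; lra.
  rewrite (_ : 1 + cos y / 1 = 2 * cos (y / 2) ^+ 2).
    by rewrite sqrtrM// sqrtr_sqr ger0_norm// subrr.
  by rewrite (cos_half_sqr y) cos2sin2; field.
have cF : {within `[- pi, pi], continuous (fun y => P y - G y)}.
  by apply: withinB; [exact: der_within dP|exact: der_within dG].
have pipi : - pi <= pi :> R by lra.
have := der0_eq cF dF pipi; rewrite /G mulNr sinN sin_pihalf; lra.
Qed.

Context (m : R) (m2 : 1 / 2 < m) (m1 : m < 1) (root : abscissa m (pi / 2) = 0).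
Context (a b : R) (ab : a < b) (c : R -> R * R) (rho drho theta omega : R -> R).
Context (pf : polar_form a b c rho drho theta omega) (cab : c a = c b).

Let E := \int[mu]_(t in `[a, b]) (omega t ^+ 2 / rho t + rho t).

Let abW : a <= b.
Proof. exact: ltW. Qed.

Let ctheta : {within `[a, b], continuous theta}.
Proof. exact: primitive_on_continuous abW (polar_theta pf). Qed.

Let crho : {within `[a, b], continuous rho}.
Proof. exact: primitive_on_continuous abW (polar_rho pf). Qed.

(** The end angles are recorded in order to glue two loops at a double point. The amplitude is tied
    to arclength because comparison of arclengths yields the reparametrizations. *)
Definition minimal_drop_structure : Prop := exists e al beta (psi : R -> R),
  [/\ e = 1 \/ e = -1, cos beta = - (2 * m - 1) /\ 0 < beta < pi,
      theta a = al - e * beta /\ theta b = al + e * beta,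
      psi a = - (pi / 2) /\ psi b = pi / 2 &
      forall t, a <= t <= b ->
        [/\ - (pi / 2) <= psi t <= pi / 2,
            scale m * reduced_length m (psi t) = \int[mu]_(u in `[a, t]) rho u &
            c t = rigid e al (c a) (wave m (psi t))]].

(** The sign [e] is chosen so that the minimum of [e * (theta - al)] is taken before its maximum.
    After rotating by [al], and reflecting if [e = -1], the centred estimates apply. *)
Lemma oriented_drop e al beta ta tb : e = 1 \/ e = -1 ->
  (forall t, a <= t <= b -> - beta <= e * (theta t - al) <= beta) ->
  a <= ta -> ta <= tb -> tb <= b ->
  e * (theta ta - al) = - beta -> e * (theta tb - al) = beta ->
  drop_energy m <= E /\ (E <= drop_energy m -> minimal_drop_structure).
Proof.
move=> he thb ata tatb tbb thta thtb; have pi0 := pi_gt0 R; have ab1 := ab; have [m2_ m1_] := (m2, m1).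
have e2 : e * e = 1 by case: he => ->; ring.
have ee z : e * (e * z) = z by rewrite mulrA e2 mul1r.
pose th t := e * (theta t - al).
have cosE t : cos (th t) = cos al * cos (theta t) + sin al * sin (theta t).
  by rewrite /th; case: he => ->; rewrite ?mul1r ?mulN1r ?cosN cosB; ring.
have sinE t : sin (th t) = e * (cos al * sin (theta t) - sin al * cos (theta t)).
  by rewrite /th; case: he => ->; rewrite ?mul1r ?mulN1r ?sinN sinB; ring.
pose x t := cos al * (c t).1 + sin al * (c t).2.
pose y t := e * (cos al * (c t).2 - sin al * (c t).1).
have px : primitive_on a b x (fun t => rho t * cos (th t)).
  apply: primitive_on_eq (primitive_onD (primitive_onZ (cos al) (polar_x pf))
    (primitive_onZ (sin al) (polar_y pf))) _ _ => // t _.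
  by rewrite cosE; ring.
have py : primitive_on a b y (fun t => rho t * sin (th t)).
  apply: primitive_on_eq (primitive_onZ e (primitive_onB (primitive_onZ (cos al) (polar_y pf))
    (primitive_onZ (sin al) (polar_x pf)))) _ _ => // t _.
  by rewrite sinE; ring.
have pth : primitive_on a b th (fun t => e * omega t).
  apply: primitive_on_eq (primitive_onZ e (primitive_onB (polar_theta pf)
    (primitive_on_cst a b al))) _ _ => // t _.
  by rewrite /cst subr0.
have cth := primitive_on_continuous abW pth.
have r0 := polar_gt0 pf.
have xab : x a = x b by rewrite /x cab.
have eomega t : (e * omega t) ^+ 2 / rho t + rho t = omega t ^+ 2 / rho t + rho t.
  by rewrite exprMn [e ^+ 2]expr2 e2 mul1r.
have iE : mu.-integrable `[a, b] (fun t => ((e * omega t) ^+ 2 / rho t + rho t)%:E).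
  by apply: eq_integrable_segment (polar_int pf) => t _; rewrite eomega.
have EE : \int[mu]_(t in `[a, b]) ((e * omega t) ^+ 2 / rho t + rho t) = E.
  by apply: eq_Rintegral => t _; rewrite eomega.
have ccos : {within `[a, b], continuous (fun t => rho t * cos (th t))}.
  by apply: withinM => //; apply: (within_comp cth) => z _; exact: continuous_cos.
(* Otherwise [x] is nondecreasing throughout and strictly increasing near a time where the centred
   angle is 0, so the curve could not close. *)
have beta2 : pi / 2 < beta.
  rewrite ltNge; apply/negP => b2.
  have tab : a <= ta <= b by rewrite ata (le_trans tatb).
  have b0 : 0 <= beta by have := thb _ tab; move=> /andP[]; lra.
  have mid : Num.min (th ta) (th tb) <= 0 <= Num.max (th ta) (th tb).
    by rewrite /th thta thtb ge_min le_max oppr_le0 b0 orbT.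
  have [q] := IVT tatb (withinW ata tbb cth) mid.
  rewrite in_itv/= => /andP[taq qtb] q0.
  have qab : a <= q <= b by rewrite (le_trans ata taq) (le_trans qtb).
  have ccos1 : {within `[a, b], continuous (fun t => cos (th t))}.
    by apply: (within_comp cth) => z _; exact: continuous_cos.
  have [d d0 dP] := (within_distP _ _ _).1 ccos1 q qab 1 ltr01.
  pose s := Num.max a (q - d / 2); pose t := Num.min b (q + d / 2).
  have /andP[aq qb] := qab.
  have as_ : a <= s by rewrite /s le_max lexx.
  have tb' : t <= b by rewrite /t ge_min lexx.
  have sq : q - d / 2 <= s by rewrite /s le_max lexx orbT.
  have tq : t <= q + d / 2 by rewrite /t ge_min lexx orbT.
  have st : s < t by rewrite /s /t lt_min !gt_max; apply/andP; split; apply/andP; split; lra.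
  have xlt : x s < x t.
    apply: (@der_gt0_lt _ s t x (fun t => rho t * cos (th t))) => //.
    - by apply: primitive_on_continuous (ltW st) (primitive_onW px as_ tb').
    - move=> z /andP[sz zt]; apply: primitive_on_derive px ccos _.
      by rewrite (le_lt_trans as_ sz) (lt_le_trans zt tb').
    - move=> z /andP[sz zt].
      have zab : a <= z <= b by rewrite (le_trans as_ (ltW sz)) (le_trans (ltW zt) tb').
      have zq : `|z - q| < d by rewrite ltr_norml; apply/andP; split; lra.
      have := dP z zab zq; rewrite q0 cos0 ltr_norml => /andP[h _].
      by apply: mulr_gt0; [exact: r0|lra].
  have xle u v : a <= u -> u <= v -> v <= b -> x u <= x v.
    apply: (primitive_on_le px) => z zab; apply: mulr_ge0; first exact/ltW/r0.
    by apply: cos_ge0_pihalf; have /andP[] := thb z zab; rewrite -/(th z) => ? ?; apply/andP; split; lra.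
  have h1 := xle _ _ (lexx a) as_ (le_trans (ltW st) tb').
  have h2 := xle _ _ (le_trans as_ (ltW st)) tb' (lexx b).
  by move: xab; lra.
have tatb' : ta < tb.
  rewrite lt_neqAle tatb andbT; apply/eqP => tE; move: thtb; rewrite -tE thta; lra.
have contp (nu : R) : continuous (fun z : R => Num.sqrt (1 + cos z / nu)).
  move=> z; apply: (@continuous_comp _ _ _ (fun z => 1 + cos z / nu) Num.sqrt).
    exact: der_continuous (derD (derC 1 z) (derM (der_cos (derI z)) (derC nu^-1 z))).
  exact: sqrt_continuous.
(* If [beta >= pi] the multiplier is 1 and the bound is [8 * Num.sqrt 2], which strict comparison at
   modulus 1 places above [drop_energy m]: such a drop is never minimal. *)
have [bpi|pib] := ltP beta pi; last first.
  have [P dP] := exists_antiderivative (contp 1).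
  have nub z : - beta <= z <= beta -> 0 <= 1 + cos z / 1 by move=> _; have := cos_geN1 z; lra.
  have := energy_ge_potential px r0 pth iE xab thb ata tatb' tbb thta thtb nub dP.
  rewrite EE => h.
  have h2 := potential_increment_ge_pi pib dP.
  have cs : {within `[- (pi / 2), pi / 2], continuous (@sin R)} by apply: withinT; exact: continuous_sin.
  have ds z : - (pi / 2) < z < pi / 2 -> is_derive z 1 (@sin R) (1 * cos z ^+ 2 / delta 1 z).
    move=> /cos_gt0_pihalf c0; apply: (der_eq (is_derive_sin z)).
    rewrite /delta mul1r mul1r -cos2sin2 sqrtr_sqr gtr0_norm// expr2 mulfK// gt_eqF//.
  have h12 : 1 / 2 < 1 :> R by lra.
  have ne : 1 != m by rewrite gt_eqF.
  have := drop_energy_lt m2 m1 h12 (lexx 1) root cs ds ne.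
  rewrite sinN sin_pihalf opprK => h3.
  have s2 : scale 1 = Num.sqrt 2 :> R by rewrite /scale; congr Num.sqrt; ring.
  have s20 : 0 < Num.sqrt (2 : R) by rewrite sqrtr_gt0.
  have h4 : 8 * (1 + 1) / scale 1 = 8 * Num.sqrt 2 :> R.
    rewrite s2 -[(1 + 1 : R)](@sqr_sqrtr _ 2)//; field; by rewrite gt_eqF.
  by split; lra.
pose nu := - cos beta.
have nu0 : 0 < nu.
  rewrite /nu oppr_gt0 -[beta](subrK (pi / 2)) cosDpihalf oppr_lt0.
  by apply: sin_gt0_pi; apply/andP; split; lra.
have b0 : 0 < beta by lra.
have nu1 : nu < 1.
  rewrite /nu ltrNl -cospi ltr_cos// in_itv/=; apply/andP; split; lra.
have nub z : - beta <= z <= beta -> 0 <= 1 + cos z / nu.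
  rewrite -ler_norml => zb; have : cos beta <= cos z.
    rewrite leNgt -[cos z]cos_norm ltr_cos ?in_itv/= -?leNgt//; apply/andP; split => //; lra.
  move=> h; have : -1 <= cos z / nu by rewrite ler_pdivlMr// mulN1r /nu opprK.
  lra.
(* The modulus whose wave has extreme angle [beta]. *)
pose n := (1 + nu) / 2.
have nE : 2 * n - 1 = nu by rewrite /n; field.
have n2 : 1 / 2 < n by rewrite /n; lra.
have n1 : n < 1 by rewrite /n; lra.
have cosb : cos beta = - (2 * n - 1) by rewrite nE /nu opprK.
have [P dP] := exists_antiderivative (contp nu).
have := energy_ge_potential px r0 pth iE xab thb ata tatb' tbb thta thtb nub dP.
rewrite EE => hE.
have PE : 2 * (P beta - P (- beta)) = drop_energy n.
  have dP' z : is_derive z 1 P (Num.sqrt (1 + cos z / (2 * n - 1))) by rewrite nE.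
  rewrite (potential_increment n2 n1 b0 bpi cosb dP').
  by rewrite /drop_energy; field; rewrite gt_eqF// scale_gt0.
(* A modulus other than [m] gives a strictly larger bound, so minimality determines [beta]. *)
have [nm|nm] := eqVneq n m; last first.
  have [bn0 dbn] := bendingP n1.
  have := drop_energy_lt m2 m1 n2 (ltW n1) root (der_within dbn) (fun z _ => dbn z) nm.
  rewrite bn0 subr0 -/(drop_energy n) => h.
  by split; lra.
rewrite nm in PE nE cosb.
split; first by rewrite -PE.
move=> min; have min' : \int[mu]_(t in `[a, b]) ((e * omega t) ^+ 2 / rho t + rho t) <=
  2 * (P beta - P (- beta)) by rewrite EE PE.
have out := minimal_cos_outside px crho r0 pth iE xab thb ata tatb' tbb thta thtb nu0 nub dP min'.
have ode := minimal_ode px crho r0 pth iE xab thb ata tatb' tbb thta thtb nub dP min'.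
rewrite -nE in out ode.
have [psi [psia psib tha thb' psiP]] := minimal_structure m2 m1 b0 bpi cosb root px py crho r0
  cth xab thb ata tatb' tbb thta thtb out ode.
exists e, al, beta, psi; split=> //.
- by rewrite b0.
- have h1 : theta a - al = e * - beta by rewrite -[LHS]ee -/(th a) tha.
  have h2 : theta b - al = e * beta by rewrite -[LHS]ee -/(th b) thb'.
  by split; lra.
- move=> t tab; have [pt lt xt yt] := psiP t tab; split=> //.
  have xc : cos al * x t - e * sin al * y t = (c t).1.
    have := cos2Dsin2 al; rewrite /x /y; set C := cos al; set S := sin al => CS.
    transitivity ((C ^+ 2 + (e * e) * S ^+ 2) * (c t).1 + (1 - e * e) * C * S * (c t).2).
      by ring.
    by rewrite e2 mul1r CS; ring.
  have yc : sin al * x t + e * cos al * y t = (c t).2.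
    have := cos2Dsin2 al; rewrite /x /y; set C := cos al; set S := sin al => CS.
    transitivity (((e * e) * C ^+ 2 + S ^+ 2) * (c t).2 + (1 - e * e) * C * S * (c t).1).
      by ring.
    by rewrite e2 mul1r CS; ring.
  have xa : cos al * x a - e * sin al * y a = (c a).1.
    have := cos2Dsin2 al; rewrite /x /y; set C := cos al; set S := sin al => CS.
    transitivity ((C ^+ 2 + (e * e) * S ^+ 2) * (c a).1 + (1 - e * e) * C * S * (c a).2).
      by ring.
    by rewrite e2 mul1r CS; ring.
  have ya : sin al * x a + e * cos al * y a = (c a).2.
    have := cos2Dsin2 al; rewrite /x /y; set C := cos al; set S := sin al => CS.
    transitivity (((e * e) * C ^+ 2 + S ^+ 2) * (c a).2 + (1 - e * e) * C * S * (c a).1).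
      by ring.
    by rewrite e2 mul1r CS; ring.
  rewrite [LHS]surjective_pairing /rigid /wave -xc -yc -xa -ya /=.
  by rewrite xt yt; congr pair; ring.
Qed.

Lemma drop_bound_and_structure :
  drop_energy m <= E /\ (E <= drop_energy m -> minimal_drop_structure).
Proof.
have [s /[!in_itv]/= /andP[as_ sb] sP] := EVT_min abW ctheta.
have [t /[!in_itv]/= /andP[at_ tb] tP] := EVT_max abW ctheta.
pose al := (theta s + theta t) / 2; pose beta := (theta t - theta s) / 2.
have bnd u : a <= u <= b -> theta s <= theta u <= theta t.
  by move=> uab; rewrite sP ?tP// in_itv.
have [st|ts] := leP s t.
  apply: (@oriented_drop 1 al beta s t) => //.
  - by left.
  - by move=> u /bnd/andP[? ?]; rewrite /al /beta; apply/andP; split; lra.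
  - by rewrite /al /beta; lra.
  - by rewrite /al /beta; lra.
apply: (@oriented_drop (-1) al beta t s) => //.
- by right.
- by move=> u /bnd/andP[? ?]; rewrite /al /beta; apply/andP; split; lra.
- exact: ltW.
- by rewrite /al /beta; lra.
- by rewrite /al /beta; lra.
Qed.

Lemma energy_drop : energy a b c = E%:E.
Proof. by rewrite (polar_energy pf). Qed.

End DropTheorem.

(** * Smooth curves and algebras of smooth functions *)

Section SmoothCurves.
Context {R : realType}.
Implicit Types (a b t w m : R) (f g F : R -> R) (c : R -> R * R).

Lemma smooth_der f : smooth f -> forall t, is_derive t 1 f (derive1 f t).
Proof. by move=> sf t; apply: derivable_der; exact: (sf 0). Qed.

Lemma smooth_derive1 f : smooth f -> smooth (derive1 f).
Proof. by move=> sf n t; have := sf n.+1 t; rewrite derive1Sn. Qed.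

Lemma smooth_continuous f : smooth f -> continuous f.
Proof. by move=> sf t; exact: der_continuous (smooth_der sf t). Qed.

Lemma C2_H2 a b f df ddf : (forall t, is_derive t 1 f (df t)) ->
  (forall t, is_derive t 1 df (ddf t)) -> continuous ddf -> H2_with_derivative a b f df.
Proof.
move=> d1 d2 c2.
have c1 : continuous df by move=> t; exact: der_continuous (d2 t).
split.
  by apply: (primitive_on_C1 (withinT c1) (der_within d1)) => x _; exact: d1.
exists ddf; split; last by apply: integrable_within; apply: withinX; exact: withinT.
by apply: (primitive_on_C1 (withinT c2) (der_within d2)) => x _; exact: d2.
Qed.

Lemma smooth_H2 a b f : smooth f -> H2_with_derivative a b f (derive1 f).
Proof.
move=> sf; have s1 := smooth_derive1 sf; have s2 := smooth_derive1 s1.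
exact: C2_H2 (smooth_der sf) (smooth_der s1) (smooth_continuous s2).
Qed.

Lemma smooth_closed_curve c : periodic1 c -> smooth (fst \o c) -> smooth (snd \o c) ->
  (forall t, velocity c t <> (0, 0)) -> closed_curve c.
Proof.
move=> pc s1 s2 v0; split=> // a b _; exists (velocity c); split=> //; exact: smooth_H2.
Qed.

Lemma energy_continuous c (h F : R -> R) a b : a < b -> continuous h ->
  (forall t, is_derive t 1 F (h t)) ->
  (forall t, a < t < b -> (curvature c t ^+ 2 + 1) * speed c t = h t) ->
  energy a b c = (F b - F a)%:E.
Proof.
move=> ab ch dF hE; rewrite /energy.
transitivity (\int[lebesgue_measure]_(t in `]a, b[) (h t)%:E)%E.
  by apply: eq_integral => t; rewrite inE/= in_itv/= => /hE ->.
rewrite -(@integral_itv_bndoo _ a b (EFin \o h) true false); last first.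
  apply/measurable_EFinP; apply: measurable_funTS; exact: continuous_measurable_fun.
have [_ Fa Fb] := (continuous_within_itvP _ ab).1 (der_within dF (a := a) (b := b)).
rewrite (@continuous_FTC2 _ h F a b)//.
- exact: withinT.
- by split=> // t _; have [] := dF t.
- by move=> t _; exact: der_derive1.
Qed.

Inductive generated (G : (R -> R) -> Prop) : (R -> R) -> Prop :=
| generated_cst r : generated G (fun=> r)
| generated_base f : G f -> generated G f
| generatedD f g : generated G f -> generated G g -> generated G (fun t => f t + g t)
| generatedM f g : generated G f -> generated G g -> generated G (fun t => f t * g t).

(** An algebra stable under differentiation consists of smooth functions, so only first derivatives
    of generators have to be computed. *)
Lemma generated_smooth (G : (R -> R) -> Prop) :
  (forall f, G f -> exists2 g, generated G g & forall t, is_derive t 1 f (g t)) ->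
  forall f, generated G f -> smooth f.
Proof.
move=> GD.
have GD' f : generated G f -> exists2 g, generated G g & forall t, is_derive t 1 f (g t).
  elim=> [r|f1 /GD//|f1 f2 _ [g1 e1 d1] _ [g2 e2 d2]|f1 f2 h1 [g1 e1 d1] h2 [g2 e2 d2]].
  - by exists (fun=> 0); [exact: generated_cst|move=> t; exact: derC].
  - by exists (fun t => g1 t + g2 t); [exact: generatedD|move=> t; exact: derD].
  - exists (fun t => g1 t * f2 t + f1 t * g2 t); last by move=> t; exact: derM.
    by apply: generatedD; exact: generatedM.
move=> f ef n; suff h : generated G (derive1n n f).
  by move=> t; have [g _ dg] := GD' _ h; have [] := dg t.
elim: n => [//|n ih]; have [g eg dg] := GD' _ ih.
rewrite (_ : derive1n n.+1 f = g)//; apply/funext => t.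
by rewrite derive1nS; exact: der_derive1.
Qed.

Lemma generated_of_smooth f : generated (@smooth R) f -> smooth f.
Proof.
apply: generated_smooth => g sg; exists (derive1 g); last exact: smooth_der.
by apply: generated_base; exact: smooth_derive1.
Qed.

(** [delta^-1] is among the generators because the derivative of [delta] involves it. *)
Inductive elliptic w m : (R -> R) -> Prop :=
| elliptic_sin : elliptic w m (fun t => sin (w * t))
| elliptic_cos : elliptic w m (fun t => cos (w * t))
| elliptic_delta : elliptic w m (fun t => delta m (w * t))
| elliptic_deltaV : elliptic w m (fun t => (delta m (w * t))^-1).

Lemma der_scale w t : is_derive t 1 (fun t => w * t) w.
Proof. by apply: (der_eq (derZ w (derI t))); rewrite mulr1. Qed.

Lemma der_delta_scale w t m : m < 1 -> is_derive t 1 (fun t => delta m (w * t))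
  (- (m * sin (w * t) * cos (w * t)) / delta m (w * t) * w).
Proof. by move=> m1; exact: der_comp (derive_delta _ m1) (der_scale w t). Qed.

Lemma elliptic_smooth w m f : m < 1 -> generated (elliptic w m) f -> smooth f.
Proof.
move=> m1; apply: generated_smooth => {}f [].
- exists (fun t => cos (w * t) * w); last by move=> t; exact: der_sin (der_scale w t).
  by apply: generatedM; do 2 constructor.
- exists (fun t => -1 * sin (w * t) * w).
    by apply: generatedM; [apply: generatedM|]; do 2? constructor.
  by move=> t; apply: (der_eq (der_cos (der_scale w t))); rewrite mulN1r.
- exists (fun t => - m * sin (w * t) * cos (w * t) * (delta m (w * t))^-1 * w).
    by do !apply: generatedM; do 2? constructor.
  by move=> t; apply: (der_eq (der_delta_scale w t m1)); rewrite !mulNr.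
- exists (fun t => m * sin (w * t) * cos (w * t) * (delta m (w * t))^-1 *
      (delta m (w * t))^-1 * (delta m (w * t))^-1 * w).
    by do !apply: generatedM; do 2? constructor.
  move=> t; have d0 := delta_neq0 (w * t) m1.
  by apply: (der_eq (derV (f := fun t => delta m (w * t)) d0 (der_delta_scale w t m1))); field.
Qed.

Lemma smooth_primitive F f : smooth f -> (forall t, is_derive t 1 F (f t)) -> smooth F.
Proof.
move=> sf dF [|n] t; first by have [] := dF t.
rewrite derive1Sn (_ : derive1 F = f); first exact: sf.
by apply/funext => z; exact: der_derive1.
Qed.

End SmoothCurves.

(** * One period of the closed wave is a figure eight *)

Section FigureEightExists.
Context {R : realType}.
Context (m : R) (m2 : 1 / 2 < m) (m1 : m < 1) (root : abscissa m (pi / 2) = 0).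

Let k := Num.sqrt m.
Let w : R := 2 * pi.
Let a := scale m.
Let k0 : 0 < k.
Proof. by move: m2; rewrite sqrtr_gt0; lra. Qed.
Let k2 : k ^+ 2 = m.
Proof. by rewrite sqr_sqrtr//; move: m2; lra. Qed.
Let w0 : 0 < w.
Proof. by rewrite /w mulr_gt0// pi_gt0. Qed.
Let a0 : 0 < a.
Proof. exact: scale_gt0. Qed.
Let a2 : a ^+ 2 = 4 * m - 2.
Proof. by rewrite /a scale_sqr//; ring. Qed.

(** At a zero of [abscissa], half a period causes no drift: the wave closes after a full period and
    its two halves are mirror images. *)
Lemma waveDpi x : wave m (x + pi) = ((wave m x).1, - (wave m x).2).
Proof.
by rewrite /wave/= abscissaDpi// root addr0 cosDpi mulrN.
Qed.

Lemma waveD2pi x : wave m (x + 2 * pi) = wave m x.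
Proof.
rewrite (_ : x + 2 * pi = x + pi + pi); last by ring.
by rewrite 2!waveDpi; case: (wave m x) => u v /=; rewrite opprK.
Qed.

Let eight t := wave m (w * t).
Let S t := sin (w * t).
Let C t := cos (w * t).
Let D t := delta m (w * t).
Let D0 (t : R) : D t != 0.
Proof. exact: delta_neq0. Qed.
Let DE (t : R) : D t ^+ 2 = 1 - m * S t ^+ 2.
Proof. by rewrite /D delta_sqr// ltW. Qed.

Let dx (t : R) : is_derive t 1 (fst \o eight) (a * w * ((1 - 2 * m * S t ^+ 2) / D t)).
Proof.
have [_ dA] := abscissaP m1.
by apply: (der_eq (derZ a (der_comp (dA (w * t)) (der_scale w t)))); rewrite /D /S; ring.
Qed.

Let dy (t : R) : is_derive t 1 (snd \o eight) (2 * a * w * k * S t).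
Proof.
apply: (der_eq (derN (derZ (2 * a * k) (der_cos (der_scale w t))))).
by rewrite /S; ring.
Qed.

Let dS (t : R) : is_derive t 1 S (C t * w).
Proof. exact: der_sin (der_scale w t). Qed.

Let dC (t : R) : is_derive t 1 C (- S t * w).
Proof. exact: der_cos (der_scale w t). Qed.

Let dD (t : R) : is_derive t 1 D (- (m * S t * C t) / D t * w).
Proof. exact: der_delta_scale. Qed.

Let velE (t : R) : velocity eight t = (a * w * ((1 - 2 * m * S t ^+ 2) / D t), 2 * a * w * k * S t).
Proof. by rewrite /velocity (der_derive1 (dx t)) (der_derive1 (dy t)). Qed.

Let speedE (t : R) : speed eight t = a * w / D t.
Proof.
rewrite /speed velE /enorm/=.
rewrite (_ : _ + _ = (a * w / D t) ^+ 2).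
  rewrite sqrtr_sqr ger0_norm//; exact: ltW (divr_gt0 (mulr_gt0 a0 w0) (delta_gt0 _ m1)).
have -> : 1 - 2 * m * S t ^+ 2 = 2 * D t ^+ 2 - 1 by rewrite DE; ring.
have -> : (2 * a * w * k * S t) ^+ 2 = 4 * a ^+ 2 * w ^+ 2 * (1 - D t ^+ 2).
  by rewrite DE -k2; ring.
by have Dn := D0 t; field.
Qed.

Let accE (t : R) : velocity (velocity eight) t =
  (- a * w ^+ 2 * m * S t * C t * (2 * D t ^+ 2 + 1) / D t ^+ 3, 2 * a * w ^+ 2 * k * C t).
Proof.
rewrite /velocity; congr pair; apply: der_derive1.
  have -> : fst \o velocity eight = fun t => a * w * ((1 - 2 * m * S t ^+ 2) / D t).
    by apply/funext => z; rewrite /comp velE.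
  apply: (der_eq (derZ (a * w) (der_div (D0 t)
    (derB (derC 1 t) (derZ (2 * m) (derX 2 (dS t)))) (dD t)))).
  have -> : 1 - 2 * m * S t ^+ 2 = 2 * D t ^+ 2 - 1 by rewrite DE; ring.
  by have Dn := D0 t; field.
have -> : snd \o velocity eight = fun t => 2 * a * w * k * S t.
  by apply/funext => z; rewrite /comp velE.
by apply: (der_eq (derZ (2 * a * w * k) (dS t))); ring.
Qed.

Let curvE (t : R) : curvature eight t = 2 * k * C t / a.
Proof.
rewrite /curvature accE speedE velE/=.
have -> : 1 - 2 * m * S t ^+ 2 = 2 * D t ^+ 2 - 1 by rewrite DE; ring.
have Dn := D0 t; have an : a != 0 by rewrite gt_eqF.
have wn : w != 0 by rewrite gt_eqF.
have -> : a * w * ((2 * D t ^+ 2 - 1) / D t) * (2 * a * w ^+ 2 * k * C t) -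
   2 * a * w * k * S t * (- a * w ^+ 2 * m * S t * C t * (2 * D t ^+ 2 + 1) / D t ^+ 3) =
   2 * a ^+ 2 * w ^+ 3 * k * C t * ((2 * D t ^+ 2 - 1) / D t +
      (m * S t ^+ 2) * (2 * D t ^+ 2 + 1) / D t ^+ 3) by field.
have -> : m * S t ^+ 2 = 1 - D t ^+ 2 by rewrite DE; ring.
by field; rewrite Dn an wn.
Qed.

Let odeE (t : R) : 2 * arclength_derivative eight (arclength_derivative eight (curvature eight)) t
  + curvature eight t ^+ 3 - curvature eight t = 0.
Proof.
have Dn := D0 t; have an : a != 0 by rewrite gt_eqF.
have wn : w != 0 by rewrite gt_eqF.
have -> : arclength_derivative eight (curvature eight) = fun t => - (2 * k / a ^+ 2) * (S t * D t).
  apply/funext => z; rewrite /arclength_derivative speedE.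
  have -> : curvature eight = fun t => (2 * k / a) * C t.
    by apply/funext => y; rewrite curvE; ring.
  rewrite (der_derive1 (derZ (2 * k / a) (dC z))); have Dz := D0 z.
  by field; rewrite Dz an wn.
rewrite /arclength_derivative speedE.
rewrite (der_derive1 (derZ (- (2 * k / a ^+ 2)) (derM (dS t) (dD t)))) curvE.
have -> : S t * (- (m * S t * C t) / D t * w) = - (m * S t ^+ 2) * C t * w / D t by ring.
have -> : m * S t ^+ 2 = 1 - D t ^+ 2 by rewrite DE; ring.
have -> : (2 * k * C t / a) ^+ 3 = 2 * k * C t / a ^+ 3 * (4 * k ^+ 2 * C t ^+ 2) by field; rewrite an.
have -> : 4 * k ^+ 2 * C t ^+ 2 = a ^+ 2 + 2 * (2 * D t ^+ 2 - 1).
  by rewrite k2 a2 DE /C cos2sin2 -/(S t); ring.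
by field; rewrite Dn an wn.
Qed.

Lemma eight_figure_eight : figure_eight eight.
Proof.
have m2' := m2; have pi0 := pi_gt0 R.
have per : periodic1 eight.
  by move=> t; rewrite /eight (_ : w * (t + 1) = w * t + 2 * pi) ?waveD2pi// /w; ring.
(* The amplitudes [pi / 2] and [3 pi / 2], where the wave crosses its axis, both at the origin by
   [root]. *)
have half : eight (1 / 4) = eight (3 / 4) /\ eight (1 / 4) = (0, 0).
  have e1 : eight (1 / 4) = (0, 0).
    rewrite /eight /wave (_ : w * (1 / 4) = pi / 2); last by rewrite /w; field.
    by rewrite root cos_pihalf !mulr0 oppr0.
  split=> //; rewrite e1 /eight (_ : w * (3 / 4) = pi / 2 + pi); last by rewrite /w; field.
  by rewrite waveDpi /wave/= root cos_pihalf !mulr0 !oppr0.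
split.
- split; [exact: per| | |exact: odeE].
  + split.
      apply: (smooth_primitive _ dx); apply: (@elliptic_smooth _ w m) => //.
      apply: generatedM; first by constructor.
      apply: generatedM; last by do 2 constructor.
      have -> : (fun t => 1 - 2 * m * S t ^+ 2) = (fun t => 1 + (- (2 * m)) * (S t * S t)).
        by apply/funext => z; ring.
      by apply: generatedD; [|apply: generatedM; [|apply: generatedM]]; do 2? constructor.
    apply: (smooth_primitive _ dy); apply: (@elliptic_smooth _ w m) => //.
    by apply: generatedM; do 2? constructor.
  + move=> t v0; have : 0 < speed eight t.
      by rewrite speedE divr_gt0 ?mulr_gt0// delta_gt0.
    by rewrite /speed v0 /enorm/= expr0n/= addr0 sqrtr0 ltxx.
- exists (1 / 4), (3 / 4); split; [lra|lra|by lra|by case: half].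
- move=> [p [r [r0 pr]]].
  have pr2 t : ((eight t).1 - p.1) ^+ 2 + ((eight t).2 - p.2) ^+ 2 = r ^+ 2.
    by rewrite -(pr t) sqr_sqrtr// addr_ge0// sqr_ge0.
  have orth t : ((eight t).1 - p.1) * (velocity eight t).1 +
      ((eight t).2 - p.2) * (velocity eight t).2 = 0.
    have d := derD (derX 2 (derB (dx t) (derC p.1 t))) (derX 2 (derB (dy t) (derC p.2 t))).
    have d0 : is_derive t 1 (fun t => ((fst \o eight) t - p.1) ^+ 2 + ((snd \o eight) t - p.2) ^+ 2) 0.
      have -> : (fun t => ((fst \o eight) t - p.1) ^+ 2 + ((snd \o eight) t - p.2) ^+ 2) =
        (fun=> r ^+ 2) by apply/funext => z; exact: pr2.
      exact: derC.
    by have := der_inj d d0; rewrite velE /= !expr1; lra.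
  (* The two branches cross the double point in different directions. The centre of a circle would
     lie on both normals, hence at the double point itself, and the radius would be 0. *)
  have o1 := orth (1 / 4); have o2 := orth (3 / 4).
  have [e12 e0] := half; move: o1 o2; rewrite -e12 e0 !velE /=.
  have s1 : S (1 / 4) = 1.
    by rewrite /S (_ : w * (1 / 4) = pi / 2) ?sin_pihalf// /w; field.
  have s3 : S (3 / 4) = -1.
    rewrite /S (_ : w * (3 / 4) = pi / 2 + pi); last by rewrite /w; field.
    by rewrite sinDpi sin_pihalf.
  have DD : D (3 / 4) = D (1 / 4).
    by apply/eqP; rewrite -(eqrXn2 (n := 2)) ?ltW ?delta_gt0// !DE s1 s3 sqrrN.
  rewrite s1 s3 DD sqrrN expr1n => o1 o2.
  have Dn := D0 (1 / 4).
  have q1 : p.1 * (a * w * ((1 - 2 * m * 1) / D (1 / 4))) = 0 by lra.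
  have q2 : p.2 * (2 * a * w * k) = 0 by lra.
  have aw : a * w != 0 by rewrite gt_eqF// mulr_gt0.
  have p1 : p.1 = 0.
    have n1 : 1 - 2 * m * 1 != 0 by rewrite lt_eqF//; lra.
    apply/eqP; move: q1 => /eqP; rewrite mulf_eq0 => /orP[//|].
    by rewrite (negbTE (mulf_neq0 aw (mulf_neq0 n1 (invr_neq0 Dn)))).
  have p2 : p.2 = 0.
    apply/eqP; move: q2 => /eqP; rewrite mulf_eq0 => /orP[//|].
    have -> : 2 * a * w * k = 2 * k * (a * w) by ring.
    by rewrite (negbTE (mulf_neq0 _ aw))// mulf_neq0// gt_eqF.
  have := pr2 (1 / 4); rewrite e0 p1 p2 /= !subrr expr0n/= addr0 => /esym/eqP.
  by rewrite sqrf_eq0 gt_eqF.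
- move=> [N [d [sigma [N1 [dper _] [sper sreg] cE]]]].
  have N0 : 0 < N%:R :> R by rewrite ltr0n (ltn_trans _ N1).
  have NV : 0 < (N%:R : R)^-1 < 1 by rewrite invr_gt0 N0 invf_lt1// ltr1n N1.
  have le13 : 1 / 2 <= 3 / 2 :> R by lra.
  have lt13 : 1 / 2 < 3 / 2 :> R by lra.
  have [ds [[psig _] _]] := sreg _ _ lt13.
  have csig := primitive_on_continuous le13 psig.
  have [e [he se]] : exists e : R, (e = 1 \/ e = -1) /\ sigma (3 / 2) = sigma (1 / 2) + e.
    have <- : 1 / 2 + 1 = 3 / 2 :> R by field.
    by case: sper => ->; [exists 1|exists (-1)]; split; auto.
  (* An [N]-fold cover repeats its value at [1 / 2] when [sigma] has moved by [1 / N]. But this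
     value is the highest point of the curve, attained only at [1 / 2] plus an integer. *)
  have mid : Num.min (sigma (1 / 2)) (sigma (3 / 2)) <= sigma (1 / 2) + e / N%:R
      <= Num.max (sigma (1 / 2)) (sigma (3 / 2)).
    rewrite se ge_min le_max; case/andP: NV => n1 n2.
    by case: he => ->; apply/andP; split; apply/orP; (left; lra) || (right; lra).
  have [t] := IVT le13 csig mid; rewrite in_itv/= => /andP[t1 t3] st.
  have same : eight t = eight (1 / 2).
    rewrite !cE st mulrDr mulrCA divff ?gt_eqF// mulr1.
    case: he => ->; first exact: dper.
    by rewrite -dper subrK.
  have C1 : cos (w * t) = cos pi.
    have := congr1 snd same; rewrite /eight /wave/= (_ : w * (1 / 2) = pi); last by rewrite /w; field.
    move=> /oppr_inj /mulfI; apply.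
    by rewrite !mulf_neq0// ?gt_eqF.
  have S1 : sin (w * t) = sin pi.
    rewrite sinpi; apply/eqP; rewrite -sqrf_eq0 sin2cos2 C1 cospi sqrrN expr1n subrr.
    exact: eqxx.
  have [n nE] := eq_angle C1 S1.
  have tE : t = 1 / 2 + n%:~R.
    apply: (mulfI (x := w)); first by rewrite gt_eqF.
    by rewrite nE /w; move: (n%:~R : R) => z; field.
  have [n0|n1] : n = 0 \/ n = 1.
    have : (0 : R) <= n%:~R by lra.
    have : n%:~R <= 1 :> R by lra.
    rewrite ler0z lerz1 => n1 n0.
    by case: n n0 n1 {nE tE} => [[|[|n]]|n] //; auto.
  + move: st; rewrite tE n0 addr0 => /eqP; rewrite -subr_eq0 opprD addrA subrr sub0r oppr_eq0.
    by case: he => ->; case/andP: NV => n1 n2 /eqP; lra.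
  + move: st; rewrite tE n1 (_ : 1 / 2 + 1%:~R = 3 / 2); last by field.
    rewrite se; case/andP: NV => n1' n2.
    by case: he => ->; lra.
Qed.

End FigureEightExists.

(** * First integrals of a closed elastica *)

Section ElasticaPhase.
Context {R : realType}.
Implicit Types (a b t w m : R) (f g F : R -> R) (c : R -> R * R).

(** [(u, v)] and [(cos F, sin F)] turn at the same rate, so their scalar and cross products are
    constant: they are the cosine and sine of the angle to be added to [F]. *)
Lemma exists_lift (g u v : R -> R) : continuous g ->
  (forall t, is_derive t 1 u (- (g t * v t))) ->
  (forall t, is_derive t 1 v (g t * u t)) ->
  (forall t, u t ^+ 2 + v t ^+ 2 = 1) ->
  exists2 phi : R -> R, forall t, is_derive t 1 phi (g t) &
    forall t, u t = cos (phi t) /\ v t = sin (phi t).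
Proof.
move=> cg du dv uv; have [F dF] := exists_antiderivative cg.
pose p t := u t * cos (F t) + v t * sin (F t).
pose q t := v t * cos (F t) - u t * sin (F t).
have pq t : p t ^+ 2 + q t ^+ 2 = 1.
  rewrite -(uv t) /p /q; have := cos2Dsin2 (F t); move: (cos (F t)) (sin (F t)) => C S e.
  transitivity ((u t ^+ 2 + v t ^+ 2) * (C ^+ 2 + S ^+ 2)); first by ring.
  by rewrite e mulr1.
have p0 t : p t = p 0.
  apply: is_derive_0_is_cst => s.
  apply: (der_eq (derD (derM (du s) (der_cos (dF s))) (derM (dv s) (der_sin (dF s))))).
  by ring.
have q0 t : q t = q 0.
  apply: is_derive_0_is_cst => s.
  apply: (der_eq (derB (derM (dv s) (der_cos (dF s))) (derM (du s) (der_sin (dF s))))).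
  by ring.
have [s [cs ss]] := exists_angle (pq 0).
exists (fun t => F t + s) => t.
  by apply: (der_eq (derD (dF t) (derC s t))); rewrite addr0.
rewrite cosD sinD cs ss -(p0 t) -(q0 t) /p /q.
have := cos2Dsin2 (F t); move: (cos (F t)) (sin (F t)) => C S e; split.
  transitivity (u t * (C ^+ 2 + S ^+ 2)); first by rewrite e mulr1.
  by ring.
transitivity (v t * (C ^+ 2 + S ^+ 2)); first by rewrite e mulr1.
by ring.
Qed.

(** A periodic monotone function is constant. Closedness of the curve enters the classification
    through this fact, applied to quantities that drift in one direction. *)
Lemma periodic_monotone f g : (forall t, f (t + 1) = f t) ->
  (forall t, is_derive t 1 f (g t)) -> (forall t, 0 <= g t) -> forall t, g t = 0.
Proof.
move=> pf df g0 t.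
have mono s u : s <= u -> f s <= f u.
  by move=> su; apply: (der_ge0_le (der_within df)) su => // x _; exact: df.
have cst s : t - 1 / 2 < s < t + 1 / 2 -> f s = f (t - 1 / 2).
  move=> /andP[ts st]; apply/eqP; rewrite eq_le; apply/andP; split; last by apply: mono; lra.
  by rewrite -(pf (t - 1 / 2)) mono//; lra.
have d0 : is_derive t 1 f 0.
  apply: near_eq_is_derive (derC (f (t - 1 / 2)) t).
  have : t \in `]t - 1 / 2, t + 1 / 2[ by rewrite in_itv/=; apply/andP; split; lra.
  by move=> /near_in_itvoo; apply: filterS => s; rewrite in_itv/= => /cst ->.
exact: der_inj (df t) d0.
Qed.

(** [lam] and [al] are the length and direction of the conserved vector, and [theta] is the tangent
    angle measured from it; [phase_sqr] and [phase_curvature] are its components along the tangent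
    and the normal. Only [cos theta] and [sin theta] are periodic, since [theta] may gain a multiple
    of [2 pi]. *)
Record elastica_phase c (al lam : R) (theta : R -> R) : Prop := {
  phase_lam : 0 <= lam;
  phase_x : forall t, is_derive t 1 (fun t => cos al * (c t).1 + sin al * (c t).2)
    (speed c t * cos (theta t));
  phase_y : forall t, is_derive t 1 (fun t => cos al * (c t).2 - sin al * (c t).1)
    (speed c t * sin (theta t));
  phase_theta : forall t, is_derive t 1 theta (speed c t * curvature c t);
  phase_curvature : forall t,
    is_derive t 1 (curvature c) (- (speed c t * lam * sin (theta t) / 2));
  phase_sqr : forall t, curvature c t ^+ 2 = 1 + lam * cos (theta t);
  phase_cos : forall t, cos (theta (t + 1)) = cos (theta t);
  phase_sin : forall t, sin (theta (t + 1)) = sin (theta t)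
}.

Lemma derive1_periodic f : (forall t, f (t + 1) = f t) -> forall t, derive1 f (t + 1) = derive1 f t.
Proof.
move=> pf t; rewrite /derive1 (_ : (fun h : R => _) = fun h : R => h^-1 *: (f (h + t) - f t))//.
by apply/funext => h; rewrite addrA !pf.
Qed.

Lemma velocity_periodic c : periodic1 c -> periodic1 (velocity c).
Proof.
by move=> pc t; rewrite /velocity !derive1_periodic// => s; rewrite /= pc.
Qed.

Lemma speed_periodic c : periodic1 c -> forall t, speed c (t + 1) = speed c t.
Proof. by move=> pc t; rewrite /speed velocity_periodic. Qed.

Lemma curvature_periodic c : periodic1 c -> forall t, curvature c (t + 1) = curvature c t.
Proof.
move=> pc t; have e1 := velocity_periodic pc t.
have e2 := velocity_periodic (velocity_periodic pc) t.
by rewrite /curvature (speed_periodic pc) e1 e2.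
Qed.

Section SmoothImmersion.
Context c (sx : smooth (fst \o c)) (sy : smooth (snd \o c)).
Context (v0 : forall t, velocity c t <> (0, 0)).
Let vx := derive1 (fst \o c).
Let vy := derive1 (snd \o c).
Let wx := derive1 vx.
Let wy := derive1 vy.
Let dvx t : is_derive t 1 vx (wx t).
Proof. by apply: smooth_der; exact: smooth_derive1. Qed.
Let dvy t : is_derive t 1 vy (wy t).
Proof. by apply: smooth_der; exact: smooth_derive1. Qed.

Lemma speed_gt0 t : 0 < speed c t.
Proof.
rewrite sqrtr_gt0 lt0r addr_ge0 ?sqr_ge0// andbT paddr_eq0 ?sqr_ge0// !sqrf_eq0.
apply/negP => /andP[/eqP v1 /eqP v2]; apply: (@v0 t).
by rewrite [LHS]surjective_pairing v1 v2.
Qed.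

Lemma speed_sqr t : speed c t ^+ 2 = vx t ^+ 2 + vy t ^+ 2.
Proof. by rewrite sqr_sqrtr// addr_ge0// sqr_ge0. Qed.

Lemma derive_speed t : is_derive t 1 (speed c) ((vx t * wx t + vy t * wy t) / speed c t).
Proof.
have s0 := speed_gt0 t.
apply: (der_eq (der_sqrt (f := fun t => vx t ^+ 2 + vy t ^+ 2) _
  (derD (derX 2 (dvx t)) (derX 2 (dvy t))))).
  by rewrite -speed_sqr exprn_gt0.
rewrite -[Num.sqrt _]/(speed c t) /= !expr1.
by have sn : speed c t != 0 by [rewrite gt_eqF|]; field.
Qed.

(** The derivative of [speed^-1] is a polynomial in smooth functions and [speed^-1] itself; [speed]
    is recovered as its square times [speed^-1]. *)
Let G f := smooth f \/ f = (fun t => (speed c t)^-1).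
Let Gs f : smooth f -> generated G f.
Proof. by move=> sf; apply: generated_base; left. Qed.
Let Gi : generated G (fun t => (speed c t)^-1).
Proof. by apply: generated_base; right. Qed.
Let sm : [/\ smooth vx, smooth vy, smooth wx & smooth wy].
Proof. 
by split; [exact: smooth_derive1 sx|exact: smooth_derive1 sy|
  exact: smooth_derive1 (smooth_derive1 sx)|exact: smooth_derive1 (smooth_derive1 sy)].
 Qed.

Let G_smooth f : generated G f -> smooth f.
Proof.
apply: generated_smooth => {}f [sf|->].
  exists (derive1 f); last exact: smooth_der.
  by apply: Gs; exact: smooth_derive1.
have [s1 s2 s3 s4] := sm.
exists (fun t => -1 * (vx t * wx t + vy t * wy t) * (speed c t)^-1 * (speed c t)^-1 * (speed c t)^-1).
  by do !(apply: generatedM => //); [constructor|apply: generatedD; apply: generatedM; exact: Gs].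
move=> t; have sn : speed c t != 0 by rewrite gt_eqF// speed_gt0.
by apply: (der_eq (derV (f := speed c) sn (derive_speed t))); field.
Qed.

Lemma smooth_speed : smooth (speed c).
Proof.
have [s1 s2 s3 s4] := sm.
rewrite (_ : speed c = fun t => (vx t * vx t + vy t * vy t) * (speed c t)^-1).
  by apply: G_smooth; apply: generatedM => //; apply: generatedD; apply: generatedM; exact: Gs.
apply/funext => t; have sn : speed c t != 0 by rewrite gt_eqF// speed_gt0.
by rewrite -!expr2 -speed_sqr; field.
Qed.

Lemma smooth_curvature : smooth (curvature c).
Proof.
have [s1 s2 s3 s4] := sm.
rewrite (_ : curvature c = fun t => (vx t * wy t + -1 * (vy t * wx t)) *
    (speed c t)^-1 * (speed c t)^-1 * (speed c t)^-1).
  apply: G_smooth; do !(apply: generatedM => //); apply: generatedD.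
    by apply: generatedM; exact: Gs.
  by apply: generatedM; [constructor|apply: generatedM; exact: Gs].
apply/funext => t; have sn : speed c t != 0 by rewrite gt_eqF// speed_gt0.
have -> : curvature c t = (vx t * wy t - vy t * wx t) / speed c t ^+ 3 by [].
by field.
Qed.

Lemma smooth_arclength_derivative f : smooth f -> smooth (arclength_derivative c f).
Proof.
move=> sf; apply: G_smooth; apply: generatedM => //; apply: Gs.
exact: smooth_derive1.
Qed.

Lemma exists_tangent_angle : exists theta : R -> R, forall t,
  [/\ is_derive t 1 theta (speed c t * curvature c t), vx t = speed c t * cos (theta t) &
      vy t = speed c t * sin (theta t)].
Proof.
have cg : continuous (fun t => speed c t * curvature c t).
  move=> t; apply: cvgM.
    exact: (smooth_continuous smooth_speed).
  exact: (smooth_continuous smooth_curvature).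
have sn t : speed c t != 0 by rewrite gt_eqF// speed_gt0.
have kE t : curvature c t * speed c t ^+ 3 = vx t * wy t - vy t * wx t.
  rewrite /curvature mulfVK// expf_neq0//.
have [|||phi dphi phiP] := @exists_lift _ (fun t => vx t / speed c t) (fun t => vy t / speed c t) cg.
- move=> t; apply: (der_eq (der_div (sn t) (dvx t) (derive_speed t))).
  transitivity ((wx t * speed c t ^+ 2 - vx t * (vx t * wx t + vy t * wy t)) / speed c t ^+ 3).
    by have ? := sn t; field.
  transitivity (- ((curvature c t * speed c t ^+ 3) * vy t) / speed c t ^+ 3); last first.
    by have ? := sn t; field.
  by congr (_ / _); rewrite kE speed_sqr; ring.
- move=> t; apply: (der_eq (der_div (sn t) (dvy t) (derive_speed t))).
  transitivity ((wy t * speed c t ^+ 2 - vy t * (vx t * wx t + vy t * wy t)) / speed c t ^+ 3).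
    by have ? := sn t; field.
  transitivity (((curvature c t * speed c t ^+ 3) * vx t) / speed c t ^+ 3); last first.
    by have ? := sn t; field.
  by congr (_ / _); rewrite kE speed_sqr; ring.
- move=> t; rewrite !expr_div_n -mulrDl -speed_sqr divff//.
  by rewrite expf_neq0.
exists phi => t; have [e1 e2] := phiP t; split=> //.
  by rewrite -e1 mulrC divfK.
by rewrite -e2 mulrC divfK.
Qed.

End SmoothImmersion.

Lemma exists_elastica_phase c : closed_elastica c ->
  exists al lam theta, elastica_phase c al lam theta.
Proof.
move=> [pc [sx sy] v0 ode].
have [th thP] := exists_tangent_angle sx sy v0.
have s0 := speed_gt0 v0.
have sn t : speed c t != 0 by rewrite gt_eqF.
have ss := smooth_speed sx sy v0; have sk := smooth_curvature sx sy v0.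
pose k := curvature c; pose ks := arclength_derivative c k.
have sks : smooth ks by exact: smooth_arclength_derivative.
have dk t : is_derive t 1 k (speed c t * ks t).
  by apply: (der_eq (smooth_der sk t)); rewrite /ks /arclength_derivative mulrC divfK.
have dks t : is_derive t 1 ks (speed c t * (k t - k t ^+ 3) / 2).
  apply: (der_eq (smooth_der sks t)).
  have -> : k t - k t ^+ 3 = 2 * arclength_derivative c ks t.
    have odet : 2 * arclength_derivative c ks t + k t ^+ 3 - k t = 0 := ode t.
    by lra.
  by rewrite /arclength_derivative; have ? := sn t; field.
have dth t : is_derive t 1 th (speed c t * k t) by have [] := thP t.
have dC t := der_cos (dth t); have dS t := der_sin (dth t).
have dk2 t := derB (derX 2 (dk t)) (derC 1 t).
(* Cartesian coordinates of the conserved vector. *)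
pose p t := (k t ^+ 2 - 1) * cos (th t) - 2 * ks t * sin (th t).
pose q t := (k t ^+ 2 - 1) * sin (th t) + 2 * ks t * cos (th t).
have p0 t : p t = p 0.
  apply: is_derive_0_is_cst => s.
  apply: (der_eq (derB (derM (dk2 s) (dC s)) (derM (derZ 2 (dks s)) (dS s)))).
  by rewrite /= expr1; field.
have q0 t : q t = q 0.
  apply: is_derive_0_is_cst => s.
  apply: (der_eq (derD (derM (dk2 s) (dS s)) (derM (derZ 2 (dks s)) (dC s)))).
  by rewrite /= expr1; field.
pose lam := Num.sqrt (p 0 ^+ 2 + q 0 ^+ 2).
have lam0 : 0 <= lam by exact: sqrtr_ge0.
have lam2 : lam ^+ 2 = p 0 ^+ 2 + q 0 ^+ 2 by rewrite sqr_sqrtr// addr_ge0// sqr_ge0.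
have [al [alc als]] : exists al, lam * cos al = p 0 /\ lam * sin al = q 0.
  have [l0|ln] := eqVneq lam 0.
    exists 0; rewrite l0 !mul0r; move: lam2; rewrite l0 expr0n/= => /esym/eqP.
    by rewrite paddr_eq0 ?sqr_ge0// !sqrf_eq0 => /andP[/eqP -> /eqP ->].
  have [|al [e1 e2]] := @exists_angle R (p 0 / lam) (q 0 / lam).
    by rewrite !expr_div_n -mulrDl -lam2 divff// expf_neq0.
  by exists al; rewrite e1 e2 mulrC divfK// mulrC divfK.
exists al, lam, (fun t => th t - al).
have dx t := smooth_der sx t; have dy t := smooth_der sy t.
have cpt t : cos (th (t + 1)) = cos (th t) /\ sin (th (t + 1)) = sin (th t).
  have [_ a1 a2] := thP t; have [_ b1 b2] := thP (t + 1).
  have pv := velocity_periodic pc t.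
  move: (congr1 fst pv) (congr1 snd pv); rewrite /= a1 a2 b1 b2 speed_periodic//.
  by move=> /(mulfI (sn t)) -> /(mulfI (sn t)) ->.
split => //.
- move=> t; apply: (der_eq (derD (derZ (cos al) (dx t)) (derZ (sin al) (dy t)))).
  by have [_ -> ->] := thP t; rewrite cosB; ring.
- move=> t; apply: (der_eq (derB (derZ (cos al) (dy t)) (derZ (sin al) (dx t)))).
  by have [_ -> ->] := thP t; rewrite sinB; ring.
- by move=> t; apply: (der_eq (derB (dth t) (derC al t))); rewrite subr0.
- move=> t; apply: (der_eq (dk t)); rewrite sinB.
  have -> : speed c t * lam * (sin (th t) * cos al - cos (th t) * sin al) =
     speed c t * (sin (th t) * (lam * cos al) - cos (th t) * (lam * sin al)) by ring.
  rewrite alc als -(p0 t) -(q0 t) /p /q.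
  have -> : sin (th t) * ((k t ^+ 2 - 1) * cos (th t) - 2 * ks t * sin (th t)) -
     cos (th t) * ((k t ^+ 2 - 1) * sin (th t) + 2 * ks t * cos (th t)) =
     - 2 * ks t * (cos (th t) ^+ 2 + sin (th t) ^+ 2) by ring.
  by rewrite cos2Dsin2; field.
- move=> t; rewrite cosB.
  have -> : lam * (cos (th t) * cos al + sin (th t) * sin al) =
     cos (th t) * (lam * cos al) + sin (th t) * (lam * sin al) by ring.
  rewrite alc als -(p0 t) -(q0 t) /p /q -/k.
  have -> : cos (th t) * ((k t ^+ 2 - 1) * cos (th t) - 2 * ks t * sin (th t)) +
     sin (th t) * ((k t ^+ 2 - 1) * sin (th t) + 2 * ks t * cos (th t)) =
     (k t ^+ 2 - 1) * (cos (th t) ^+ 2 + sin (th t) ^+ 2) by ring.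
  by rewrite cos2Dsin2; ring.
- by move=> t; rewrite !cosB; have [-> ->] := cpt t.
- by move=> t; rewrite !sinB; have [-> ->] := cpt t.
Qed.

End ElasticaPhase.

(** * Closed elasticae other than circles are wavelike *)

Section Classification.
Context {R : realType}.
Implicit Types (a b t w m : R) (f g F : R -> R) (c : R -> R * R).

Lemma nonvanishing_gt0 f : continuous f -> (forall t, f t != 0) -> 0 < f 0 ->
  forall t, 0 < f t.
Proof.
move=> cf f0 fp t; rewrite ltNge; apply/negP => ft.
have [t0|t0] := leP 0 t.
  have [|s _ fs] := @IVT _ f 0 t 0 t0 (withinT cf).
    by rewrite ge_min le_max ft (ltW fp) orbT.
  by have := f0 s; rewrite fs eqxx.
have [|s _ fs] := @IVT _ f t 0 0 (ltW t0) (withinT cf).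
  by rewrite ge_min le_max ft (ltW fp) orbT.
by have := f0 s; rewrite fs eqxx.
Qed.

Lemma abscissa_periods m x (n : nat) : m < 1 ->
  abscissa m (x + n%:R * (2 * pi)) = abscissa m x + n%:R * (2 * abscissa m (pi / 2)).
Proof.
move=> m1; elim: n => [|n ih]; first by rewrite !mul0r !addr0.
have -> : x + n.+1%:R * (2 * pi) = x + n%:R * (2 * pi) + pi + pi by rewrite -natr1; ring.
by rewrite abscissaDpi// abscissaDpi// ih -natr1; ring.
Qed.

Lemma rigid_closed_curve al p c : periodic1 c -> smooth (fst \o c) -> smooth (snd \o c) ->
  (forall t, velocity c t <> (0, 0)) -> closed_curve (fun t => rigid 1 al p (c t)).
Proof.
move=> pc sx sy v0.
have dx t := derD (derC p.1 t)
  (derB (derZ (cos al) (smooth_der sx t)) (derZ (1 * sin al) (smooth_der sy t))).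
have dy t := derD (derC p.2 t)
  (derD (derZ (sin al) (smooth_der sx t)) (derZ (1 * cos al) (smooth_der sy t))).
apply: smooth_closed_curve.
- by move=> t; rewrite pc.
- apply: (smooth_primitive _ dx); apply: generated_of_smooth.
  rewrite (_ : (fun t => _) = fun t => cos al * derive1 (fst \o c) t +
    (- sin al) * derive1 (snd \o c) t); last by apply/funext => t; ring.
  by apply: generatedD; apply: generatedM; constructor; exact: smooth_derive1.
- apply: (smooth_primitive _ dy); apply: generated_of_smooth.
  rewrite (_ : (fun t => _) = fun t => sin al * derive1 (fst \o c) t +
    cos al * derive1 (snd \o c) t); last by apply/funext => t; ring.
  by apply: generatedD; apply: generatedM; constructor; exact: smooth_derive1.
- move=> t; rewrite /velocity (der_derive1 (dx t)) (der_derive1 (dy t)) => -[e1 e2].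
  apply: (v0 t); rewrite /velocity; move: e1 e2.
  set u := derive1 _ t; set v := derive1 _ t => e1 e2.
  have CS := cos2Dsin2 al.
  have -> : u = (cos al ^+ 2 + sin al ^+ 2) * u by rewrite CS mul1r.
  have -> : v = (cos al ^+ 2 + sin al ^+ 2) * v by rewrite CS mul1r.
  congr pair.
    transitivity (cos al * (0 + (cos al * u - 1 * sin al * v)) +
      sin al * (0 + (sin al * u + 1 * cos al * v))); first by ring.
    by rewrite e1 e2; ring.
  transitivity (cos al * (0 + (sin al * u + 1 * cos al * v)) -
    sin al * (0 + (cos al * u - 1 * sin al * v))); first by ring.
  by rewrite e1 e2; ring.
Qed.

Section Phase.
Context c (ec : closed_elastica c) (al lam : R) (theta : R -> R)
  (ph : elastica_phase c al lam theta).

Let pc : periodic1 c.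
Proof. by have [] := ec. Qed.
Let s0 (t : R) : 0 < speed c t.
Proof. by have [_ _ v0 _] := ec; exact: speed_gt0. Qed.
Let sn (t : R) : speed c t != 0.
Proof. by rewrite gt_eqF. Qed.
Let dC (t : R) := der_cos (phase_theta ph t).
Let dS (t : R) := der_sin (phase_theta ph t).
Let X t := cos al * (c t).1 + sin al * (c t).2.
Let Y t := cos al * (c t).2 - sin al * (c t).1.
Let Xper t : X (t + 1) = X t.
Proof. by rewrite /X pc. Qed.
Let coord1 t : (c t).1 = cos al * X t - sin al * Y t.
Proof.
rewrite /X /Y; transitivity ((cos al ^+ 2 + sin al ^+ 2) * (c t).1); last by ring.
by rewrite cos2Dsin2 mul1r.
Qed.
Let coord2 t : (c t).2 = sin al * X t + cos al * Y t.
Proof.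
rewrite /X /Y; transitivity ((cos al ^+ 2 + sin al ^+ 2) * (c t).2); last by ring.
by rewrite cos2Dsin2 mul1r.
Qed.

(** If the conserved vector is 0, the curvature is constantly 1 or -1, and the centre of curvature
    [(x, y)] does not move. *)
Lemma phase_lam_gt0 : ~ covers_circle c -> 0 < lam.
Proof.
move=> nc; rewrite lt0r (phase_lam ph) andbT; apply/eqP => l0; apply: nc.
have kE (t : R) : curvature c t = curvature c 0.
  apply: is_derive_0_is_cst => s; apply: (der_eq (phase_curvature ph s)).
  by rewrite l0 mulr0 !mul0r oppr0.
set k := curvature c 0 in kE.
have k2 : k ^+ 2 = 1 by rewrite -(kE 0) (phase_sqr ph) l0 mul0r addr0.
pose x t := X t - k * sin (theta t); pose y t := Y t + k * cos (theta t).
have x0 (t : R) : x t = x 0.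
  apply: is_derive_0_is_cst => s; apply: (der_eq (derB (phase_x ph s) (derZ k (dS s)))).
  rewrite kE; transitivity (speed c s * cos (theta s) * (1 - k ^+ 2)); first by ring.
  by rewrite k2 subrr mulr0.
have y0 (t : R) : y t = y 0.
  apply: is_derive_0_is_cst => s; apply: (der_eq (derD (phase_y ph s) (derZ k (dC s)))).
  rewrite kE; transitivity (speed c s * sin (theta s) * (1 - k ^+ 2)); first by ring.
  by rewrite k2 subrr mulr0.
exists (cos al * x 0 - sin al * y 0, sin al * x 0 + cos al * y 0), 1; split=> // t.
rewrite /enorm /= coord1 coord2 -(x0 t) -(y0 t) /x /y.
rewrite (_ : _ + _ = k ^+ 2 * (cos al ^+ 2 + sin al ^+ 2) *
  (cos (theta t) ^+ 2 + sin (theta t) ^+ 2)); last by ring.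
by rewrite !cos2Dsin2 k2 !mulr1 sqrtr1.
Qed.

(** An elastica without inflection drifts along the conserved direction: [sin theta / k - X] would
    be periodic and nondecreasing, which forces [sin theta] to vanish identically and the tangent
    not to turn, whereas the curvature is nonzero. *)
Lemma phase_inflection : 0 < lam -> exists t : R, curvature c t = 0.
Proof.
move=> l0; apply: contrapT => nz.
have k0 (t : R) : curvature c t != 0 by apply/eqP => kt; apply: nz; exists t.
pose f t := sin (theta t) / curvature c t - X t.
have df (t : R) : is_derive t 1 f
    (speed c t * lam * sin (theta t) ^+ 2 / (2 * curvature c t ^+ 2)).
  apply: (der_eq (derB (der_div (k0 t) (dS t) (phase_curvature ph t)) (phase_x ph t))).
  by have ? := k0 t; field.
have z : forall t, speed c t * lam * sin (theta t) ^+ 2 / (2 * curvature c t ^+ 2) = 0.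
  apply: (periodic_monotone _ df).
    by move=> t; rewrite /f (phase_sin ph) curvature_periodic// Xper.
  move=> t; apply: divr_ge0; last by rewrite mulr_ge0// sqr_ge0.
  by rewrite mulr_ge0 ?sqr_ge0// mulr_ge0// ltW.
have S0 (t : R) : sin (theta t) = 0.
  apply/eqP; rewrite -sqrf_eq0; move: (z t) => /eqP.
  rewrite mulf_eq0 mulf_eq0 mulf_eq0 (negbTE (sn t)) (gt_eqF l0) /= => /orP[//|].
  by rewrite invr_eq0 (negbTE (mulf_neq0 _ (expf_neq0 2 (k0 t)))).
have d0 : is_derive (0 : R) 1 (fun t => sin (theta t)) 0.
  by rewrite (_ : (fun t => sin (theta t)) = (fun=> 0)); [exact: derC|exact/funext].
have /eqP := der_inj (dS 0) d0.
rewrite mulf_eq0 (negbTE (mulf_neq0 (sn 0) (k0 0))) orbF -sqrf_eq0 cos2sin2 S0.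
by rewrite expr0n/= subr0 oner_eq0.
Qed.

(** At an inflection [1 + lam * cos theta = 0], so [lam >= 1]. In the borderline case [lam = 1] the
    squared curvature satisfies [q' <= 2 speed q]; once zero it remains zero, and the curve would be
    a straight line. *)
Lemma phase_lam_gt1 : 0 < lam -> 1 < lam.
Proof.
move=> l0; have [t0 kt0] := phase_inflection l0.
rewrite lt_neqAle; apply/andP; split; last first.
  have := phase_sqr ph t0; rewrite kt0 expr0n/=.
  have : -1 <= cos (theta t0) by exact: cos_geN1.
  by have l0' := l0; nra.
apply/eqP => l1.
have [v0 sx sy] : [/\ forall t, velocity c t <> (0, 0), smooth (fst \o c) & smooth (snd \o c)].
  by have [_ [? ?] ? _] := ec.
have [S dS'] := exists_antiderivative (smooth_continuous (smooth_speed sx sy v0)).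
pose q t := curvature c t ^+ 2.
have q0 t : 0 <= q t by exact: sqr_ge0.
have dq (t : R) : is_derive t 1 q (- (speed c t * sin (theta t) * curvature c t)).
  by apply: (der_eq (derX 2 (phase_curvature ph t))); rewrite -l1 /= expr1; field.
(* Gronwall's argument with the factor [expR (- (2 * S))], forward in time only; periodicity covers
   the past. *)
have qz (t : R) : t0 <= t -> q t = 0.
  move=> tt.
  have dE (s : R) := @der_comp _ expR (fun s => - (2 * S s)) s _ _
    (is_derive_expR _) (derN (derZ 2 (dS' s))).
  have dF s := derN (derM (dq s) (dE s)).
  have : - (q t0 * expR (- (2 * S t0))) <= - (q t * expR (- (2 * S t))).
    apply: (der_ge0_le (der_within dF) (fun x _ => dF x)) tt => s _.
    have E0 : 0 < expR (- (2 * S s)) by exact: expR_gt0.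
    have kb : - (2 * q s) <= sin (theta s) * curvature c s.
      have qE : q s = 1 + cos (theta s) by rewrite /q (phase_sqr ph) -l1 mul1r.
      have sq : (sin (theta s) * curvature c s) ^+ 2 <= (2 * q s) ^+ 2.
        have h1 : cos (theta s) <= 1 by exact: cos_le1.
        have h2 : -1 <= cos (theta s) by exact: cos_geN1.
        rewrite exprMn -/(q s) sin2cos2 qE; move: (cos _) h1 h2 => C h1 h2.
        rewrite -subr_ge0 (_ : _ - _ = (1 + C) ^+ 2 * (3 + C)); last by ring.
        by rewrite mulr_ge0 ?sqr_ge0//; lra.
      rewrite leNgt; apply/negP => lt; have qs := q0 s.
      by move: lt sq; move: (sin _ * _) => z lt sq; nra.
    have sp := s0 s.
    have : 0 <= expR (- (2 * S s)) * speed c s * (2 * q s + sin (theta s) * curvature c s).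
      by rewrite mulr_ge0 ?mulr_ge0 ?(ltW E0) ?(ltW sp)//; lra.
    by lra.
  rewrite /q kt0 expr0n/= mul0r oppr0 oppr_ge0 pmulr_lle0 ?expR_gt0// => qt.
  by apply/eqP; rewrite eq_le qt q0.
have qz' : forall t, q t = 0.
  apply: (@periodic_ind R (fun t => q t = 0) t0) => t.
    by rewrite /q curvature_periodic.
  by move=> /andP[/qz].
have cN1 (t : R) : cos (theta t) = -1.
  by have := phase_sqr ph t; rewrite -/(q t) qz' -l1; lra.
have dX (t : R) := derN (phase_x ph t).
have z : forall t, - (speed c t * cos (theta t)) = 0.
  apply: (periodic_monotone _ dX); first by move=> t; congr (- _); exact: Xper.
  by move=> t; rewrite cN1 mulrN1 opprK ltW.
by have /eqP := z 0; rewrite cN1 mulrN1 opprK (negbTE (sn 0)).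
Qed.

End Phase.

End Classification.

(** * Every figure eight is one period of a closed wave *)

Section FigureEightAmplitude.
Context {R : realType}.
Implicit Types (a b t w m : R) (f g F : R -> R) (c : R -> R * R).

(** [rigid 1] suffices: a reflected wave is the wave shifted by half a period. *)
Record amplitude c m al p (phi : R -> R) : Prop := {
  amplitude_half : 1 / 2 < m;
  amplitude_lt1 : m < 1;
  amplitude_root : abscissa m (pi / 2) = 0;
  amplitude_derive : forall t, is_derive t 1 phi (speed c t * delta m (phi t) / scale m);
  amplitude_period : forall t, phi (t + 1) = phi t + 2 * pi;
  amplitude_curve : forall t, c t = rigid 1 al p (wave m (phi t));
  amplitude_curvature : forall t, curvature c t = 2 * Num.sqrt m * cos (phi t) / scale m
}.

Lemma phase_amplitude c al lam theta : closed_elastica c ->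
  elastica_phase c al lam theta -> 1 < lam -> ~ multiple_cover c ->
  exists m p phi, amplitude c m al p phi.
Proof.
move=> ec ph l1 nm; have [pc [sx sy] v0 _] := ec.
have pi0 := pi_gt0 R.
have s0 := speed_gt0 v0.
have l0 : 0 < lam by lra.
have ln : lam != 0 by rewrite gt_eqF.
(* Chosen so that [2 * m - 1 = 1 / lam]: the curvature vanishes where [cos theta = - 1 / lam], which
   is the extreme angle of the wave. *)
pose m : R := (lam + 1) / (2 * lam).
have mE : 2 * lam * m = lam + 1 by rewrite /m; field.
have m2 : 1 / 2 < m by have l0' := l0; nra.
have m1 : m < 1 by have l0' := l0; nra.
pose k := Num.sqrt m.
have m0 : 0 < m by lra.
have k0 : 0 < k by rewrite sqrtr_gt0.
have kn : k != 0 by rewrite gt_eqF.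
have k2 : k ^+ 2 = m by rewrite sqr_sqrtr// ltW.
pose a := scale m.
have a0 : 0 < a by exact: scale_gt0.
have an : a != 0 by rewrite gt_eqF.
have a2 : lam * a ^+ 2 = 2 by rewrite /a scale_sqr//; lra.
(* [h] is half the angle, shifted by [pi] if necessary to make its cosine positive. As [lam > 1],
   nonnegativity of [1 + lam * cos theta] keeps [theta] away from the odd multiples of [pi]. *)
have [h [dh h0 hC hS]] : exists h : R -> R, [/\
    forall t, is_derive t 1 h (speed c t * curvature c t / 2),
    forall t, 0 < cos (h t),
    forall t, cos (theta t) = 1 - 2 * sin (h t) ^+ 2 &
    forall t, sin (theta t) = 2 * sin (h t) * cos (h t)].
  have dth t : is_derive t 1 (fun t => theta t / 2) (speed c t * curvature c t / 2).
    apply: (der_eq (derM (phase_theta ph t) (derC 2^-1 t))).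
    by rewrite mulr0 addr0.
  have tE t : theta t = theta t / 2 + theta t / 2 by field.
  have hC t : cos (theta t) = 1 - 2 * sin (theta t / 2) ^+ 2.
    by rewrite {1}(tE t) cosD -!expr2 cos2sin2; ring.
  have hS t : sin (theta t) = 2 * sin (theta t / 2) * cos (theta t / 2).
    by rewrite {1}(tE t) sinD; ring.
  have cn t : cos (theta t / 2) != 0.
    rewrite -sqrf_eq0 cos2sin2 gt_eqF//.
    have := phase_sqr ph t; rewrite hC; have := sqr_ge0 (curvature c t).
    move: (curvature c t ^+ 2) (sin _ ^+ 2) => K S K0 KE.
    by have l0' := l0; nra.
  have cc : continuous (fun t => cos (theta t / 2)).
    by move=> t; exact: der_continuous (der_cos (dth t)).
  have [cp|cm] := ltP 0 (cos (theta 0 / 2)).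
    by exists (fun t => theta t / 2); split=> //; exact: nonvanishing_gt0.
  have cp : forall t, 0 < - cos (theta t / 2).
    apply: nonvanishing_gt0.
    - by move=> t; apply: cvgN; exact: cc.
    - by move=> t; rewrite oppr_eq0.
    - by rewrite oppr_gt0 lt_neqAle cn.
  exists (fun t => theta t / 2 + pi); split => t.
  - by apply: (der_eq (derD (dth t) (derC pi t))); rewrite addr0.
  - by rewrite cosDpi.
  - by rewrite sinDpi sqrrN.
  - by rewrite sinDpi cosDpi hS; ring.
have dk t : is_derive t 1 (curvature c) (- (speed c t * lam * sin (h t) * cos (h t))).
  by apply: (der_eq (phase_curvature ph t)); rewrite hS; field.
pose g t := speed c t * cos (h t) / a.
have g0 t : 0 < g t by rewrite divr_gt0// mulr_gt0.
have dC t := der_cos (dh t); have dS t := der_sin (dh t).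
have dsp := smooth_der (smooth_speed sx sy v0).
have dg t : is_derive t 1 g ((derive1 (speed c) t * cos (h t) +
    speed c t * (- sin (h t) * (speed c t * curvature c t / 2))) * a^-1).
  apply: (der_eq (derM (derM (dsp t) (dC t)) (derC a^-1 t))).
  by rewrite mulr0 addr0.
have cg : continuous g by move=> t; exact: der_continuous (dg t).
have sk := smooth_curvature sx sy v0.
have cdg : continuous (fun t => (derive1 (speed c) t * cos (h t) +
    speed c t * (- sin (h t) * (speed c t * curvature c t / 2))) * a^-1).
  have ds2 := smooth_der (smooth_derive1 (smooth_speed sx sy v0)).
  move=> t; apply: (der_continuous (derM (derD (derM (ds2 t) (dC t)) (derM (dsp t) (derM (derN (dS t))
    (derM (derM (dsp t) (smooth_der sk t)) (derC 2^-1 t))))) (derC a^-1 t))).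
(* The relation between squared curvature and angle puts the rescaled pair of curvature and [sin h]
   on the unit circle; its argument is the amplitude. *)
have [|||phi dphi phiP] := @exists_lift R g (fun t => a / (2 * k) * curvature c t)
    (fun t => k^-1 * sin (h t)) cg.
- move=> t; apply: (der_eq (derZ (a / (2 * k)) (dk t))).
  transitivity (- (lam * a ^+ 2 * speed c t * sin (h t) * cos (h t) / (2 * k * a))).
    by field; rewrite kn an.
  by rewrite a2 /g; field; rewrite kn an.
- by move=> t; apply: (der_eq (derZ k^-1 (dS t))); rewrite /g; field; rewrite kn an.
- move=> t.
  have -> : (a / (2 * k) * curvature c t) ^+ 2 = a ^+ 2 / (4 * m) * curvature c t ^+ 2.
    by rewrite -k2; move: (curvature c t) => K; field.
  have -> : (k^-1 * sin (h t)) ^+ 2 = m^-1 * sin (h t) ^+ 2 by rewrite exprMn exprVn k2.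
  rewrite (phase_sqr ph) hC.
  transitivity ((a ^+ 2 * (1 + lam) - 2 * (lam * a ^+ 2) * sin (h t) ^+ 2 + 4 * sin (h t) ^+ 2) / (4 * m)).
    by field; rewrite gt_eqF.
  rewrite a2 (_ : a ^+ 2 * (1 + lam) = 4 * m); first by field; rewrite gt_eqF.
  by rewrite addrC -mE; transitivity (2 * m * (lam * a ^+ 2)); [ring|rewrite a2; ring].
have kE t : curvature c t = 2 * k * cos (phi t) / a.
  by have [<- _] := phiP t; field; rewrite kn an.
have hphi t : sin (h t) = k * sin (phi t) by have [_ <-] := phiP t; rewrite mulVKf.
have hdelta t : cos (h t) = delta m (phi t).
  apply/eqP; rewrite -(eqrXn2 (n := 2)) ?ltW ?delta_gt0 ?h0//.
  by rewrite delta_sqr ?ltW// cos2sin2 hphi exprMn k2.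
pose X t := cos al * (c t).1 + sin al * (c t).2.
pose Y t := cos al * (c t).2 - sin al * (c t).1.
have [_ dA] := abscissaP m1.
pose x t := X t - a * abscissa m (phi t).
pose y t := Y t + 2 * a * k * cos (phi t).
have x0 t : x t = x 0.
  apply: is_derive_0_is_cst => s.
  apply: (der_eq (derB (phase_x ph s) (derZ a (der_comp (dA (phi s)) (dphi s))))).
  rewrite /g hC hphi hdelta exprMn k2; have := delta_neq0 (phi s) m1.
  by move: (delta m _) => D Dn; field; rewrite an Dn.
have y0 t : y t = y 0.
  apply: is_derive_0_is_cst => s.
  apply: (der_eq (derD (phase_y ph s) (derZ (2 * a * k) (der_cos (dphi s))))).
  by rewrite /g hS hphi; field.
pose p := (cos al * x 0 - sin al * y 0, sin al * x 0 + cos al * y 0).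
have cE t : c t = rigid 1 al p (wave m (phi t)).
  have CS := cos2Dsin2 al.
  rewrite [LHS]surjective_pairing /rigid /wave /= -/a -/k; congr pair.
    rewrite -(x0 t) -(y0 t) /x /y /X /Y; transitivity ((cos al ^+ 2 + sin al ^+ 2) * (c t).1).
      by rewrite CS mul1r.
    by ring.
  rewrite -(x0 t) -(y0 t) /x /y /X /Y; transitivity ((cos al ^+ 2 + sin al ^+ 2) * (c t).2).
    by rewrite CS mul1r.
  by ring.
have hper t : cos (h (t + 1)) = cos (h t) /\ sin (h (t + 1)) = sin (h t).
  have e1 : cos (h (t + 1)) = cos (h t).
    apply/eqP; rewrite -(eqrXn2 (n := 2)) ?(ltW (h0 _))//; apply/eqP.
    by have := phase_cos ph t; rewrite !hC !cos2sin2; lra.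
  split=> //; have := phase_sin ph t; rewrite !hS e1 => /(mulIf (lt0r_neq0 (h0 t))).
  by lra.
have [n nE] : exists n : int, phi (0 + 1) = phi 0 + n%:~R * (2 * pi).
  have [e1 e2] := phiP 0; have [e3 e4] := phiP (0 + 1).
  by apply: eq_angle; rewrite -?e1 -?e2 -?e3 -?e4 ?curvature_periodic// (hper 0).2.
have per t : phi (t + 1) = phi t + n%:~R * (2 * pi).
  have : phi (t + 1) - phi t = phi (0 + 1) - phi 0.
    apply: (@is_derive_0_is_cst _ (fun t => phi (t + 1) - phi t)) => s.
    apply: (der_eq (derB (@der_comp _ phi (fun t => t + 1) s _ _ (dphi (s + 1))
      (derD (derI s) (derC 1 s))) (dphi s))).
    by rewrite /g speed_periodic// (hper s).1 addr0 mulr1 subrr.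
  by rewrite nE; lra.
have n0 : (0 < n)%R.
  have lt : phi 0 < phi (0 + 1).
    apply: (der_gt0_lt (der_within dphi) (fun x _ => dphi x)) => [s _|]; first exact: g0.
    by rewrite add0r.
  move: lt; rewrite nE ltrDl pmulr_lgt0 ?ltr0z//.
  by rewrite mulr_gt0.
case: n n0 nE per => // N N0 _ per; rewrite ltz_nat in N0.
have Nr : 0 < N%:R :> R by rewrite ltr0n.
have Pn : 2 * pi * N%:R != 0 :> R by rewrite gt_eqF// !mulr_gt0.
(* Over one turn of the curve the abscissa gains [2 N] times its half-period increment, and the
   curve is closed. *)
have root : abscissa m (pi / 2) = 0.
  have : X (0 + 1) = X 0 by rewrite /X pc.
  have := x0 (0 + 1); rewrite /x per abscissa_periods// => e1 e2.
  have /eqP : a * N%:R * 2 * abscissa m (pi / 2) = 0 by move: e1; rewrite e2; lra.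
  by rewrite mulf_eq0 mulf_eq0 mulf_eq0 (negbTE an) gt_eqF//= pnatr_eq0 => /eqP.
(* Otherwise the curve runs [N] times through one period of the wave, which is itself a closed
   curve. *)
have N1 : N = 1%N.
  apply/eqP; rewrite eqn_leq N0 andbT leqNgt; apply/negP => N2; apply: nm.
  have [[q1 [q2 q3] q4 _] _ _ _] := eight_figure_eight m2 m1 root.
  exists N, (fun t => rigid 1 al p (wave m (2 * pi * t))), (fun t => (2 * pi * N%:R)^-1 * phi t).
  split=> //.
  - exact: (rigid_closed_curve al p q1 q2 q3 q4).
  - split.
      by left=> t; rewrite per mulrDr [N%:R * _]mulrC mulVf.
    move=> s t _; exists (fun t => (2 * pi * N%:R)^-1 * g t); split.
      apply: (@C2_H2 R s t _ _ _ (fun u => derZ (2 * pi * N%:R)^-1 (dphi u))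
        (fun u => derZ (2 * pi * N%:R)^-1 (dg u))).
      move=> u; apply: (@cvgM _ _ (nbhs u)); first exact: cvg_cst.
      exact: cdg.
    by move=> u _; apply/eqP; rewrite mulf_neq0// ?gt_eqF// invr_gt0 !mulr_gt0.
  - move=> t; rewrite cE; congr (rigid _ _ _ (wave _ _)).
    by rewrite !mulrA mulfV// mul1r.
exists m, p, phi; split=> //.
- by move=> t; apply: (der_eq (dphi t)); rewrite /g hdelta.
- by move=> t; rewrite per N1 mul1r.
Qed.

Lemma figure_eight_amplitude c : figure_eight c ->
  exists m al p phi, amplitude c m al p phi.
Proof.
move=> [ec _ nc nm]; have [al [lam [theta ph]]] := exists_elastica_phase ec.
have l1 := phase_lam_gt1 ec ph (phase_lam_gt0 ph nc).
have [m [p [phi ap]]] := phase_amplitude ec ph l1 nm.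
by exists m, al, p, phi.
Qed.

Lemma figure_eight_closed_curve c : figure_eight c -> closed_curve c.
Proof. by move=> [[pc [sx sy] v0 _] _ _ _]; exact: smooth_closed_curve. Qed.

Definition wave_energy m x : R := 4 / scale m * bending m x + scale m * reduced_length m x.

Lemma wave_energyDpi m x : 1 / 2 < m -> m < 1 -> abscissa m (pi / 2) = 0 ->
  wave_energy m (x + pi) = wave_energy m x + drop_energy m.
Proof.
move=> m2 m1 root; rewrite /wave_energy bendingDpi// reduced_lengthDpi// /drop_energy.
have := bending_length_abscissa (pi / 2) m2 m1; rewrite root mulr0.
have := scale_gt0 m2; move: (scale m) (bending m (pi / 2)) (reduced_length m (pi / 2)) => a B L a0.
move=> aBL; have an : a != 0 by rewrite gt_eqF.
have -> : L = 4 * B / a ^+ 2 by have -> : 4 * B = a ^+ 2 * L by [lra|]; field.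
by field.
Qed.

Lemma wave_energyD2pi m x : 1 / 2 < m -> m < 1 -> abscissa m (pi / 2) = 0 ->
  wave_energy m (x + 2 * pi) = wave_energy m x + 2 * drop_energy m.
Proof.
move=> m2 m1 root; have -> : x + 2 * pi = x + pi + pi by ring.
by rewrite !wave_energyDpi//; ring.
Qed.

Lemma derive_wave_energy c m al p phi t : (forall t, velocity c t <> (0, 0)) ->
  amplitude c m al p phi ->
  is_derive t 1 (fun t => wave_energy m (phi t)) ((curvature c t ^+ 2 + 1) * speed c t).
Proof.
move=> v0 [m2 m1 root dphi _ _ kE].
have [_ dB] := bendingP m1; have [_ dL] := reduced_lengthP m1.
apply: (der_eq (der_comp (derD (derZ (4 / scale m) (dB (phi t)))
  (derZ (scale m) (dL (phi t)))) (dphi t))).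
rewrite kE; have := scale_gt0 m2; have := delta_neq0 (phi t) m1.
have : Num.sqrt m ^+ 2 = m by rewrite sqr_sqrtr//; lra.
move: (scale m) (delta m _) (cos _) (Num.sqrt m) => a D C k k2 Dn a0.
by rewrite -k2; field; rewrite Dn gt_eqF.
Qed.

Lemma amplitude_energy c m al p phi a b : figure_eight c ->
  amplitude c m al p phi -> a < b ->
  energy a b c = (wave_energy m (phi b) - wave_energy m (phi a))%:E.
Proof.
move=> [[pc [sx sy] v0 _] _ _ _] ap ab.
have dF t := derive_wave_energy t v0 ap.
have ch : continuous (fun t => (curvature c t ^+ 2 + 1) * speed c t).
  move=> t; apply: (der_continuous (derM (derD (derX 2 (smooth_der
    (smooth_curvature sx sy v0) t)) (derC 1 t)) (smooth_der (smooth_speed sx sy v0) t))).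
exact: (@energy_continuous R c _ _ a b ab ch dF (fun t _ => erefl)).
Qed.

End FigureEightAmplitude.

(** * Isometries relating two placements of the wave *)

Section RigidMotions.
Context {R : realType}.
Implicit Types (e al x : R) (p q : R * R).

Lemma rigid_flip e al p m x : m < 1 -> abscissa m (pi / 2) = 0 ->
  rigid (- e) al p (wave m x) = rigid e al p (wave m (x + pi)).
Proof. by move=> m1 root; rewrite waveDpi// /rigid/=; congr pair; ring. Qed.

Definition rigid_inv e al p q : R * R :=
  (cos al * (q.1 - p.1) + sin al * (q.2 - p.2),
   e * (cos al * (q.2 - p.2) - sin al * (q.1 - p.1))).

Lemma rigidK e al p : e = 1 \/ e = -1 -> cancel (rigid e al p) (rigid_inv e al p).
Proof.
move=> he q; have e2 : e * e = 1 by case: he => ->; ring.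
have CS := cos2Dsin2 al; rewrite [RHS]surjective_pairing /rigid_inv /rigid /=.
congr pair.
  transitivity ((cos al ^+ 2 + sin al ^+ 2) * q.1); first by ring.
  by rewrite CS mul1r.
transitivity ((cos al ^+ 2 + sin al ^+ 2) * (e * e) * q.2); first by ring.
by rewrite CS e2 !mul1r.
Qed.

Lemma isometry_rigid e al p : e = 1 \/ e = -1 -> Defs.isometry (rigid e al p).
Proof.
move=> he q r; have e2 : e ^+ 2 = 1 by case: he => ->; ring.
rewrite /enorm /rigid /=; congr Num.sqrt; have CS := cos2Dsin2 al.
transitivity ((cos al ^+ 2 + sin al ^+ 2) *
  ((q.1 - r.1) ^+ 2 + e ^+ 2 * (q.2 - r.2) ^+ 2)); first by ring.
by rewrite CS e2 !mul1r.
Qed.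

Lemma isometry_rigid_inv e al p : e = 1 \/ e = -1 -> Defs.isometry (rigid_inv e al p).
Proof.
move=> he q r; have e2 : e ^+ 2 = 1 by case: he => ->; ring.
rewrite /enorm /rigid_inv /=; congr Num.sqrt; have CS := cos2Dsin2 al.
transitivity ((cos al ^+ 2 + e ^+ 2 * sin al ^+ 2) * (q.1 - r.1) ^+ 2 +
  (sin al ^+ 2 + e ^+ 2 * cos al ^+ 2) * (q.2 - r.2) ^+ 2 +
  2 * (1 - e ^+ 2) * cos al * sin al * (q.1 - r.1) * (q.2 - r.2)); first by ring.
by rewrite e2 !mul1r [sin al ^+ 2 + _]addrC CS; ring.
Qed.

Lemma exists_isometry e al p e' al' p' : e = 1 \/ e = -1 -> e' = 1 \/ e' = -1 ->
  exists2 Phi, Defs.isometry Phi & forall q : R * R, Phi (rigid e al p q) = rigid e' al' p' q.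
Proof.
move=> he he'; exists (fun q => rigid e' al' p' (rigid_inv e al p q)).
  by move=> q r; rewrite isometry_rigid// isometry_rigid_inv.
by move=> q; rewrite rigidK.
Qed.

End RigidMotions.

(** * Reparametrization by matching arclengths *)

Section ArclengthChange.
Context {R : realType}.
Local Notation mu := (@lebesgue_measure R).
Implicit Types (a b s t : R) (f g : R -> R) (c : R -> R * R).

Lemma polar_formW a b s t c rho drho theta omega :
  polar_form a b c rho drho theta omega -> a <= s -> t <= b ->
  polar_form s t c rho drho theta omega.
Proof.
move=> [px py pr pr2 pt pi pg pv pe] as_ tb; have sub := subset_segment as_ tb; split.
- exact: primitive_onW px _ _.
- exact: primitive_onW py _ _.
- exact: primitive_onW pr _ _.
- by apply: integrableS pr2.
- exact: primitive_onW pt _ _.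
- by apply: integrableS pi.
- by move=> u /andP[su ut]; apply: pg; rewrite (le_trans as_ su) (le_trans ut tb).
- by move=> u /andP[su ut]; apply: pv; rewrite (le_lt_trans as_ su) (lt_le_trans ut tb).
- by move=> u v su uv vt; apply: pe => //; [exact: le_trans su|exact: le_trans vt tb].
Qed.

Lemma polar_speed a b c rho drho theta omega t :
  polar_form a b c rho drho theta omega -> a < t < b -> speed c t = rho t.
Proof.
move=> pf /[dup] tab /andP[at_ tb]; rewrite /speed (polar_velocity pf tab) enorm_polar//.
by apply: ltW; apply: (polar_gt0 pf); rewrite !ltW.
Qed.

Lemma arclength_polar a b c rho drho theta omega F : a <= b ->
  polar_form a b c rho drho theta omega -> (forall t, is_derive t 1 F (speed c t)) ->
  primitive_on a b F rho.
Proof.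
move=> ab pf dF; apply: primitive_on_C1.
- exact: primitive_on_continuous ab (polar_rho pf).
- exact: der_within dF.
- by move=> x xab; rewrite -(polar_speed pf xab); exact: dF.
Qed.

(** Both uniqueness statements use reparametrizations of the form [G \o L], an inverse arclength
    after an arclength. The second derivative is [q (L) * drho + dq (L) * rho^2], square integrable
    because [drho] is. *)
Lemma H2_arclength_change a b c rho drho theta omega (L G q dq : R -> R) : a <= b ->
  polar_form a b c rho drho theta omega -> primitive_on a b L rho ->
  (forall y : R, is_derive y 1 G (q y)) -> (forall y : R, is_derive y 1 q (dq y)) ->
  continuous dq -> H2_with_derivative a b (G \o L) (fun t => q (L t) * rho t).
Proof.
move=> ab pf pL dG dQ cdq.
have cL := primitive_on_continuous ab pL.
have cr := primitive_on_continuous ab (polar_rho pf).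
have cq y : {for y, continuous q} by exact: der_continuous (dQ y).
have cqL : {within `[a, b], continuous (q \o L)} by apply: within_comp.
have cdqL : {within `[a, b], continuous (dq \o L)} by apply: within_comp => // x _; exact: cdq.
have cddr : {within `[a, b], continuous (fun t => (dq \o L) t * rho t * rho t)}.
  by apply: withinM => //; apply: withinM.
split; first exact: (primitive_on_comp pL (fun t _ => dG (L t)) cqL).
have pq := primitive_on_comp pL (fun t _ => dQ (L t)) cdqL.
exists (fun t => q (L t) * drho t + dq (L t) * rho t * rho t); split.
  exact: (primitive_onM ab pq (polar_rho pf)).
apply: integrable_sqrD.
- exact: (integrable_withinM cqL (polar_rho pf).1).
- exact: (integrable_within cddr).
- exact: (integrable_sqrM cqL (polar_drho2 pf)).
- by apply: integrable_within; exact: (withinX (n := 2) cddr).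
Qed.

(** The speed is positive and periodic, hence bounded below, so arclength maps onto the whole line.
    Continuity of [dq] makes the inverse of class C^2. *)
Lemma exists_arclength_inverse c : closed_elastica c -> exists S G dq : R -> R,
  [/\ forall t : R, is_derive t 1 S (speed c t), cancel S G /\ cancel G S,
      forall y : R, is_derive y 1 G (speed c (G y))^-1,
      forall y : R, is_derive y 1 (fun y => (speed c (G y))^-1) (dq y) & continuous dq].
Proof.
move=> [pc [sx sy] v0 _].
have s0 := speed_gt0 v0.
have ss := smooth_speed sx sy v0; have cs := smooth_continuous ss.
have ds := smooth_der ss; have dds := smooth_der (smooth_derive1 ss).
have [S dS] := exists_antiderivative cs.
have [e e0 se] := periodic_bounded_below cs (speed_periodic pc) s0.
have [G [SG GS dG]] := exists_inverse dS s0 (der_lbound_surj dS e0 se).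
have sn y : speed c (G y) != 0 by rewrite gt_eqF.
pose u (y : R) := (speed c (G y))^-1.
have du (y : R) : is_derive y 1 u (- (derive1 (speed c) (G y) * u y) / speed c (G y) ^+ 2).
  exact: (derV (f := fun y => speed c (G y)) (sn y) (der_comp (ds (G y)) (dG y))).
exists S, G, (fun y => - (derive1 (speed c) (G y) * u y) * (u y * u y)); split=> //.
  move=> y; apply: (der_eq (du y)); rewrite /u.
  by have ? := sn y; field.
move=> y; apply: (der_continuous (derM (derN (derM (der_comp (dds (G y)) (dG y)) (du y)))
  (derM (du y) (du y)))).
Qed.

End ArclengthChange.

(** * Translation invariance of Lebesgue measure *)

Section Translation.
Context {R : realType}.
Local Notation mu := (@lebesgue_measure R).
Implicit Types (a b r s t : R).

Definition translate (r : R) : measurableTypeR R -> measurableTypeR R := fun x => x + r.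

Lemma measurable_translate r : measurable_fun setT (translate r).
Proof. exact: measurable_funD. Qed.

HB.instance Definition _ r := isMeasurableFun.Build _ _ _ _ _ (measurable_translate r).

Lemma preimage_translate a b r (x y : bool) :
  translate r @^-1` [set` Interval (BSide x (a + r)) (BSide y (b + r))] =
  [set` Interval (BSide x a) (BSide y b)].
Proof.
by case: x; case: y; apply/seteqP; split => u /=; rewrite !in_itv/= /translate ?lerD2r ?ltrD2r.
Qed.

Lemma lebesgue_measure_translate (r : R) (A : set R) : measurable A ->
  pushforward mu (translate r) A = mu A.
Proof.
move=> mA; apply/esym/lebesgue_measure_unique => //= _ [[a b]] _ <-.
have := preimage_translate (a - r) (b - r) r false false; rewrite !subrK => E.
rewrite [RHS](_ : _ = mu `](a - r), (b - r)]); last by congr (mu _); exact: E.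
rewrite !lebesgue_measure_itv/= !lte_fin ltrD2r.
by congr (if _ then _ else _); rewrite -!EFinB; congr EFin; ring.
Qed.

Lemma ge0_integral_translate (f : R -> \bar R) (a b r : R) :
  measurable_fun `[(a + r)%R, (b + r)%R] f ->
  (forall x, a + r <= x <= b + r -> (0 <= f x)%E) ->
  (\int[mu]_(x in `[(a + r)%R, (b + r)%R]) f x = \int[mu]_(x in `[a, b]) f (x + r)%R)%E.
Proof.
move=> mf f0.
transitivity (\int[pushforward mu (translate r)]_(x in `[(a + r)%R, (b + r)%R]) f x)%E.
  by apply: eq_measure_integral => //= A mA _; exact/esym/lebesgue_measure_translate.
rewrite (ge0_integral_pushforward (measurable_translate r))//=.
  by rewrite preimage_translate.
by move=> y /[1!inE]/=; rewrite in_itv/=; exact: f0.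
Qed.

End Translation.

(** * The loops of a figure eight are the minimal drops *)

Section Drops.
Context {R : realType}.
Local Notation mu := (@lebesgue_measure R).
Implicit Types (a b s t l : R) (f g F : R -> R) (c d : R -> R * R).

Lemma drop_energy_le m a b d : 1 / 2 < m -> m < 1 -> abscissa m (pi / 2) = 0 -> a < b ->
  regular_H2_curve a b d -> d a = d b -> ((drop_energy m)%:E <= energy a b d)%E.
Proof.
move=> m2 m1 root ab rd dab; have [rho [drho [th [om pf]]]] := exists_polar_form ab rd.
have [le _] := drop_bound_and_structure m2 m1 root ab pf dab.
by rewrite (energy_drop ab pf) lee_fin.
Qed.

Lemma der_affine s l t f r : is_derive (s + t * l) 1 f r ->
  is_derive t 1 (fun t => f (s + t * l)) (l * r).
Proof.
move=> df; apply: (der_eq (@der_comp _ f (fun t => s + t * l) t _ _ df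
  (derD (derC s t) (derM (derI t) (derC l t))))).
by ring.
Qed.

Section AffineReparametrization.
Context c (sx : smooth (fst \o c)) (sy : smooth (snd \o c)) (s l : R) (l0 : 0 < l).
Let D t := c (s + t * l).

Let dx (t : R) : is_derive t 1 (fst \o D) (l * derive1 (fst \o c) (s + t * l)).
Proof. by apply: (@der_affine s l t (fst \o c)); exact: smooth_der. Qed.
Let dy (t : R) : is_derive t 1 (snd \o D) (l * derive1 (snd \o c) (s + t * l)).
Proof. by apply: (@der_affine s l t (snd \o c)); exact: smooth_der. Qed.
Let d2x (t : R) : is_derive t 1 (fun t => l * derive1 (fst \o c) (s + t * l))
  (l * (l * derive1 (derive1 (fst \o c)) (s + t * l))).
Proof. by apply: derZ; apply: der_affine; apply: smooth_der; exact: smooth_derive1. Qed.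
Let d2y (t : R) : is_derive t 1 (fun t => l * derive1 (snd \o c) (s + t * l))
  (l * (l * derive1 (derive1 (snd \o c)) (s + t * l))).
Proof. by apply: derZ; apply: der_affine; apply: smooth_der; exact: smooth_derive1. Qed.

Lemma velocity_affine : velocity D = fun t => (l * (velocity c (s + t * l)).1, l * (velocity c (s + t * l)).2).
Proof. by apply/funext => t; rewrite /velocity (der_derive1 (dx t)) (der_derive1 (dy t)). Qed.

Lemma speed_affine t : speed D t = l * speed c (s + t * l).
Proof.
rewrite /speed velocity_affine /enorm /= !exprMn -mulrDr sqrtrM ?sqr_ge0//.
by rewrite sqrtr_sqr gtr0_norm.
Qed.

Lemma curvature_affine t : speed c (s + t * l) != 0 -> curvature D t = curvature c (s + t * l).
Proof.
move=> sn; rewrite /curvature speed_affine.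
have -> : velocity (velocity D) t = (l * (l * (velocity (velocity c) (s + t * l)).1),
    l * (l * (velocity (velocity c) (s + t * l)).2)).
  rewrite velocity_affine [LHS](_ : _ = (derive1 (fun t => l * derive1 (fst \o c) (s + t * l)) t,
    derive1 (fun t => l * derive1 (snd \o c) (s + t * l)) t))//.
  by rewrite (der_derive1 (d2x t)) (der_derive1 (d2y t)).
rewrite velocity_affine; lazy zeta; have ln : l != 0 by rewrite gt_eqF.
move: (speed c _) sn (velocity c _) (velocity (velocity c) _) => r rn [v1 v2] [w1 w2] /=.
by field; rewrite ln rn.
Qed.

Lemma regular_affine a b : (forall t, velocity c t <> (0, 0)) -> regular_H2_curve a b D.
Proof.
move=> v0; exists (velocity D); rewrite velocity_affine.
have cts f : smooth f -> continuous (fun t => l * (l * derive1 (derive1 f) (s + t * l))).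
  move=> sf t; have d3 := smooth_der (smooth_derive1 (smooth_derive1 sf)).
  exact: (der_continuous (derZ l (derZ l (der_affine (d3 (s + t * l)))))).
split.
- exact: (@C2_H2 R a b _ _ _ dx d2x (cts _ sx)).
- exact: (@C2_H2 R a b _ _ _ dy d2y (cts _ sy)).
- move=> t _ [] /eqP e1 /eqP e2; apply: (v0 (s + t * l)); move: e1 e2.
  by rewrite !mulf_eq0 (gt_eqF l0) /= /velocity => /eqP -> /eqP ->.
Qed.

End AffineReparametrization.

Section LoopsOfFigureEight.
Context c (fc : figure_eight c) (m al : R) (p : R * R) (phi : R -> R)
  (ap : amplitude c m al p phi).
Let m2 : 1 / 2 < m. Proof. exact: amplitude_half ap. Qed.
Let m1 : m < 1. Proof. exact: amplitude_lt1 ap. Qed.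
Let root : abscissa m (pi / 2) = 0. Proof. exact: amplitude_root ap. Qed.

Lemma figure_eight_energy : energy 0 1 c = (2 * drop_energy m)%:E.
Proof.
rewrite (amplitude_energy fc ap ltr01) -{1}[1]add0r (amplitude_period ap) wave_energyD2pi//.
by congr EFin; ring.
Qed.

(** The double point is never located: the two complementary loops each have at least the minimal
    energy, and their energies add up to twice the minimum. *)
Lemma loop_wave_energy s1 s2 : s1 < s2 < s1 + 1 -> c s1 = c s2 ->
  wave_energy m (phi s2) - wave_energy m (phi s1) = drop_energy m.
Proof.
move=> /andP[s12 s21] cs; have [pc rc] := figure_eight_closed_curve fc.
have h1 := drop_energy_le m2 m1 root s12 (rc _ _ s12) cs.
have h2 := drop_energy_le m2 m1 root s21 (rc _ _ s21) (etrans (esym cs) (esym (pc s1))).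
move: h1 h2; rewrite !(amplitude_energy fc ap)// !lee_fin (amplitude_period ap).
by rewrite wave_energyD2pi//; lra.
Qed.

Context (s1 s2 : R) (s12 : s1 < s2 < s1 + 1) (cs : c s1 = c s2).
Let l := s2 - s1.
Let l0 : 0 < l. Proof. by rewrite subr_gt0; case/andP: s12. Qed.
Let D t := c (s1 + t * l).

Lemma loop_is_drop : is_drop D.
Proof.
have [[_ [sx sy] v0 _] _ _ _] := fc; split; first exact: regular_affine.
by rewrite /D mul0r addr0 mul1r subrKC.
Qed.

Lemma loop_energy : energy 0 1 D = (drop_energy m)%:E.
Proof.
have [[_ [sx sy] v0 _] _ _ _] := fc.
have s0 t := speed_gt0 v0 t.
pose h t := l * ((curvature c (s1 + t * l) ^+ 2 + 1) * speed c (s1 + t * l)).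
have dF t : is_derive t 1 (fun t => wave_energy m (phi (s1 + t * l))) (h t).
  exact: (@der_affine s1 l t (fun t => wave_energy m (phi t))) (derive_wave_energy _ v0 ap).
have ch : continuous h.
  move=> t; apply: (der_continuous (derZ l (@der_affine s1 l t _ _ (derM (derD (derX 2 (smooth_der
    (smooth_curvature sx sy v0) _)) (derC 1 _)) (smooth_der (smooth_speed sx sy v0) _))))).
rewrite (@energy_continuous R D h _ 0 1 ltr01 ch dF).
  by rewrite mul0r addr0 mul1r subrKC loop_wave_energy.
move=> t _; rewrite curvature_affine// ?gt_eqF// speed_affine// /h.
by rewrite mulrCA.
Qed.

Lemma loop_minimizer : minimizer is_drop (energy 0 1) D.
Proof.
split; first exact: loop_is_drop.
move=> d [rd d01]; rewrite loop_energy.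
exact: drop_energy_le ltr01 rd d01.
Qed.

Lemma reduced_length_inj : injective (reduced_length m).
Proof.
have [_ dL] := reduced_lengthP m1; apply: (der_pos_inj dL) => x.
by rewrite invr_gt0 delta_gt0.
Qed.

Lemma loop_unique d : minimizer is_drop (energy 0 1) d -> drop_congruent D d.
Proof.
move=> [[rd d01] /(_ _ loop_is_drop)]; rewrite loop_energy => le.
have [ltse s21] := andP s12; have les := ltW ltse.
have [ec _ _ _] := fc; have [_ _ v0 _] := ec.
have a0 : 0 < scale m by exact: scale_gt0.
have an : scale m != 0 by rewrite gt_eqF.
have [rho [drho [th [om pf]]]] := exists_polar_form ltr01 rd.
have [_ st] := drop_bound_and_structure m2 m1 root ltr01 pf d01.
move: le; rewrite (energy_drop ltr01 pf) lee_fin => /st.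
move=> [e [be [b0 [psi [he _ _ [psi0 psi1] psiP]]]]].
have [_ rc] := figure_eight_closed_curve fc.
have [rhc [drhc [thc [omc pfc]]]] := exists_polar_form ltse (rc _ _ ltse).
have [_ stc] := drop_bound_and_structure m2 m1 root ltse pfc cs.
have := amplitude_energy fc ap ltse; rewrite loop_wave_energy// (energy_drop ltse pfc) => -[Ec].
(* The structure theorem is applied to the loop as well as to [d]; both are then half waves,
   compared through [chi] and [psi]. *)
have /stc[e' [al' [b' [chi [he' _ _ [chi1 chi2] chiP]]]]] :
    \int[mu]_(t in `[s1, s2]) (omc t ^+ 2 / rhc t + rhc t) <= drop_energy m by rewrite Ec.
have [S [G [dq [dS [SG GS] dG dQ cdq]]]] := exists_arclength_inverse ec.
have pS := arclength_polar les pfc dS.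
(* Arclength along [d], counted from the arclength at which the loop begins; [G \o L] is the time of
   [c] with the same arclength. *)
pose L t := S s1 + \int[mu]_(u in `[0, t]) rho u.
have irho := integrable_within (primitive_on_continuous ler01 (polar_rho pf)).
have Lz : L 0 = S s1 by rewrite /L set_itv1 Rintegral_set1 addr0.
have pL : primitive_on 0 1 L rho.
  by split=> // t t01; rewrite Lz.
have SE t : s1 <= t <= s2 -> S t = S s1 + scale m * reduced_length m (chi t).
  move=> tab; have [_ -> _] := chiP _ tab; exact: pS.2.
have LE t : 0 <= t <= 1 -> L t = S s1 + scale m * reduced_length m (psi t).
  by move=> t01; have [_ -> _] := psiP _ t01.
have L1 : L 1 = S s2.
  by rewrite LE ?lexx ?ler01// (SE s2) ?lexx ?les// psi1 chi2.
have Lmono t : 0 <= t <= 1 -> S s1 <= L t <= S s2.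
  move=> /andP[t0 t1]; have r0 u : 0 <= u <= 1 -> 0 <= rho u.
    by move=> u01; exact: ltW (polar_gt0 pf u01).
  by rewrite -Lz -L1; apply/andP; split; apply: (primitive_on_le pL r0).
have Smono := der_pos_mono dS (speed_gt0 v0).
have Gs t : 0 <= t <= 1 -> s1 <= G (L t) <= s2.
  by move=> /Lmono; rewrite -{1 2}(GS (L t)) !Smono.
have chipsi t : 0 <= t <= 1 -> chi (G (L t)) = psi t.
  move=> t01; apply: reduced_length_inj; apply: (mulfI an).
  by have := LE _ t01; rewrite -{1}(GS (L t)) SE ?Gs//; lra.
have [Phi iPhi PhiE] := exists_isometry al' (c s1) be (d 0) he' he.
exists Phi, (fun t => l^-1 * (G (L t) - s1)); split=> //.
- have ln : l != 0 by rewrite gt_eqF.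
  (* An increasing parameter change always suffices, since reflected drops are taken care of by the
     isometry. *)
  split; first by left; rewrite Lz L1 !SG subrr mulr0 mulVf.
  exists (fun t => l^-1 * (speed c (G (L t)))^-1 * rho t); split; last first.
    move=> t t01; apply/eqP; rewrite !mulf_neq0 ?invr_neq0 ?gt_eqF ?(polar_gt0 pf)//.
    exact: speed_gt0.
  have dGl (y : R) : is_derive y 1 (fun y => l^-1 * (G y - s1)) (l^-1 * (speed c (G y))^-1).
    by apply: (der_eq (derZ l^-1 (derB (dG y) (derC s1 y)))); rewrite subr0.
  have dQl (y : R) := derZ l^-1 (dQ y).
  apply: (H2_arclength_change ler01 pf pL dGl dQl).
  by move=> y; apply: (@cvgM _ _ (nbhs y)); [exact: cvg_cst|exact: cdq].
- move=> t t01; have [_ _ ->] := psiP _ t01.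
  have -> : D (l^-1 * (G (L t) - s1)) = c (G (L t)).
    by congr c; rewrite mulrAC mulVf ?gt_eqF// mul1r subrKC.
  by have [_ _ ->] := chiP _ (Gs _ t01); rewrite PhiE chipsi.
Qed.

End LoopsOfFigureEight.

End Drops.

(** * Cutting a closed curve at a double point *)

Section ClosedCurves.
Context {R : realType}.
Local Notation mu := (@lebesgue_measure R).
Implicit Types (a b s t l : R) (f g F : R -> R) (c d : R -> R * R).

Lemma closed_speed_continuous d : closed_curve d -> continuous (speed d).
Proof.
move=> [_ rd] t; have ab : t - 1 < t + 1 by lra.
have [rho [drho [th [om pf]]]] := exists_polar_form ab (rd _ _ ab).
have tab : t - 1 < t < t + 1 by apply/andP; split; lra.
have crho : {for t, continuous rho}.
  exact: within_itvoo (primitive_on_continuous (ltW ab) (polar_rho pf)) tab.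
rewrite /continuous_at (polar_speed pf tab); apply: cvg_trans crho.
apply: near_eq_cvg; have : t \in `]t - 1, t + 1[ by rewrite in_itv.
by move=> /near_in_itvoo; apply: filterS => u; rewrite in_itv/= => /(polar_speed pf) ->.
Qed.

Section PeriodicIntegrand.
Context d (cd : closed_curve d) (rho drho theta omega : R -> R)
  (pf : polar_form (-1) 3 d rho drho theta omega).
Let g t := omega t ^+ 2 / rho t + rho t.

Let velocity_cos_sin t : -1 < t < 2 ->
  [/\ rho (t + 1) = rho t, cos (theta (t + 1)) = cos (theta t) &
      sin (theta (t + 1)) = sin (theta t)].
Proof.
move=> /andP[t1 t2].
have h1 : -1 < t < 3 by apply/andP; split; lra.
have h2 : -1 < t + 1 < 3 by apply/andP; split; lra.
have r0 : rho t != 0 by rewrite gt_eqF// (polar_gt0 pf)//; apply/andP; split; lra.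
have rE : rho (t + 1) = rho t.
  by rewrite -(polar_speed pf h1) -(polar_speed pf h2) speed_periodic//; case: cd.
have := velocity_periodic cd.1 t; rewrite (polar_velocity pf h1) (polar_velocity pf h2) rE.
by move=> [/(mulfI r0) -> /(mulfI r0) ->].
Qed.

(** [omega] is determined only almost everywhere, and [theta] need not be periodic. But [cos theta]
    and [sin theta] are, and comparing their derivatives at almost every point shows that [omega]
    repeats there. *)
Lemma integral_periodic s : 0 <= s <= 1 ->
  \int[mu]_(t in `[0 + 1, s + 1]) g t = \int[mu]_(t in `[0, s]) g t.
Proof.
move=> /andP[s0 s1]; rewrite /Rintegral; congr fine.
have g0 t : -1 <= t <= 3 -> 0 <= g t.
  move=> /(polar_gt0 pf)/ltW r0; rewrite /g addr_ge0//.
  by rewrite divr_ge0// sqr_ge0.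
rewrite (ge0_integral_translate (f := EFin \o g)); last 2 first.
- have ig : mu.-integrable `[0 + 1, s + 1] (EFin \o g).
    by apply: integrableS (polar_int pf) => //; apply: subset_segment; lra.
  exact: measurable_int ig.
- move=> x /andP[x0 x1]; rewrite lee_fin; apply: g0; apply/andP; split; lra.
have [N [mN N0 NP]] := primitive_on_ae_derive (polar_theta pf).
have mN1 : measurable (translate 1 @^-1` N).
  by rewrite -[X in measurable X]setTI; exact: measurable_translate.
symmetry; apply: (@eq_integral_off_null R _ _ mu _ (N `|` translate 1 @^-1` N)).
- exact: measurableU.
- rewrite -N0; apply: measureU0 => //.
  exact: etrans (lebesgue_measure_translate 1 mN) N0.
- move=> x /=; rewrite in_itv/= => /andP[x0 x1]; rewrite lee_fin; apply: g0.
  by apply/andP; split; lra.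
- move=> x /=; rewrite in_itv/= => /andP[x0 x1]; rewrite lee_fin; apply: g0.
  by apply/andP; split; lra.
move=> x /=; rewrite in_itv/= => /andP[x0 x1] /not_orP[Nx N1x].
have x12 : -1 < x < 2 by apply/andP; split; lra.
have d1 : is_derive x 1 theta (omega x) by apply: NP => //; apply/andP; split; lra.
have d2 : is_derive x 1 (fun y => theta (y + 1)) (omega (x + 1)).
  have dt : is_derive (x + 1) 1 theta (omega (x + 1)).
    by apply: NP => //; apply/andP; split; lra.
  apply: (der_eq (@der_comp _ theta (fun y => y + 1) x _ _ dt (derD (derI x) (derC 1 x)))).
  by rewrite addr0 mulr1.
have nb : \forall y \near x, -1 < y < 2.
  have : x \in `]-1, 2[ by rewrite in_itv.
  by move=> /near_in_itvoo; apply: filterS => y; rewrite in_itv.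
have [rE CE SE] := velocity_cos_sin x12.
have eC : - sin (theta x) * omega x = - sin (theta x) * omega (x + 1).
  rewrite -{2}SE; apply: (der_inj (der_cos d1)); apply: near_eq_is_derive (der_cos d2).
  by apply: filterS nb => y /velocity_cos_sin[].
have eS : cos (theta x) * omega x = cos (theta x) * omega (x + 1).
  rewrite -{2}CE; apply: (der_inj (der_sin d1)); apply: near_eq_is_derive (der_sin d2).
  by apply: filterS nb => y /velocity_cos_sin[].
have oE : omega x = omega (x + 1).
  transitivity ((cos (theta x) ^+ 2 + sin (theta x) ^+ 2) * omega x); first by rewrite cos2Dsin2 mul1r.
  transitivity ((cos (theta x) ^+ 2 + sin (theta x) ^+ 2) * omega (x + 1)); last by rewrite cos2Dsin2 mul1r.
  transitivity (cos (theta x) * (cos (theta x) * omega x) - sin (theta x) * (- sin (theta x) * omega x)).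
    by ring.
  by rewrite eC eS; ring.
by rewrite /= /g rE oE.
Qed.

(** The window [[-1, 3]] contains both [[0, 1]] and [[s1, s1 + 1]], so one polar form serves all
    pieces; periodicity of the density replaces [[0, s1]] by [[1, s1 + 1]]. *)
Lemma closed_energy_split s1 s2 : 0 <= s1 -> s1 < s2 -> s2 < 1 ->
  energy 0 1 d = (energy s1 s2 d + energy s2 (s1 + 1) d)%E.
Proof.
move=> s0 s12 s21.
pose I t := \int[mu]_(u in `[-1, t]) g u.
have I1 : I (-1) = 0 by rewrite /I set_itv1 Rintegral_set1.
have pI : primitive_on (-1) 3 I g.
  by split=> [|t _]; [exact: polar_int pf|rewrite I1 add0r].
have eE s t : -1 <= s -> s < t -> t <= 3 -> energy s t d = (I t - I s)%:E.
  by move=> h1 h2 h3; rewrite (polar_energy pf)// -(primitive_on_incr pI)// ltW.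
have per : I (s1 + 1) - I (0 + 1) = I s1 - I 0.
  rewrite !(primitive_on_incr pI)//; do ?lra.
  by apply: integral_periodic; apply/andP; split; lra.
have -> : energy 0 1 d = (I 1 - I 0)%:E by apply: eE; lra.
have -> : energy s1 s2 d = (I s2 - I s1)%:E by apply: eE; lra.
have -> : energy s2 (s1 + 1) d = (I (s1 + 1) - I s2)%:E by apply: eE; lra.
by rewrite -EFinD; congr EFin; move: per; rewrite add0r; lra.
Qed.

End PeriodicIntegrand.

Lemma self_intersecting_ordered d : self_intersecting d ->
  exists s1 s2, [/\ 0 <= s1, s1 < s2, s2 < 1 & d s1 = d s2].
Proof.
move=> [s1 [s2 [/andP[a1 b1] /andP[a2 b2] /eqP ne dE]]].
have [lt|gt|/eqP] := ltgtP s1 s2; last by rewrite (negbTE ne).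
  by exists s1, s2.
by exists s2, s1.
Qed.

End ClosedCurves.

(** * Minimality and uniqueness of the figure eight *)

Section FigureEightMinimizes.
Context {R : realType}.
Local Notation mu := (@lebesgue_measure R).
Implicit Types (a b s t l : R) (f g F : R -> R) (c d : R -> R * R).

Lemma closed_energy_ge m d : 1 / 2 < m -> m < 1 -> abscissa m (pi / 2) = 0 ->
  closed_curve d -> self_intersecting d -> ((2 * drop_energy m)%:E <= energy 0 1 d)%E.
Proof.
move=> m2 m1 root cd /self_intersecting_ordered[s1 [s2 [s0 s12 s21 ds]]].
have ab : (-1 : R) < 3 by lra.
have [rho [drho [th [om pf]]]] := exists_polar_form ab (cd.2 _ _ ab).
have s2s : s2 < s1 + 1 by lra.
rewrite (closed_energy_split cd pf s0 s12 s21) (_ : 2 * drop_energy m = drop_energy m + drop_energy m).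
  rewrite EFinD; apply: leeD; apply: drop_energy_le => //; do ?exact: cd.2.
  by rewrite cd.1.
by ring.
Qed.

(* The sign is reversed at the double point: otherwise the tangent would turn
   by [4 * beta] along the curve, which is not a multiple of [2 * pi]. *)
Lemma opposite_loops (m e1 e2 al1 al2 beta : R) (n : int) : 1 / 2 < m ->
  e1 = 1 \/ e1 = -1 -> e2 = 1 \/ e2 = -1 ->
  cos beta = - (2 * m - 1) -> 0 < beta < pi ->
  al1 + e1 * beta = al2 - e2 * beta ->
  al2 + e2 * beta = al1 - e1 * beta + n%:~R * (2 * pi) ->
  e2 = - e1 /\ al2 = al1.
Proof.
move=> m2 h1 h2 cb b0 t1 t2.
suff e : e2 = - e1 by split=> //; move: t1; rewrite e; lra.
have [//|e] : e2 = - e1 \/ e2 = e1 by case: h1 => ->; case: h2 => ->; (by left; ring) || by right.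
exfalso; have pi0 := pi_gt0 R.
(* With [0 < beta < pi] this leaves only [beta = pi / 2], whose cosine is 0 and not
   [- (2 * m - 1)]. *)
have E : 2 * (e1 * beta) = n%:~R * pi by move: t1 t2; rewrite e; lra.
have [k kE] : exists k : int, 2 * beta = k%:~R * pi.
  case: h1 => h1; rewrite h1 in E; first by exists n; lra.
  by exists (- n); rewrite mulrNz; lra.
have k0 : (0 : R) < k%:~R by case/andP: b0 => b0 b1; nra.
have k2 : k%:~R < 2%:~R :> R by case/andP: b0 => b0 b1; rewrite -[2%:~R]/2; nra.
have {k0 k2} k1 : k = 1 by move: k0 k2; rewrite ltr0z ltr_int; case: k {kE} => [[|[|k]]|k].
have bE : beta = pi / 2 by move: kE; rewrite k1; lra.
by move: cb; rewrite bE cos_pihalf; lra.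
Qed.

Section Uniqueness.
Context d (cd : closed_curve d) (m : R) (m2 : 1 / 2 < m) (m1 : m < 1)
  (root : abscissa m (pi / 2) = 0).

(** Each point is described by some amplitude [x] with the right arclength. This form is invariant
    under [t + 1], so only the period starting at the double point has to be examined. *)
Lemma closed_minimizer_wave (S : R -> R) : self_intersecting d ->
  (energy 0 1 d <= (2 * drop_energy m)%:E)%E -> (forall t, is_derive t 1 S (speed d t)) ->
  exists e al p s, [/\ e = 1 \/ e = -1,
    (forall t, S (t + 1) = S t + 2 * (scale m * reduced_length m (pi / 2))) &
    forall t, exists2 x, scale m * reduced_length m x = S t - S s &
      d t = rigid e al p (wave m x)].
Proof.
move=> /self_intersecting_ordered[s1 [s2 [s0 s12 s21 ds]]] le dS.
have ab : (-1 : R) < 3 by lra.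
have [rho [drho [th [om pf]]]] := exists_polar_form ab (cd.2 _ _ ab).
have s2s : s2 < s1 + 1 by lra.
have ds' : d s2 = d (s1 + 1) by rewrite cd.1.
have pf1 : polar_form s1 s2 d rho drho th om by apply: polar_formW pf _ _; lra.
have pf2 : polar_form s2 (s1 + 1) d rho drho th om by apply: polar_formW pf _ _; lra.
have [le1 st1] := drop_bound_and_structure m2 m1 root s12 pf1 ds.
have [le2 st2] := drop_bound_and_structure m2 m1 root s2s pf2 ds'.
move: le; rewrite (closed_energy_split cd pf s0 s12 s21) (energy_drop s12 pf1) (energy_drop s2s pf2).
rewrite -EFinD lee_fin => le.
have {st1}[e1 [al1 [b1 [psi [h1 [cb1 b10] [ta1 tb1] [psia psib] psiP]]]]] := st1 ltac:(lra).
have {st2}[e2 [al2 [b2 [chi [h2 [cb2 b20] [ta2 tb2] [chia chib] chiP]]]]] := st2 ltac:(lra).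
have bE : b2 = b1.
  by apply: cos_inj; rewrite ?in_itv/=; [case/andP: b20 => *; rewrite !ltW|
    case/andP: b10 => *; rewrite !ltW|rewrite cb1 cb2].
rewrite {}bE in ta2 tb2 cb2 b20.
(* The tangent directions at the two ends agree, the angles only up to full turns. *)
have [n nE] : exists n : int, th (s1 + 1) = th s1 + n%:~R * (2 * pi).
  have i1 : -1 < s1 < 3 by apply/andP; split; lra.
  have i2 : -1 < s1 + 1 < 3 by apply/andP; split; lra.
  have r0 : rho s1 != 0 by rewrite gt_eqF// (polar_gt0 pf)//; apply/andP; split; lra.
  have := velocity_periodic cd.1 s1; rewrite (polar_velocity pf i1) (polar_velocity pf i2).
  rewrite -(polar_speed pf i1) -(polar_speed pf i2) speed_periodic; last exact: cd.1.
  rewrite (polar_speed pf i1) => -[/(mulfI r0) eC /(mulfI r0) eS].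
  exact: eq_angle.
have [e2E alE] : e2 = - e1 /\ al2 = al1.
  apply: (@opposite_loops m e1 e2 al1 al2 b1 n) => //.
  - by rewrite -tb1 ta2.
  - by rewrite -tb2 nE ta1.
have p1 := arclength_polar (ltW s12) pf1 dS.
have p2 := arclength_polar (ltW s2s) pf2 dS.
have A t : s1 <= t <= s2 -> scale m * reduced_length m (psi t) = S t - S s1.
  by move=> tab; have [_ -> _] := psiP _ tab; rewrite p1.2//; ring.
have B t : s2 <= t <= s1 + 1 -> scale m * reduced_length m (chi t) = S t - S s2.
  by move=> tab; have [_ -> _] := chiP _ tab; rewrite p2.2//; ring.
have As2 : scale m * reduced_length m (pi / 2) = S s2 - S s1.
  by rewrite -psib A// lexx ltW.
have Bs1 : scale m * reduced_length m (pi / 2) = S (s1 + 1) - S s2.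
  by rewrite -chib B// lexx ltW.
have Sper t : S (t + 1) = S t + 2 * (scale m * reduced_length m (pi / 2)).
  have : S (t + 1) - S t = S (s1 + 1) - S s1.
    apply: (@is_derive_0_is_cst R (fun t => S (t + 1) - S t)) => u.
    apply: (der_eq (derB (@der_comp _ S (fun t => t + 1) u _ _ (dS (u + 1))
      (derD (derI u) (derC 1 u))) (dS u))).
    by rewrite (speed_periodic cd.1) addr0 mulr1 subrr.
  by lra.
exists e1, al1, (d s1), s1; split=> //.
apply: (@periodic_ind R _ s1) => t.
  split=> -[x xS dx].
    exists (x + 2 * pi); last by rewrite waveD2pi// cd.1.
    by rewrite reduced_lengthD2pi// Sper mulrDr xS; ring.
  exists (x - 2 * pi).
    have := reduced_lengthD2pi (x - 2 * pi) m1; rewrite subrK => E.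
    by move: xS; rewrite E Sper mulrDr; lra.
  by rewrite -cd.1 dx -(waveD2pi m1 root (x - 2 * pi)) subrK.
move=> /andP[t1 t2]; have [ts|ts] := leP t s2.
  have tab : s1 <= t <= s2 by rewrite t1.
  by exists (psi t); [exact: A|have [_ _ ->] := psiP _ tab].
have tab : s2 <= t <= s1 + 1 by rewrite !ltW.
(* The second loop is a reflected half wave starting from the same double point, that is, the half
   of the wave from [pi / 2] to [3 pi / 2]. *)
exists (chi t + pi).
  by rewrite reduced_lengthDpi// mulrDr B// As2; ring.
by have [_ _ ->] := chiP _ tab; rewrite -ds alE e2E rigid_flip.
Qed.

End Uniqueness.

Section AmplitudeUniqueness.
Context c (fc : figure_eight c) (m al : R) (p : R * R) (phi : R -> R)
  (ap : amplitude c m al p phi).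
Let m2 : 1 / 2 < m. Proof. exact: amplitude_half ap. Qed.
Let m1 : m < 1. Proof. exact: amplitude_lt1 ap. Qed.
Let root : abscissa m (pi / 2) = 0. Proof. exact: amplitude_root ap. Qed.

Lemma figure_eight_minimizer :
  minimizer (fun d => closed_curve d /\ self_intersecting d) (energy 0 1) c.
Proof.
split; first by split; [exact: figure_eight_closed_curve|have [] := fc].
by move=> d [cd sd]; rewrite (figure_eight_energy fc ap); exact: closed_energy_ge.
Qed.

Lemma figure_eight_unique d :
  minimizer (fun d => closed_curve d /\ self_intersecting d) (energy 0 1) d ->
  closed_congruent c d.
Proof.
move=> [[cd sd] /(_ _ figure_eight_minimizer.1)]; rewrite (figure_eight_energy fc ap) => le.
have [ec _ _ _] := fc; have [_ _ v0 _] := ec.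
have a0 : 0 < scale m by exact: scale_gt0.
have an : scale m != 0 by rewrite gt_eqF.
have [T dT] := exists_antiderivative (closed_speed_continuous cd).
have [e [be [q [s [he Tper dP]]]]] := closed_minimizer_wave cd m2 m1 root sd le dT.
have [S [G [dq [dS [SG GS] dG dQ cdq]]]] := exists_arclength_inverse ec.
have [_ dL] := reduced_lengthP m1.
have SE t : scale m * reduced_length m (phi t) - S t = scale m * reduced_length m (phi 0) - S 0.
  apply: (@is_derive_0_is_cst R (fun t => scale m * reduced_length m (phi t) - S t)) => u.
  apply: (der_eq (derB (derZ (scale m) (der_comp (dL (phi u)) (amplitude_derive ap u))) (dS u))).
  have := delta_neq0 (phi u) m1; move: (delta m _) (speed c u) => D r Dn.
  by field; rewrite an Dn.
set K := scale m * reduced_length m (phi 0) - S 0 in SE.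
(* The constant [K] matches the time [s] of [d] with the arclength at which the amplitude of [c] is
   [- (pi / 2)]. *)
pose L t := T t - T s - K.
have dLd t : is_derive t 1 L (speed d t).
  by apply: (der_eq (derB (derB (dT t) (derC (T s) t)) (derC K t))); rewrite !subr0.
have phiG t x : scale m * reduced_length m x = T t - T s -> phi (G (L t)) = x.
  move=> xE; apply: (reduced_length_inj ap); apply: (mulfI an); rewrite xE.
  by have := SE (G (L t)); rewrite GS /L; lra.
have Sper t : S (t + 1) = S t + 2 * (scale m * reduced_length m (pi / 2)).
  by have := SE (t + 1); rewrite (amplitude_period ap) reduced_lengthD2pi// -(SE t) mulrDr; lra.
have [Phi iPhi PhiE] := exists_isometry al p be q (or_introl erefl) he.
exists Phi, (G \o L); split=> //.
- split.
    left=> t; apply: (can_inj SG); rewrite /= Sper !GS /L Tper; ring.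
  move=> a b ab; have ab' : a - 1 < b + 1 by lra.
  have [rho [drho [th [om pf']]]] := exists_polar_form ab' (cd.2 _ _ ab').
  have pf : polar_form a b d rho drho th om by apply: polar_formW pf' _ _; lra.
  have pL := arclength_polar (ltW ab) pf dLd.
  exists (fun t => (speed c (G (L t)))^-1 * rho t); split.
    exact: (H2_arclength_change (ltW ab) pf pL dG dQ cdq).
  move=> t tab; apply/eqP; rewrite mulf_neq0 ?invr_neq0 ?gt_eqF ?(polar_gt0 pf)//.
  exact: speed_gt0.
- move=> t; have [x xE ->] := dP t.
  by rewrite /= (amplitude_curve ap) PhiE (phiG _ _ xE).
Qed.

End AmplitudeUniqueness.

End FigureEightMinimizes.

(** The figure eight is given by a predicate; the existence clause ensures that the statement about
    all of them is not vacuous. *)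
Theorem proposition4p8 (R : realType) :
  (exists F8 : R -> R * R, figure_eight F8) /\
  forall F8 : R -> R * R, figure_eight F8 ->
    unique_minimizer_up_to closed_congruent
      (fun c => closed_curve c /\ self_intersecting c) (energy 0 1) F8 /\
    forall D : R -> R * R, loop_of F8 D ->
      unique_minimizer_up_to drop_congruent is_drop (energy 0 1) D.
Proof.
split.
  have [m [m2 m1 root]] := @exists_modulus R.
  by exists (fun t => wave m (2 * pi * t)); exact: eight_figure_eight.
move=> F8 fF8; have [m [al [p [phi ap]]]] := figure_eight_amplitude fF8.
split.
  by split; [exact: figure_eight_minimizer ap|exact: figure_eight_unique ap].
move=> D [s1 [s2 [s12 cs DE]]].
have -> : D = fun t => F8 (s1 + t * (s2 - s1)) by exact/funext.
by split; [exact: (loop_minimizer fF8 ap s12 cs)|exact: (loop_unique fF8 ap s12 cs)].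
Qed.
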